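(* Given a set $\mathcal{D}$ of $n$ disks in the plane and $\epsilon>0$, one can compute in $O(n+1/\epsilon^3)$ time two congruent disks $C_1,C_2$ of common radius $r$ with $\bigcup_{D\in\mathcal{D}}D\subseteq C_1\cup C_2$ and $r\le(1+\epsilon)r^*$, where $r^*$ is the smallest radius $\rho$ such that there exist two disks of radius $\rho$ whose union contains $\bigcup_{D\in\mathcal{D}}D$.
   Context: Disks are closed disks in the plane given by center and radius; computations are in the real-RAM model (with the floor function available). The paper assumes throughout that no disk of $\mathcal{D}$ contains another disk of $\mathcal{D}$. *)

(* Defs.v *)
From Stdlib Require Import Reals List Lra.
Import ListNotations.
Open Scope R_scope.

Record disk := Disk { dx : R ; dy : R ; dr : R }.

Definition in_disk (D : disk) (px py : R) : Prop :=
  (px - dx D) ^ 2 + (py - dy D) ^ 2 <= (dr D) ^ 2.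

Definition disk_subset (D E : disk) : Prop :=
  forall px py, in_disk D px py -> in_disk E px py.

Definition no_containment (Ds : list disk) : Prop :=
  forall i j d, i <> j -> (i < length Ds)%nat -> (j < length Ds)%nat ->
    ~ disk_subset (nth i Ds d) (nth j Ds d).

Definition covers2 (Ds : list disk) (C1 C2 : disk) : Prop :=
  forall px py, (exists D, In D Ds /\ in_disk D px py) ->
    in_disk C1 px py \/ in_disk C2 px py.

Definition two_cover_radius (Ds : list disk) (rho : R) : Prop :=
  0 <= rho /\ exists x1 y1 x2 y2,
    covers2 Ds (Disk x1 y1 rho) (Disk x2 y2 rho).

Definition is_opt_two_cover_radius (Ds : list disk) (rstar : R) : Prop :=
  two_cover_radius Ds rstar /\
  forall rho, two_cover_radius Ds rho -> rstar <= rho.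

Inductive instr :=
| IConst (i : nat) (z : Z)
| IAdd   (i j k : nat)
| ISub   (i j k : nat)
| IMul   (i j k : nat)
| IDiv   (i j k : nat)
| ISqrt  (i j : nat)
| IFloor (i j : nat)
| ILoad  (i j : nat)
| IStore (i j : nat)
| IJlt   (i j l : nat)
| IJmp   (l : nat)
| IHalt.

Definition program := list instr.
Definition mem := nat -> R.

Definition upd (M : mem) (a : nat) (v : R) : mem :=
  fun b => if Nat.eqb b a then v else M b.

(* floor, as an integer; Int_part r = up r - 1 = floor r *)
Definition rfloor (r : R) : R := IZR (Int_part r).
Definition addr (r : R) : nat := Z.to_nat (Int_part r).

Definition config := (nat * mem)%type.

Inductive step (P : program) : config -> config -> Prop :=
| SConst pc M i z : nth_error P pc = Some (IConst i z) ->
    step P (pc, M) (S pc, upd M i (IZR z))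
| SAdd pc M i j k : nth_error P pc = Some (IAdd i j k) ->
    step P (pc, M) (S pc, upd M i (M j + M k))
| SSub pc M i j k : nth_error P pc = Some (ISub i j k) ->
    step P (pc, M) (S pc, upd M i (M j - M k))
| SMul pc M i j k : nth_error P pc = Some (IMul i j k) ->
    step P (pc, M) (S pc, upd M i (M j * M k))
| SDiv pc M i j k : nth_error P pc = Some (IDiv i j k) -> M k <> 0 ->
    step P (pc, M) (S pc, upd M i (M j / M k))
| SSqrt pc M i j : nth_error P pc = Some (ISqrt i j) -> 0 <= M j ->
    step P (pc, M) (S pc, upd M i (sqrt (M j)))
| SFloor pc M i j : nth_error P pc = Some (IFloor i j) ->
    step P (pc, M) (S pc, upd M i (rfloor (M j)))
| SLoad pc M i j : nth_error P pc = Some (ILoad i j) -> 0 <= M j ->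
    step P (pc, M) (S pc, upd M i (M (addr (M j))))
| SStore pc M i j : nth_error P pc = Some (IStore i j) -> 0 <= M i ->
    step P (pc, M) (S pc, upd M (addr (M i)) (M j))
| SJltT pc M i j l : nth_error P pc = Some (IJlt i j l) -> M i < M j ->
    step P (pc, M) (l, M)
| SJltF pc M i j l : nth_error P pc = Some (IJlt i j l) -> ~ (M i < M j) ->
    step P (pc, M) (S pc, M)
| SJmp pc M l : nth_error P pc = Some (IJmp l) ->
    step P (pc, M) (l, M).

Definition halted (P : program) (c : config) : Prop :=
  nth_error P (fst c) = Some IHalt \/ nth_error P (fst c) = None.

Inductive steps (P : program) : nat -> config -> config -> Prop :=
| steps0 c : steps P 0 c c
| stepsS k c c' c'' : step P c c' -> steps P k c' c'' -> steps P (S k) c c''.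

Definition runs_to (P : program) (M0 : mem) (k : nat) (M : mem) : Prop :=
  exists pc, steps P k (0%nat, M0) (pc, M) /\ halted P (pc, M).

(* Input encoding: M[0] = n, M[1] = eps, and for the i-th disk
   M[2+3i] = x_i, M[3+3i] = y_i, M[4+3i] = r_i; all other cells are 0. *)
Definition input_mem (Ds : list disk) (eps : R) : mem :=
  fun a =>
    match a with
    | O => INR (length Ds)
    | S O => eps
    | S (S b) =>
        match nth_error Ds (b / 3) with
        | None => 0
        | Some D =>
            match (b mod 3)%nat with
            | O => dx D
            | S O => dy D
            | _ => dr D
            end
        end
    end.

Definition out_disk1 (M : mem) : disk := Disk (M 0%nat) (M 1%nat) (M 2%nat).
Definition out_disk2 (M : mem) : disk := Disk (M 3%nat) (M 4%nat) (M 5%nat).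

(* Main.v *)
Require Import Defs.
From Stdlib Require Import Reals List Lra Lia ZArith Psatz Classical.
Import ListNotations.
Open Scope R_scope.

(* Write [n] for the number of disks and [N] for about [1000 / eps].  Farthest
   point clustering on the centers gives [p1], [p2] and, in linear time, a radius
   [R0 <= 4 r*] such that the disks of radius [R0] around [p1] and [p2] cover
   everything.  If [p1] and [p2] are farther apart than [5 R0], no disk of radius
   [R0] meets both clusters, so the second one can be translated to distance
   [5 R0]; hence all disks may be assumed to lie in a square of side [12 R0], which
   is scaled to [12 N].

   The union of the disks is rasterized in time [n + N^3]: in each grid cell only
   the largest disk centered there matters, and the set of grid points covered by
   the enlarged disks is given by the maximum over cells [(k, l)] of
   [Q(k, l) - (i - k)^2 - (j - l)^2], computed one coordinate at a time.

   The bisector of the two centers splits the points covered by an optimal pair of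
   disks, and its normal can be replaced by one of [2 N + 1] unit vectors.  For a
   fixed direction and a fixed radius [r], only the top and the bottom point of
   each of the [52 N + 1] columns matter; for each of the [78 N + 1] ordinates, one
   scan that maintains the interval of the admissible abscissas finds the longest
   prefix of columns that fits into a disk of radius [r].  Directions and radii are
   explored along a staircase: after a success [r] decreases by 1, after a failure
   the next direction is tried.  Thus [3 N] trials of cost [N^2] suffice, without
   the logarithmic factor of a binary search. *)

(** * A structured language for the real RAM *)

(** Error budget, with the grid cell, of side [R0 / N <= 4 r* / N], as the unit. Replacing the disks
    by grid points costs an optimal cover 4, replacing its bisector by a chosen direction and a
    boundary between columns costs 122, and rounding abscissas and the ordinate of a center costs 2;
    an accepted radius r gives a true cover of radius r + 3, and radii decrease in steps of 1. The
    total of 132 cells is at most [528 r* / N], hence at most [eps r*]. All losses are constant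
    numbers of cells, which is why O(1 / eps) directions, columns, ordinates and radii are enough.

    Two facts carry the staircase. For a fixed direction and radius, the longest prefix and the
    longest suffix of columns are found independently, and together they cover as soon as their
    lengths add up to the number of columns. A direction refuted for r is refuted for every smaller
    radius, so it is never revisited.

    Since the time bound concerns a concrete machine, the algorithm is written in a structured
    language whose compiler is verified once; its cost is then a polynomial in n and N. *)

Inductive aop := OAdd | OSub | OMul.

Inductive expr :=
| Cst (z : Z)
| Var (v : nat)
| ParDisks
| ParGrid
| Bin (o : aop) (e1 e2 : expr)
| Div (e1 e2 : expr)
| Sqr (e : expr)
| Flr (e : expr)
| Get (a : nat) (e : expr).

(* [For v bn bN bc c] runs [c] for v = 0, 1, ..., bn * n + bN * N + bc - 1. *)
Inductive cmd :=
| Skip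
| Set_ (v : nat) (e : expr)
| Put (a : nat) (e1 e2 : expr)
| Seq (c1 c2 : cmd)
| If (e1 e2 : expr) (c1 c2 : cmd)
| For (v bn bN bc : nat) (c : cmd).

Record state := State { sc : nat -> R; ar : nat -> nat -> R }.

Definition set_sc (s : state) v x :=
  State (fun w => if Nat.eqb w v then x else sc s w) (ar s).
Definition set_ar (s : state) a i x :=
  State (sc s) (fun b j => if (Nat.eqb b a && Nat.eqb j i)%bool then x else ar s b j).

(** The absolute value makes every index legal, so that array accesses need no test; the machine
    obtains it as the square root of the squared floor. *)
Definition ridx (x : R) : nat := Z.abs_nat (Int_part x).

Definition aop_eval (o : aop) (x y : R) : R :=
  match o with OAdd => x + y | OSub => x - y | OMul => x * y end.

(* Division and square root are made total without a test, so that expressions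
   compile to straight-line code: the term added to [y] is 1 if [y = 0], else 0,
   and [Sqr] takes the square root of the absolute value. *)
Definition safe_div (x y : R) : R := x / (y + rfloor (1 / (y * y + 1))).

Fixpoint eval_expr (n N : nat) (s : state) (e : expr) : R :=
  match e with
  | Cst z => IZR z
  | Var v => sc s v
  | ParDisks => INR n
  | ParGrid => INR N
  | Bin o e1 e2 => aop_eval o (eval_expr n N s e1) (eval_expr n N s e2)
  | Div e1 e2 => safe_div (eval_expr n N s e1) (eval_expr n N s e2)
  | Sqr e => sqrt (sqrt (eval_expr n N s e * eval_expr n N s e))
  | Flr e => rfloor (eval_expr n N s e)
  | Get a e => ar s a (ridx (eval_expr n N s e))
  end.

Fixpoint loop (k : nat) (f : nat -> state -> state) (s : state) : state :=
  match k with O => s | S k => f k (loop k f s) end.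

Fixpoint run_cmd (n N : nat) (c : cmd) (s : state) : state :=
  match c with
  | Skip => s
  | Set_ v e => set_sc s v (eval_expr n N s e)
  | Put a e1 e2 => set_ar s a (ridx (eval_expr n N s e1)) (eval_expr n N s e2)
  | Seq c1 c2 => run_cmd n N c2 (run_cmd n N c1 s)
  | If e1 e2 c1 c2 =>
      if Rlt_dec (eval_expr n N s e1) (eval_expr n N s e2) then run_cmd n N c1 s else run_cmd n N c2 s
  | For v bn bN bc c =>
      loop (bn * n + bN * N + bc) (fun i s => run_cmd n N c (set_sc s v (INR i))) s
  end.

(* Registers below 50 hold scalars; 50, 51, 52 hold the base address, n and N;
   registers from 53 on are temporaries.  Entry i of array a < 6 is at
   base + 6 * i + a. *)
Definition address (t a : nat) : list instr :=
  [IFloor t t; IMul t t t; ISqrt t t; IConst (t + 2) 6; IMul t t (t + 2);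
   IAdd t t 50; IConst (t + 2) (Z.of_nat a); IAdd t t (t + 2)].

Definition aop_instr (o : aop) : nat -> nat -> nat -> instr :=
  match o with OAdd => IAdd | OSub => ISub | OMul => IMul end.

Fixpoint ecomp (t : nat) (e : expr) : list instr :=
  match e with
  | Cst z => [IConst t z]
  | Var v => [IConst t 0; IAdd t v t]
  | ParDisks => [IConst t 0; IAdd t 51 t]
  | ParGrid => [IConst t 0; IAdd t 52 t]
  | Bin o e1 e2 => ecomp t e1 ++ ecomp (t + 1) e2 ++ [aop_instr o t t (t + 1)]
  | Div e1 e2 => ecomp t e1 ++ ecomp (t + 1) e2 ++
      [IMul (t + 2) (t + 1) (t + 1); IConst (t + 3) 1; IAdd (t + 2) (t + 2) (t + 3);
       IDiv (t + 2) (t + 3) (t + 2); IFloor (t + 2) (t + 2);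
       IAdd (t + 1) (t + 1) (t + 2); IDiv t t (t + 1)]
  | Sqr e => ecomp t e ++ [IMul t t t; ISqrt t t; ISqrt t t]
  | Flr e => ecomp t e ++ [IFloor t t]
  | Get a e => ecomp t e ++ address t a ++ [ILoad t t]
  end.

(** The bound 100 leaves room for the scratch registers [t + 1] to [t + 3] below 128, where the
    arrays may begin. *)
Fixpoint ewf (t : nat) (e : expr) : bool :=
  match e with
  | Cst _ | ParDisks | ParGrid => (t <? 100)%nat
  | Var v => (t <? 100)%nat && (v <? 50)%nat
  | Bin _ e1 e2 | Div e1 e2 => (t <? 100)%nat && ewf t e1 && ewf (t + 1) e2
  | Sqr e | Flr e => (t <? 100)%nat && ewf t e
  | Get a e => (t <? 100)%nat && (a <? 6)%nat && ewf t e
  end%bool.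

(** Jump targets are absolute, hence [pc]. A loop keeps its counter and its bound in [t] and [t + 1]
    and copies the counter into [v]; the body is compiled from [t + 2] on, so it cannot disturb the
    count even if it writes [v]. *)
Fixpoint ccomp (t pc : nat) (c : cmd) : list instr :=
  match c with
  | Skip => []
  | Set_ v e => ecomp t e ++ [IConst (t + 1) 0; IAdd v t (t + 1)]
  | Put a e1 e2 =>
      ecomp t e2 ++ ecomp (t + 1) e1 ++ address (t + 1) a ++ [IStore (t + 1) t]
  | Seq c1 c2 => let l1 := ccomp t pc c1 in l1 ++ ccomp t (pc + length l1) c2
  | If e1 e2 c1 c2 =>
      let l := ecomp t e1 ++ ecomp (t + 1) e2 in
      let p := (pc + length l + 1)%nat in
      let l2 := ccomp t p c2 in
      let p1 := (p + length l2 + 1)%nat in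
      let l1 := ccomp t p1 c1 in
      l ++ [IJlt t (t + 1) p1] ++ l2 ++ [IJmp (p1 + length l1)] ++ l1
  | For v bn bN bc c =>
      let l := ccomp (t + 2) (pc + 12) c in
      [IConst t 0; IConst (t + 1) (Z.of_nat bc);
       IConst (t + 2) (Z.of_nat bn); IMul (t + 2) (t + 2) 51; IAdd (t + 1) (t + 1) (t + 2);
       IConst (t + 2) (Z.of_nat bN); IMul (t + 2) (t + 2) 52; IAdd (t + 1) (t + 1) (t + 2);
       IJlt t (t + 1) (pc + 10); IJmp (pc + 12 + length l + 3);
       IConst (t + 2) 0; IAdd v t (t + 2)]
      ++ l ++ [IConst (t + 2) 1; IAdd t t (t + 2); IJmp (pc + 8)]
  end.

Fixpoint cwf (t : nat) (c : cmd) : bool :=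
  match c with
  | Skip => true
  | Set_ v e => (v <? 50)%nat && ewf t e
  | Put a e1 e2 => (a <? 6)%nat && ewf t e2 && ewf (t + 1) e1
  | Seq c1 c2 => cwf t c1 && cwf t c2
  | If e1 e2 c1 c2 => ewf t e1 && ewf (t + 1) e2 && cwf t c1 && cwf t c2
  | For v _ _ _ c => (t <? 100)%nat && (v <? 50)%nat && cwf (t + 2) c
  end%bool.

(** A conditional is charged for both branches: the bound then involves neither the state nor a
    maximum and stays a polynomial in [n] and [N]. *)
Fixpoint ccost (n N : nat) (c : cmd) : nat :=
  match c with
  | Skip => 0
  | Set_ v e => length (ecomp 0 e) + 2
  | Put a e1 e2 => length (ecomp 0 e2) + length (ecomp 0 e1) + 9
  | Seq c1 c2 => ccost n N c1 + ccost n N c2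
  | If e1 e2 c1 c2 =>
      length (ecomp 0 e1) + length (ecomp 0 e2) + 2 + (ccost n N c1 + ccost n N c2)
  | For v bn bN bc c => 10 + (bn * n + bN * N + bc) * (6 + ccost n N c)
  end.

(** * Correctness of the compilation *)

Lemma steps_app P k1 k2 c1 c2 c3 :
  steps P k1 c1 c2 -> steps P k2 c2 c3 -> steps P (k1 + k2) c1 c3.
Proof. induction 1; simpl; eauto using steps. Qed.

Lemma steps_one P c1 c2 : step P c1 c2 -> steps P 1 c1 c2.
Proof. eauto using steps. Qed.

Definition code_at (P : program) (pc : nat) (l : list instr) : Prop :=
  exists pre post, P = pre ++ l ++ post /\ length pre = pc.

Lemma code_at_app P pc l1 l2 :
  code_at P pc (l1 ++ l2) -> code_at P pc l1 /\ code_at P (pc + length l1) l2.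
Proof.
  intros (pre & post & -> & <-). split.
  - exists pre, (l2 ++ post). now rewrite <- app_assoc.
  - exists (pre ++ l1), post. now rewrite length_app, <- !app_assoc.
Qed.

Lemma code_at_sub P pc l i k :
  (i <= length l)%nat -> code_at P pc l -> code_at P (pc + i) (firstn k (skipn i l)).
Proof.
  intros L H. rewrite <- (firstn_skipn i l) in H. apply code_at_app in H as [_ H].
  rewrite length_firstn, Nat.min_l in H by lia.
  rewrite <- (firstn_skipn k (skipn i l)) in H. now apply code_at_app in H as [H _].
Qed.

Lemma code_at_nth P pc l i x :
  code_at P pc l -> nth_error l i = Some x -> nth_error P (pc + i) = Some x.
Proof.
  intros (pre & post & -> & <-) H.
  rewrite nth_error_app2 by lia.
  replace (length pre + i - length pre)%nat with i by lia.
  rewrite nth_error_app1; [easy|]. apply nth_error_Some. congruence.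
Qed.

(** Straight-line code is run by a function, so that compiled expressions are verified by
    computation; [ok1] collects the side conditions and excludes jumps. *)
Definition exec1 (I : instr) (M : mem) : mem :=
  match I with
  | IConst i z => upd M i (IZR z)
  | IAdd i j k => upd M i (M j + M k)
  | ISub i j k => upd M i (M j - M k)
  | IMul i j k => upd M i (M j * M k)
  | IDiv i j k => upd M i (M j / M k)
  | ISqrt i j => upd M i (sqrt (M j))
  | IFloor i j => upd M i (rfloor (M j))
  | ILoad i j => upd M i (M (addr (M j)))
  | IStore i j => upd M (addr (M i)) (M j)
  | _ => M
  end.

Definition ok1 (I : instr) (M : mem) : Prop :=
  match I with
  | IDiv i j k => M k <> 0
  | ISqrt i j | ILoad i j => 0 <= M j
  | IStore i j => 0 <= M i
  | IJlt _ _ _ | IJmp _ | IHalt => False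
  | _ => True
  end.

Fixpoint exec (l : list instr) (M : mem) : mem :=
  match l with [] => M | x :: l => exec l (exec1 x M) end.

Fixpoint okl (l : list instr) (M : mem) : Prop :=
  match l with [] => True | x :: l => ok1 x M /\ okl l (exec1 x M) end.

Lemma exec_app l1 l2 M : exec (l1 ++ l2) M = exec l2 (exec l1 M).
Proof. revert M. induction l1; simpl; auto. Qed.

Lemma okl_app l1 l2 M : okl l1 M -> okl l2 (exec l1 M) -> okl (l1 ++ l2) M.
Proof. revert M. induction l1; simpl; auto. intros M [? ?] ?. auto. Qed.

Lemma exec_steps P l pc M :
  code_at P pc l -> okl l M -> steps P (length l) (pc, M) ((pc + length l)%nat, exec l M).
Proof.
  revert pc M. induction l as [|I l IH]; intros pc M H Hok; simpl in *.
  - rewrite Nat.add_0_r. constructor.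
  - destruct Hok as [H1 H2].
    assert (E : nth_error P pc = Some I).
    { rewrite <- (Nat.add_0_r pc). now apply code_at_nth with (1 := H). }
    apply steps_app with (k1 := 1%nat) (c2 := (S pc, exec1 I M)).
    + apply steps_one. destruct I; simpl in *; try tauto; now constructor.
    + replace (pc + S (length l))%nat with (S pc + length l)%nat by lia.
      apply IH; auto.
      apply (code_at_app P pc [I] l) in H. simpl in H.
      now rewrite Nat.add_1_r in H.
Qed.

Definition agree (t : nat) (M M' : mem) : Prop :=
  forall r, ~ (t <= r < 128)%nat -> M' r = M r.

Lemma agree_trans t t' M1 M2 M3 :
  (t <= t')%nat -> agree t M1 M2 -> agree t' M2 M3 -> agree t M1 M3.
Proof. intros L H1 H2 r Hr. rewrite H2, H1; auto. lia. Qed.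

Record rel (base n N : nat) (s : state) (M : mem) : Prop := {
  rel_base : M 50%nat = INR base;
  rel_n : M 51%nat = INR n;
  rel_N : M 52%nat = INR N;
  rel_sc : forall v, (v < 50)%nat -> M v = sc s v;
  rel_ar : forall a i, (a < 6)%nat -> M (base + 6 * i + a)%nat = ar s a i;
  rel_128 : (128 <= base)%nat
}.

Lemma rel_agree base n N s M M' t :
  rel base n N s M -> agree t M M' -> (53 <= t)%nat -> rel base n N s M'.
Proof.
  intros [] A Ht. constructor; try rewrite A by lia; auto.
  - intros v Hv. rewrite A by lia. auto.
  - intros a i Ha. rewrite A by lia. auto.
Qed.

Lemma upd_eq M a x : upd M a x a = x.
Proof. unfold upd. now rewrite Nat.eqb_refl. Qed.

Lemma upd_neq M a b x : b <> a -> upd M a x b = M b.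
Proof. unfold upd. intros H. now apply Nat.eqb_neq in H as ->. Qed.

Lemma Int_part_spec r z : IZR z <= r < IZR z + 1 -> Int_part r = z.
Proof.
  intros H. destruct (base_Int_part r) as [H1 H2].
  assert (A : IZR (Int_part r) < IZR (z + 1)) by (rewrite plus_IZR; lra).
  assert (B : IZR z < IZR (Int_part r + 1)) by (rewrite plus_IZR; lra).
  apply lt_IZR in A, B. lia.
Qed.

Lemma Int_part_INR k : Int_part (INR k) = Z.of_nat k.
Proof. apply Int_part_spec. rewrite INR_IZR_INZ. lra. Qed.

Lemma addr_INR k : addr (INR k) = k.
Proof. unfold addr. rewrite Int_part_INR. lia. Qed.

Lemma ridx_INR k : ridx (INR k) = k.
Proof. unfold ridx. rewrite Int_part_INR. lia. Qed.

Lemma sqrt_rfloor_sq x : sqrt (rfloor x * rfloor x) = INR (ridx x).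
Proof.
  unfold rfloor, ridx. rewrite INR_IZR_INZ, Zabs2Nat.id_abs, abs_IZR.
  apply (sqrt_Rsqr_abs (IZR (Int_part x))).
Qed.

Ltac upds := repeat (rewrite upd_eq || rewrite upd_neq by lia).

Lemma address_ok base n N s M t a :
  rel base n N s M -> (53 <= t)%nat -> (t < 100)%nat ->
  okl (address t a) M /\
  exec (address t a) M t = INR (base + 6 * ridx (M t) + a) /\
  forall r, r <> t -> r <> (t + 2)%nat -> exec (address t a) M r = M r.
Proof.
  intros H Ht Ht'. unfold address. cbn [okl ok1 exec exec1]. repeat split.
  - upds. nra.
  - upds. rewrite sqrt_rfloor_sq, (rel_base _ _ _ _ _ H).
    rewrite !plus_INR, mult_INR, <- INR_IZR_INZ, (INR_IZR_INZ 6). simpl Z.of_nat. lra.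
  - intros r R1 R2. upds. auto.
Qed.

Lemma safe_den_neq_0 y : y + rfloor (1 / (y * y + 1)) <> 0.
Proof.
  unfold rfloor. destruct (Req_dec y 0) as [->|Hy].
  - replace (1 / (0 * 0 + 1)) with (INR 1) by (simpl; field).
    rewrite Int_part_INR. simpl. lra.
  - rewrite (Int_part_spec _ 0). { lra. }
    assert (0 < y * y) by nra. split.
    + apply Rlt_le. apply Rdiv_lt_0_compat; lra.
    + apply Rmult_lt_reg_r with (y * y + 1). { lra. } field_simplify; lra.
Qed.

Lemma safe_div_eq x y : y <> 0 -> safe_div x y = x / y.
Proof.
  intros Hy. unfold safe_div, rfloor. rewrite (Int_part_spec _ 0).
  { now rewrite Rplus_0_r. }
  assert (0 < y * y) by nra. split.
  - apply Rlt_le. apply Rdiv_lt_0_compat; lra.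
  - apply Rmult_lt_reg_r with (y * y + 1). { lra. } field_simplify; lra.
Qed.

Ltac bools := repeat match goal with
  | H : (_ && _)%bool = true |- _ => apply andb_prop in H; destruct H
  | H : (_ <? _)%nat = true |- _ => apply Nat.ltb_lt in H
  end.

Lemma ecomp_ok base n N s e : forall t M,
  rel base n N s M -> (53 <= t)%nat -> ewf t e = true ->
  okl (ecomp t e) M /\ exec (ecomp t e) M t = eval_expr n N s e /\
  agree t M (exec (ecomp t e) M).
Proof.
  induction e; intros t M HR Ht Hw; simpl in Hw; bools; cbn [ecomp eval_expr].
  - simpl. repeat split; upds; auto. intros r Hr. upds. auto.
  - simpl. repeat split; upds; auto. { rewrite (rel_sc _ _ _ _ _ HR); auto; lra. }
    intros r Hr. upds. auto.
  - simpl. repeat split; upds; auto. { rewrite (rel_n _ _ _ _ _ HR); auto; lra. }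
    intros r Hr. upds. auto.
  - simpl. repeat split; upds; auto. { rewrite (rel_N _ _ _ _ _ HR); auto; lra. }
    intros r Hr. upds. auto.
  - destruct (IHe1 t M) as (O1 & E1 & A1); auto.
    destruct (IHe2 (t + 1)%nat (exec (ecomp t e1) M)) as (O2 & E2 & A2); auto; try lia.
    { eapply rel_agree; eauto. }
    rewrite !exec_app. repeat split.
    + repeat apply okl_app; auto. destruct o; simpl; auto.
    + rewrite <- E1, <- E2, <- (A2 t) by lia. destruct o; simpl; upds; auto.
    + intros r Hr. rewrite <- A1, <- A2 by lia. destruct o; simpl; upds; auto.
  - destruct (IHe1 t M) as (O1 & E1 & A1); auto.
    destruct (IHe2 (t + 1)%nat (exec (ecomp t e1) M)) as (O2 & E2 & A2); auto; try lia.
    { eapply rel_agree; eauto. }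
    rewrite !exec_app. rewrite <- E1, <- E2, <- (A2 t) by lia.
    repeat split.
    + repeat apply okl_app; auto. simpl. upds. repeat split. { nra. } apply safe_den_neq_0.
    + simpl. upds. reflexivity.
    + intros r Hr. rewrite <- A1, <- A2 by lia. simpl; upds; auto.
  - destruct (IHe t M) as (O1 & E1 & A1); auto.
    rewrite !exec_app. repeat split.
    + repeat apply okl_app; auto. simpl. upds. repeat split. { nra. } apply sqrt_pos.
    + simpl. upds. now rewrite E1.
    + intros r Hr. rewrite <- A1 by lia. simpl; upds; auto.
  - destruct (IHe t M) as (O1 & E1 & A1); auto.
    rewrite !exec_app. repeat split.
    + repeat apply okl_app; simpl; auto.
    + simpl. upds. now rewrite E1.
    + intros r Hr. rewrite <- A1 by lia. simpl; upds; auto.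
  - destruct (IHe t M) as (O1 & E1 & A1); auto.
    destruct (address_ok base n N s (exec (ecomp t e) M) t a) as (O2 & E2 & A2); auto.
    { eapply rel_agree; eauto. }
    rewrite !exec_app. repeat split.
    + repeat apply okl_app; auto. cbn [okl ok1]. rewrite E2. split; auto. apply pos_INR.
    + cbn [exec exec1]. rewrite upd_eq, E2, addr_INR, E1, A2 by (destruct HR; lia).
      rewrite A1 by (destruct HR; lia). now apply rel_ar with (1 := HR).
    + intros r Hr. cbn [exec exec1]. rewrite upd_neq, A2 by lia. apply A1. lia.
Qed.

Lemma length_ecomp e : forall t, length (ecomp t e) = length (ecomp 0 e).
Proof.
  induction e; intros t; simpl; rewrite ?length_app; simpl; auto.
  - now rewrite (IHe1 t), (IHe2 (t + 1)%nat), (IHe2 1%nat).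
  - now rewrite (IHe1 t), (IHe2 (t + 1)%nat), (IHe2 1%nat).
Qed.

Lemma ewf_lt t e : ewf t e = true -> (t < 100)%nat.
Proof. destruct e; simpl; intros; bools; lia. Qed.

Lemma ecomp_steps P base n N s e t pc M :
  rel base n N s M -> (53 <= t)%nat -> ewf t e = true -> code_at P pc (ecomp t e) ->
  exists M', steps P (length (ecomp 0 e)) (pc, M) ((pc + length (ecomp t e))%nat, M') /\
    M' t = eval_expr n N s e /\ agree t M M'.
Proof.
  intros HR Ht Hw Hc. destruct (ecomp_ok base n N s e t M) as (O & E & A); auto.
  exists (exec (ecomp t e) M). split; auto. rewrite <- (length_ecomp e t) at 1.
  now apply exec_steps.
Qed.

(* Unlike [agree t], lets the scalars and the arrays change. *)
Definition keeps (t : nat) (M M' : mem) : Prop :=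
  forall r, (50 <= r < t)%nat -> M' r = M r.

Lemma agree_keeps t t' M M' : agree t M M' -> (t' <= t)%nat -> keeps t' M M'.
Proof. intros A L r Hr. apply A. lia. Qed.

Lemma keeps_trans t M1 M2 M3 : keeps t M1 M2 -> keeps t M2 M3 -> keeps t M1 M3.
Proof. intros H1 H2 r Hr. now rewrite H2, H1. Qed.

Lemma rel_set_sc base n N s M v x :
  rel base n N s M -> (v < 50)%nat -> rel base n N (set_sc s v x) (upd M v x).
Proof.
  intros [] Hv. constructor; upds; auto.
  - intros w Hw. unfold upd; simpl. destruct (Nat.eqb w v); auto.
  - intros a i Ha. upds. auto.
Qed.

Lemma rel_set_ar base n N s M a i x :
  rel base n N s M -> (a < 6)%nat ->
  rel base n N (set_ar s a i x) (upd M (base + 6 * i + a) x).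
Proof.
  intros [] Hv. constructor; upds; auto.
  - intros v Hw. upds. auto.
  - intros b j Hb. unfold upd; cbn [set_ar ar].
    destruct (Nat.eqb_spec b a) as [->|]; cbn [andb].
    + destruct (Nat.eqb_spec j i) as [->|].
      * now rewrite Nat.eqb_refl.
      * destruct (Nat.eqb_spec (base + 6 * j + a) (base + 6 * i + a)); [lia|auto].
    + destruct (Nat.eqb_spec (base + 6 * j + b) (base + 6 * i + a)); [lia|auto].
Qed.

Lemma ccomp_ok P base n N c : forall s t pc M,
  rel base n N s M -> (53 <= t)%nat -> cwf t c = true -> code_at P pc (ccomp t pc c) ->
  exists k M', (k <= ccost n N c)%nat /\
    steps P k (pc, M) ((pc + length (ccomp t pc c))%nat, M') /\
    rel base n N (run_cmd n N c s) M' /\ keeps t M M'.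
Proof.
  induction c; intros s t pc M HR Ht Hw Hc; cbn [ccomp run_cmd ccost cwf] in *; bools.
  - exists 0%nat, M. simpl. rewrite Nat.add_0_r. split; [auto|split; [|split]]; auto.
    { constructor. } now intros r Hr.
  - apply code_at_app in Hc as [Hc1 Hc2].
    destruct (ecomp_steps P base n N s e t pc M) as (M' & S1 & E1 & A1); auto.
    exists (length (ecomp 0 e) + 2)%nat.
    exists (upd (upd M' (t + 1) 0) v (eval_expr n N s e)). split; [auto|split; [|split]].
    + rewrite length_app, Nat.add_assoc. eapply steps_app; [exact S1|].
      replace (upd (upd M' (t + 1) 0) v (eval_expr n N s e)) with
        (exec [IConst (t + 1) 0; IAdd v t (t + 1)] M').
      { apply (exec_steps P _ _ _ Hc2). simpl; auto. }
      simpl. upds. rewrite E1. f_equal. lra.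
    + apply rel_set_sc; auto. apply rel_agree with (M := M) (t := t); auto.
      apply ewf_lt in H0.
      intros r Hr. unfold upd. destruct (Nat.eqb_spec r (t + 1)); [lia|]. now apply A1.
    + intros r Hr. upds. apply A1. lia.
  - assert (Ht' : (t + 1 < 100)%nat) by (eapply ewf_lt; eauto).
    destruct (ecomp_ok base n N s e2 t M) as (O1 & E1 & A1); auto.
    set (M1 := exec (ecomp t e2) M) in *.
    assert (R1 : rel base n N s M1) by (eapply rel_agree; eauto).
    destruct (ecomp_ok base n N s e1 (t + 1) M1) as (O2 & E2 & A2); auto; try lia.
    set (M2 := exec (ecomp (t + 1) e1) M1) in *.
    assert (R2 : rel base n N s M2) by (eapply rel_agree; eauto; lia).
    destruct (address_ok base n N s M2 (t + 1) a) as (O3 & E3 & A3); auto; try lia.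
    set (M3 := exec (address (t + 1) a) M2) in *.
    assert (A4 : agree t M M3).
    { intros r Hr. rewrite A3, A2, A1 by lia. reflexivity. }
    set (l := ecomp t e2 ++ ecomp (t + 1) e1 ++ address (t + 1) a ++ [IStore (t + 1) t]) in *.
    assert (E : exec l M = upd M3 (base + 6 * ridx (eval_expr n N s e1) + a) (eval_expr n N s e2)).
    { unfold l. rewrite !exec_app. cbn [exec exec1]. fold M1. fold M2. fold M3.
      rewrite E3, addr_INR, E2. f_equal. rewrite A3, A2, E1 by lia. reflexivity. }
    exists (length l), (exec l M). split; [|split; [|split]].
    + unfold l. rewrite !length_app, (length_ecomp e2 t), (length_ecomp e1 (t + 1)). simpl. lia.
    + apply exec_steps; auto. unfold l. repeat apply okl_app; auto.
      fold M1. fold M2. fold M3. cbn [okl ok1]. split; auto. rewrite E3. apply pos_INR.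
    + rewrite E. apply rel_set_ar; auto. now apply rel_agree with (M := M) (t := t).
    + intros r Hr. pose proof (rel_128 _ _ _ _ _ HR). rewrite E, upd_neq by lia. apply A4. lia.
  - apply code_at_app in Hc as [Hc1 Hc2].
    destruct (IHc1 s t pc M) as (k1 & M1 & L1 & S1 & R1 & K1); auto.
    destruct (IHc2 (run_cmd n N c1 s) t (pc + length (ccomp t pc c1))%nat M1)
      as (k2 & M2 & L2 & S2 & R2 & K2); auto.
    exists (k1 + k2)%nat, M2. rewrite length_app, Nat.add_assoc.
    split; [lia|split; [|split]]; auto.
    + eapply steps_app; eauto.
    + eapply keeps_trans; eauto.
  - rewrite <- app_assoc in Hc. apply code_at_app in Hc as [Hc1 Hc2].
    apply code_at_app in Hc2 as [Hc2 Hc3].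
    rewrite <- app_assoc, !length_app in *.
    set (l1 := length (ecomp t e1)) in *. set (l2 := length (ecomp (t + 1) e2)) in *.
    set (p := (pc + (l1 + l2) + 1)%nat) in *.
    set (c2' := ccomp t p c2) in *.
    set (p1 := (p + length c2' + 1)%nat) in *.
    set (c1' := ccomp t p1 c1) in *.
    apply code_at_app in Hc3 as [Hc3 Hc4].
    apply code_at_app in Hc4 as [Hc4 Hc5].
    apply code_at_app in Hc5 as [Hc5 Hc6]. simpl length in *.
    destruct (ecomp_steps P base n N s e1 t pc M) as (M1 & S1 & E1 & A1); auto.
    fold l1 in S1.
    assert (R1 : rel base n N s M1) by (eapply rel_agree; eauto; lia).
    destruct (ecomp_steps P base n N s e2 (t + 1) (pc + l1)%nat M1) as (M2 & S2 & E2 & A2);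
      auto; try lia. fold l2 in S2.
    assert (A3 : agree t M M2) by (eapply agree_trans; [|eauto|eauto]; lia).
    assert (R2 : rel base n N s M2) by (eapply rel_agree; eauto; lia).
    assert (E3 : M2 t = eval_expr n N s e1) by (rewrite <- E1; apply A2; lia).
    pose proof (code_at_nth _ _ _ 0 _ Hc3 eq_refl) as J1. rewrite Nat.add_0_r in J1.
    pose proof (code_at_nth _ _ _ 0 _ Hc5 eq_refl) as J2. rewrite Nat.add_0_r in J2.
    replace (pc + l1 + l2 + 1)%nat with p in * by (unfold p; lia).
    replace (p + length c2' + 1)%nat with p1 in * by (unfold p1; lia).
    pose proof (steps_app _ _ _ _ _ _ S1 S2) as S3.
    destruct (Rlt_dec (eval_expr n N s e1) (eval_expr n N s e2)) as [Hlt|Hlt].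
    + destruct (IHc1 s t p1 M2) as (k & M3 & L3 & S4 & R3 & K3); auto.
      exists (length (ecomp 0 e1) + length (ecomp 0 e2) + (1 + k))%nat, M3.
      split; [lia|split; [|split]]; auto.
      * eapply steps_app; [exact S3|]. eapply steps_app.
        { apply steps_one. apply SJltT with (1 := J1). now rewrite E2, E3. }
        fold c1' in S4.
        replace (pc + _)%nat with (p1 + length c1')%nat by (unfold p1, p; lia). exact S4.
      * eapply keeps_trans; eauto. eapply agree_keeps; eauto.
    + destruct (IHc2 s t p M2) as (k & M3 & L3 & S4 & R3 & K3); auto.
      exists (length (ecomp 0 e1) + length (ecomp 0 e2) + (1 + (k + 1)))%nat, M3.
      split; [lia|split; [|split]]; auto.
      * eapply steps_app; [exact S3|]. eapply steps_app.
        { apply steps_one. apply SJltF with (1 := J1). now rewrite E2, E3. }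
        replace (S (pc + l1 + l2)) with p by (unfold p; lia).
        eapply steps_app; [exact S4|]. fold c2'.
        replace (pc + _)%nat with (p1 + length c1')%nat by (unfold p1, p; lia).
        apply steps_one. now constructor.
      * eapply keeps_trans; eauto. eapply agree_keeps; eauto.
  - set (l := ccomp (t + 2) (pc + 12) c) in *.
    set (cnt := (bn * n + bN * N + bc)%nat).
    apply (code_at_app P pc) in Hc as [Hc1 Hc2].
    apply code_at_app in Hc2 as [Hc2 Hc3]. simpl length in Hc2, Hc3.
    set (p := (pc + 12)%nat) in *.
    assert (Hi := Hc1). apply (code_at_sub _ _ _ 0 8) in Hi; [|simpl; lia].
    cbn [firstn skipn] in Hi. rewrite Nat.add_0_r in Hi.
    match type of Hi with code_at _ _ ?x => set (li := x) in * end.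
    assert (Oi : okl li M) by (simpl; tauto).
    pose proof (exec_steps P li pc M Hi Oi) as S0.
    set (M0 := exec li M) in *.
    assert (F : agree t M M0 /\ M0 t = INR 0 /\ M0 (t + 1)%nat = INR cnt).
    { unfold M0, li. simpl. rewrite <- !INR_IZR_INZ. repeat split; upds; auto.
      - intros r Hr. upds. auto.
      - rewrite (rel_n _ _ _ _ _ HR), (rel_N _ _ _ _ _ HR). unfold cnt.
        rewrite !plus_INR, !mult_INR. lra. }
    destruct F as (A0 & C0 & B0).
    assert (R0 : rel base n N s M0) by (eapply rel_agree; eauto).
    pose proof (code_at_nth _ _ _ 8 _ Hc1 eq_refl) as J1.
    pose proof (code_at_nth _ _ _ 9 _ Hc1 eq_refl) as J2.
    assert (Hg : code_at P (pc + 10) [IConst (t + 2) 0; IAdd v t (t + 2)]).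
    { apply (code_at_sub _ _ _ 10 2) in Hc1; [exact Hc1|simpl; lia]. }
    assert (Hend : code_at P (p + length l) [IConst (t + 2) 1; IAdd t t (t + 2)]).
    { apply (code_at_sub _ _ _ 0 2) in Hc3; [|simpl; lia].
      now rewrite Nat.add_0_r in Hc3. }
    pose proof (code_at_nth _ _ _ 2 _ Hc3 eq_refl) as J3.
    set (f := fun (i : nat) (s0 : state) => run_cmd n N c (set_sc s0 v (INR i))).
    (* Invariant at the loop test, located at [pc + 8]. Besides the body, a round costs 6
       instructions: the test, two to copy the counter, two to increment it, and the jump back. *)
    assert (L : forall j, (j <= cnt)%nat -> exists k M',
      (k <= j * (6 + ccost n N c))%nat /\ steps P k ((pc + 8)%nat, M0) ((pc + 8)%nat, M') /\
      rel base n N (loop j f s) M' /\ keeps t M0 M' /\ M' t = INR j /\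
      M' (t + 1)%nat = INR cnt).
    { induction j as [|j IHj]; intros Hj.
      - exists 0%nat, M0. split; [lia|split; [constructor|split; [|split]]]; auto. now intros r Hr.
      - destruct IHj as (k & M1 & Lk & S1 & R1 & K1 & T1 & B1); [lia|].
        set (M2 := exec [IConst (t + 2) 0; IAdd v t (t + 2)] M1).
        assert (S2 : steps P 2 ((pc + 10)%nat, M1) (p, M2)).
        { replace p with (pc + 10 + 2)%nat by (unfold p; lia).
          apply (exec_steps P _ _ _ Hg). simpl; auto. }
        assert (R2 : rel base n N (set_sc (loop j f s) v (INR j)) M2).
        { unfold M2; simpl. upds. rewrite T1, Rplus_0_r. apply rel_set_sc; auto.
          eapply rel_agree with (t := t); eauto. intros r Hr. upds. auto. }
        destruct (IHc _ (t + 2)%nat p M2 R2) as (k2 & M3 & L3 & S3 & R3 & K3); auto; try lia.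
        set (M4 := exec [IConst (t + 2) 1; IAdd t t (t + 2)] M3).
        assert (S4 : steps P 2 ((p + length l)%nat, M3) ((p + length l + 2)%nat, M4)).
        { apply (exec_steps P _ _ _ Hend). simpl; auto. }
        assert (T3 : M3 t = INR j /\ M3 (t + 1)%nat = INR cnt).
        { rewrite !K3 by lia. unfold M2; simpl. upds. auto. }
        exists (k + (1 + (2 + (k2 + (2 + 1)))))%nat, M4. split; [simpl; lia|split; [|split; [|split; [|split]]]].
        + eapply steps_app; [exact S1|]. eapply steps_app.
          { apply steps_one. apply SJltT with (1 := J1). rewrite T1, B1.
            apply lt_INR. lia. }
          eapply steps_app; [exact S2|]. eapply steps_app; [exact S3|].
          eapply steps_app; [exact S4|].
          apply steps_one. now constructor.
        + eapply rel_agree with (t := t); [exact R3| |auto].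
          intros r Hr. unfold M4; simpl. upds. auto.
        + intros r Hr. unfold M4; simpl. upds. rewrite K3 by lia.
          unfold M2; simpl. upds. now apply K1.
        + unfold M4; simpl. upds. destruct T3 as [-> _]. destruct j; simpl; lra.
        + unfold M4; simpl. upds. apply T3. }
    destruct (L cnt) as (k & M1 & Lk & S1 & R1 & K1 & T1 & B1); auto.
    exists (8 + (k + (1 + 1)))%nat, M1. split; [lia|]. split; [|split; auto].
    + eapply steps_app; [exact S0|]. eapply steps_app; [exact S1|]. eapply steps_app.
      * apply steps_one. apply SJltF with (1 := J1). rewrite T1, B1. lra.
      * rewrite !length_app. fold l. simpl length.
        replace (pc + (12 + (length l + 3)))%nat with (p + length l + 3)%nat
          by (unfold p; lia).
        apply steps_one. constructor.
        replace (S (pc + 8)) with (pc + 9)%nat by lia. exact J2.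
    + eapply keeps_trans; [|exact K1]. eapply agree_keeps; eauto.
Qed.

(** * Relocating the input *)

(** The relative error will be 528 / N, so 1000 leaves slack. The 4 keeps N at least 4 for large
    [eps], so that rho <= N gives rho + 4 <= 2 N. *)
Definition grid (eps : R) : nat := (ridx (1000 / eps) + 4)%nat.

(* The input may occupy every cell that the program can name, and a write
   destroys what it overwrites.  The test [eps < n + eps] costs no free cell;
   then cell 0 turns into the pointer 128 n, beyond the input, where cells 1
   to 127 are saved at stride 6.  Here 756 = 6 * 126 and 762 = 6 * 127, and the
   loop that copies the other cells occupies the addresses 278 to 284. *)
Definition prologue : list instr :=
  [IAdd 0 0 1; IJlt 1 0 3; IHalt; ISub 0 0 1]
  ++ (repeat (IAdd 0 0 0) 7 ++ [IStore 0 1; IConst 1 6])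
  ++ flat_map (fun a => [IAdd 0 0 1; IStore 0 a]) (seq 2 126)
  ++ [IConst 2 756; ISub 50 0 2; IConst 4 128; IDiv 51 50 4; IConst 53 128;
      IConst 56 762; IAdd 54 50 56; IConst 55 3; IMul 55 55 51; IConst 56 2;
      IAdd 55 55 56; IConst 56 1; IConst 57 6]
  ++ [IJlt 53 55 280; IJmp 285; ILoad 58 53; IStore 54 58;
      IAdd 53 53 56; IAdd 54 54 57; IJmp 278]
  ++ [ILoad 58 50; IConst 59 1000; IDiv 59 59 58; IFloor 59 59; IConst 60 4;
      IAdd 52 59 60].

Lemma input_mem_beyond Ds eps a :
  (3 * length Ds + 2 <= a)%nat -> input_mem Ds eps a = 0.
Proof.
  intros H. destruct a as [|[|b]]; simpl; try lia.
  destruct (nth_error Ds (fst (Nat.divmod b 2 0 2))) eqn:E; auto.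
  assert (L : (b / 3 < length Ds)%nat) by (apply nth_error_Some; unfold Nat.div; congruence).
  assert (b < 3 * length Ds)%nat; [|lia].
  pose proof (Nat.div_mod_eq b 3). pose proof (Nat.mod_upper_bound b 3). lia.
Qed.

Section Prologue.
Variables (In : mem) (n : nat).
Hypothesis In_beyond : forall a, (3 * n + 2 <= a)%nat -> In a = 0.
Hypothesis n_pos : (1 <= n)%nat.

(** Invariant of the relocation: cells below [lo] have been sacrificed as registers, and [j] is the
    last entry of array 0 in place. The zeros beyond [128 * n] become the initial contents of the
    other five arrays. *)
Definition copied (lo j : nat) (M : mem) : Prop :=
  (forall r, (lo <= r < 128 * n)%nat -> M r = In r) /\
  (forall i, (i <= j)%nat -> M (128 * n + 6 * i)%nat = In (S i)) /\
  (forall x, (128 * n <= x)%nat ->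
     (forall i, (i <= j)%nat -> x <> (128 * n + 6 * i)%nat) -> M x = 0).

Lemma copied_upd_low lo lo' j M r x :
  copied lo j M -> (r < lo')%nat -> (lo <= lo')%nat -> (lo' <= 128)%nat ->
  copied lo' j (upd M r x).
Proof.
  intros (H1 & H2 & H3) L L' L''. repeat split; intros; rewrite upd_neq by lia; auto.
  apply H1. lia.
Qed.

Lemma copied_upd_next lo j M x :
  copied lo j M -> x = In (S (S j)) ->
  copied lo (S j) (upd M (128 * n + 6 * S j) x).
Proof.
  intros (H1 & H2 & H3) ->. repeat split.
  - intros r Hr. rewrite upd_neq by lia. auto.
  - intros i Hi. destruct (Nat.eq_dec i (S j)) as [->|].
    + now rewrite upd_eq.
    + rewrite upd_neq by lia. apply H2. lia.
  - intros x Hx Hi. rewrite upd_neq by (apply Hi; lia). apply H3; auto.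
Qed.

Definition saving (j : nat) (M : mem) : Prop :=
  copied 2 j M /\ M 0%nat = INR (128 * n + 6 * j) /\ M 1%nat = 6.

(** Cells 0 and 1, which hold the pointer and the stride, are the only registers available here, so
    the 126 copies are unrolled rather than looped. *)
Lemma saving_exec k : forall j M, saving j M -> (j + k <= 126)%nat ->
  let l := flat_map (fun a => [IAdd 0 0 1; IStore 0 a]) (seq (j + 2) k) in
  okl l M /\ saving (j + k) (exec l M).
Proof.
  induction k as [|k IH]; intros j M (H & H0 & H1) L.
  - simpl. rewrite Nat.add_0_r. repeat split; auto; apply H.
  - set (M1 := upd M 0 (INR (128 * n + 6 * S j))).
    assert (E0 : M 0%nat + M 1%nat = INR (128 * n + 6 * S j)).
    { rewrite H0, H1. replace (128 * n + 6 * S j)%nat with (128 * n + 6 * j + 6)%nat by lia.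
      rewrite (plus_INR _ 6). simpl. lra. }
    assert (S1 : saving (S j) (upd M1 (addr (M1 0%nat)) (M1 (j + 2)%nat))).
    { unfold M1 at 2. rewrite upd_eq, addr_INR. split; [|split].
      - apply copied_upd_next.
        + eapply copied_upd_low; eauto; lia.
        + unfold M1. rewrite upd_neq by lia. replace (S (S j)) with (j + 2)%nat by lia.
          apply H. lia.
      - rewrite upd_neq by lia. apply upd_eq.
      - unfold M1. rewrite !upd_neq by lia. auto. }
    apply IH in S1; [|lia]. replace (S j + 2)%nat with (S (j + 2)) in S1 by lia.
    destruct S1 as [O S1].
    cbn [seq flat_map app okl ok1 exec exec1]. rewrite E0. fold M1.
    replace (j + S k)%nat with (S j + k)%nat by lia. repeat split; auto; try apply S1.
    unfold M1. rewrite upd_eq. apply pos_INR.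
Qed.

Definition copying (j : nat) (M : mem) : Prop :=
  copied 128 j M /\ M 50%nat = INR (128 * n) /\ M 51%nat = INR n /\
  M 53%nat = INR (j + 2) /\ M 54%nat = INR (128 * n + 6 * S j) /\
  M 55%nat = INR (3 * n + 2) /\ M 56%nat = 1 /\ M 57%nat = 6.

Lemma copying_step P j M :
  code_at P 278 [IJlt 53 55 280; IJmp 285; ILoad 58 53; IStore 54 58;
      IAdd 53 53 56; IAdd 54 54 57; IJmp 278] ->
  copying j M -> (126 <= j)%nat -> (j < 3 * n)%nat ->
  exists M', steps P 6 (278%nat, M) (278%nat, M') /\ copying (S j) M'.
Proof.
  intros HC (H & H50 & H51 & H53 & H54 & H55 & H56 & H57) Lj Lj'.
  set (l := [ILoad 58 53; IStore 54 58; IAdd 53 53 56; IAdd 54 54 57]).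
  assert (HC2 : code_at P 280 l).
  { apply (code_at_sub _ _ _ 2 4) in HC; [exact HC|simpl; lia]. }
  assert (E : exec l M = upd (upd (upd (upd M 58 (In (S (S j))))
     (128 * n + 6 * S j) (In (S (S j)))) 53 (INR (S j + 2))) 54 (INR (128 * n + 6 * S (S j)))).
  { unfold l. cbn [exec exec1]. upds. rewrite H53, H54, !addr_INR.
    destruct H as (H & _). rewrite H by lia.
    replace (j + 2)%nat with (S (S j)) by lia. f_equal; [f_equal|].
    - upds. rewrite H53, H56, <- S_INR. f_equal.
    - upds. rewrite H54, H57. replace 6 with (INR 6) by (simpl; lra).
      rewrite <- plus_INR. f_equal. lia. }
  exists (exec l M). split.
  - apply (steps_app P 1 5) with (c2 := (280%nat, M)).
    { apply steps_one. eapply SJltT. { apply (code_at_nth _ _ _ 0 _ HC eq_refl). }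
      rewrite H53, H55. apply lt_INR. lia. }
    apply (steps_app P 4 1) with (c2 := (284%nat, exec l M)).
    { apply (exec_steps P l 280 M HC2). simpl. upds. rewrite H53, H54.
      repeat split; auto; apply pos_INR. }
    apply steps_one. constructor. apply (code_at_nth _ _ _ 6 _ HC eq_refl).
  - rewrite E. split; [|repeat split; upds; auto].
    do 2 (apply copied_upd_low with (lo := 128%nat); [|lia..]).
    apply copied_upd_next; auto.
    apply copied_upd_low with (lo := 128%nat); auto; lia.
Qed.

Lemma copying_loop P k : forall j M,
  code_at P 278 [IJlt 53 55 280; IJmp 285; ILoad 58 53; IStore 54 58;
      IAdd 53 53 56; IAdd 54 54 57; IJmp 278] ->
  copying j M -> (126 <= j)%nat -> (3 * n - j = k)%nat ->
  exists M' j', steps P (6 * k + 2) (278%nat, M) (285%nat, M') /\ copying j' M' /\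
    (3 * n <= j')%nat.
Proof.
  induction k as [|k IH]; intros j M HC H L E.
  - exists M, j. split; [|split; auto; lia].
    apply (steps_app P 1 1) with (c2 := (279%nat, M)).
    + apply steps_one. eapply SJltF. { apply (code_at_nth _ _ _ 0 _ HC eq_refl). }
      destruct H as (_ & _ & _ & -> & _ & -> & _). apply Rle_not_lt, le_INR. lia.
    + apply steps_one. constructor. apply (code_at_nth _ _ _ 1 _ HC eq_refl).
  - destruct (copying_step P j M) as (M1 & S1 & H1); auto; try lia.
    destruct (IH (S j) M1) as (M2 & j2 & S2 & H2 & L2); auto; try lia.
    exists M2, j2. split; auto. replace (6 * S k + 2)%nat with (6 + (6 * k + 2))%nat by lia.
    eapply steps_app; eauto.
Qed.

Lemma copied_all j M : copied 128 j M -> (3 * n <= j)%nat ->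
  forall i a, (a < 6)%nat ->
    M (128 * n + 6 * i + a)%nat = match a with O => In (S i) | _ => 0 end.
Proof.
  intros (_ & H2 & H3) L i [|a] La.
  - rewrite Nat.add_0_r. destruct (Nat.le_gt_cases i j); auto.
    rewrite In_beyond by lia. apply H3; lia.
  - apply H3; lia.
Qed.

Lemma prologue_steps P eps :
  0 < eps -> In 0%nat = INR n -> In 1%nat = eps ->
  code_at P 0 prologue ->
  exists k M s, (k <= 400 + 18 * n)%nat /\
    steps P k (0%nat, In) (291%nat, M) /\
    rel (128 * n) n (grid eps) s M /\
    forall a i, (a < 6)%nat -> ar s a i = match a with O => In (S i) | _ => 0 end.
Proof.
  intros He I0 I1 HC.
  assert (Hn : 1 <= INR n) by (apply (le_INR 1); lia).
  unfold prologue in HC.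
  apply code_at_app in HC as [C1 HC]. apply code_at_app in HC as [C2 HC].
  apply code_at_app in HC as [C3 HC]. apply code_at_app in HC as [C4 HC].
  apply code_at_app in HC as [C5 C6]. cbn -[flat_map] in C2, C3, C4, C5, C6.
  match type of C3 with code_at _ _ ?x => set (l3 := x) in * end.
  change (length l3) with 252%nat in *. simpl Nat.add in C2, C3, C4, C5, C6.
  (* Overwriting n loses nothing: real arithmetic is exact, and subtracting [eps] after the test
     restores it. *)
  set (A1 := upd In 0 (INR n + eps)).
  set (A2 := upd A1 0 (INR n + eps - eps)).
  assert (S1 : steps P 3 (0%nat, In) (4%nat, A2)).
  { apply (steps_app P 1 2) with (c2 := (1%nat, A1)).
    { apply steps_one. unfold A1. rewrite <- I0, <- I1. constructor.
      apply (code_at_nth _ _ _ 0 _ C1 eq_refl). }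
    apply (steps_app P 1 1) with (c2 := (3%nat, A1)).
    { apply steps_one. eapply SJltT. { apply (code_at_nth _ _ _ 1 _ C1 eq_refl). }
      unfold A1. upds. rewrite I1. lra. }
    apply steps_one. unfold A2.
    replace (INR n + eps - eps) with (A1 0%nat - A1 1%nat)
      by (unfold A1; upds; rewrite I1; reflexivity).
    constructor. apply (code_at_nth _ _ _ 3 _ C1 eq_refl). }
  match type of C2 with code_at _ _ ?x => set (l2 := x) in * end.
  assert (D0 : forall r, r <> 0%nat -> exec (repeat (IAdd 0 0 0) 7) A2 r = In r).
  { intros r Hr. simpl. unfold A2, A1. upds. auto. }
  (* Seven doublings yield [128 * n] without a second cell. *)
  assert (D1 : exec (repeat (IAdd 0 0 0) 7) A2 0%nat = INR (128 * n + 6 * 0)).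
  { cbn [repeat exec exec1]. upds. unfold A2. upds. rewrite Nat.mul_0_r, Nat.add_0_r, mult_INR.
    rewrite (INR_IZR_INZ 128). simpl IZR. lra. }
  set (A3 := exec (repeat (IAdd 0 0 0) 7) A2) in *.
  assert (E2 : exec l2 A2 = upd (upd A3 (128 * n + 6 * 0) eps) 1 6).
  { change l2 with (repeat (IAdd 0 0 0) 7 ++ [IStore 0 1; IConst 1 6]).
    rewrite exec_app. fold A3. cbn [exec exec1]. rewrite D1, addr_INR, (D0 1%nat), I1 by lia.
    reflexivity. }
  assert (O2 : okl l2 A2).
  { change l2 with (repeat (IAdd 0 0 0) 7 ++ [IStore 0 1; IConst 1 6]).
    apply okl_app. { simpl; tauto. } fold A3. cbn [okl ok1]. rewrite D1.
    repeat split. apply pos_INR. }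
  assert (SV : saving 0 (exec l2 A2)).
  { rewrite E2. split; [|split].
    - apply copied_upd_low with (lo := 2%nat); try lia. repeat split.
      + intros r Hr. rewrite upd_neq by lia. apply D0. lia.
      + intros i Hi. replace i with 0%nat by lia. rewrite upd_eq. auto.
      + intros x Hx Hi. rewrite upd_neq by (apply Hi; lia). rewrite D0 by lia.
        apply In_beyond. lia.
    - upds. exact D1.
    - upds. reflexivity. }
  pose proof (exec_steps P l2 4 A2 C2 O2) as S2.
  destruct (saving_exec 126 0 _ SV) as [O3 SV3]; [lia|].
  change (flat_map _ _) with l3 in O3, SV3. change (0 + 126)%nat with 126%nat in SV3.
  pose proof (exec_steps P _ _ _ C3 O3) as S3.
  change (length l3) with 252%nat in S3. change (length l2) with 9%nat in S2.
  simpl Nat.add in S2, S3. set (A4 := exec l3 (exec l2 A2)) in *.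
  destruct SV3 as (CP & V0 & V1).
  match type of C4 with code_at _ _ ?x => set (l4 := x) in * end.
  assert (N0 : A4 0%nat - 756 = INR (128 * n)).
  { rewrite V0, plus_INR. replace (INR (6 * 126)) with 756. { lra. }
    rewrite INR_IZR_INZ. reflexivity. }
  assert (N1 : INR (128 * n) / 128 = INR n).
  { rewrite mult_INR, (INR_IZR_INZ 128). simpl IZR. field. }
  assert (O4 : okl l4 A4).
  { unfold l4. cbn [okl ok1 exec1]. repeat split; auto. upds. lra. }
  pose proof (exec_steps P _ _ _ C4 O4) as S4. simpl Nat.add in S4.
  assert (CY : copying 126 (exec l4 A4)).
  { unfold l4. cbn [exec exec1]. split; [|repeat split; upds; rewrite ?N0, ?N1; auto].
    { repeat (apply copied_upd_low with (lo := 128%nat); [|lia..]).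
      destruct CP as (K1 & K23). split; auto. intros r Hr. apply K1. lia. }
    - rewrite INR_IZR_INZ. reflexivity.
    - rewrite (plus_INR (128 * n)), (INR_IZR_INZ (6 * 127)). reflexivity.
    - rewrite plus_INR, mult_INR. simpl. lra. }
  set (A5 := exec l4 A4) in *.
  (* If [3 * n <= 126], the unrolled copies have already moved everything and the truncated
     difference is zero rounds. *)
  destruct (copying_loop P (3 * n - 126) 126 A5) as (A6 & j & S5 & CY6 & Lj); auto.
  destruct CY6 as (CP6 & H50 & H51 & _).
  pose proof (copied_all _ _ CP6 Lj) as Har.
  match type of C6 with code_at _ _ ?x => set (l6 := x) in * end.
  assert (Eeps : A6 (128 * n)%nat = eps).
  { rewrite <- I1, <- (Har 0%nat 0%nat) by lia. f_equal. lia. }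
  assert (H1000 : 0 < 1000 / eps) by (apply Rdiv_lt_0_compat; lra).
  assert (O6 : okl l6 A6).
  { unfold l6. cbn [okl ok1 exec1]. upds. rewrite H50, addr_INR, Eeps.
    pose proof (pos_INR (128 * n)). repeat split; lra. }
  pose proof (exec_steps P _ _ _ C6 O6) as S6. simpl Nat.add in S6.
  set (A7 := exec l6 A6) in *.
  assert (F7 : forall r, r <> 52%nat -> ~ (58 <= r <= 60)%nat -> A7 r = A6 r).
  { intros r R1 R2. unfold A7, l6. cbn [exec exec1]. upds. auto. }
  assert (G7 : A7 52%nat = INR (grid eps)).
  { unfold A7, l6. cbn [exec exec1]. upds. rewrite H50, addr_INR, Eeps.
    unfold grid. rewrite plus_INR. replace (INR 4) with 4 by (simpl; lra). f_equal.
    unfold ridx, rfloor. rewrite INR_IZR_INZ, Zabs2Nat.id_abs, Z.abs_eq; auto.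
    destruct (base_Int_part (1000 / eps)) as [_ B]. apply le_IZR.
    assert (-1 < IZR (Int_part (1000 / eps))) by lra.
    apply lt_IZR in H. apply IZR_le. lia. }
  (* The abstract state is read off the memory, so the array and scalar clauses of [rel] hold by
     definition. *)
  eexists _, A7, (State A7 (fun a i => A7 (128 * n + 6 * i + a)%nat)).
  split; [|split; [|split]].
  2:{ eapply steps_app; [exact S1|]. eapply steps_app; [exact S2|].
      eapply steps_app; [exact S3|]. eapply steps_app; [exact S4|].
      eapply steps_app; [exact S5|]. exact S6. }
  - simpl. lia.
  - constructor; auto; try rewrite F7 by lia; auto; try lia.
  - intros a i Ha. cbn [ar]. rewrite F7 by lia. now apply Har.
Qed.
End Prologue.

Definition compile (c : cmd) : program := prologue ++ ccomp 53 291 c.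

Lemma compile_nonempty c Ds eps :
  cwf 53 c = true -> 0 < eps -> Ds <> [] ->
  let n := length Ds in let N := grid eps in
  exists k M s,
    runs_to (compile c) (input_mem Ds eps) k M /\
    (k <= 400 + 18 * n + ccost n N c)%nat /\
    (forall v, (v < 50)%nat -> M v = sc (run_cmd n N c s) v) /\
    (forall a i, (a < 6)%nat ->
       ar s a i = match a with O => input_mem Ds eps (S i) | _ => 0 end).
Proof.
  intros Hw He Hne n N.
  assert (Hn : (1 <= n)%nat) by (unfold n; destruct Ds; simpl; [congruence|lia]).
  destruct (prologue_steps (input_mem Ds eps) n) with (P := compile c) (eps := eps)
    as (k1 & M1 & s & L1 & S1 & R1 & A1); auto.
  { apply input_mem_beyond. }
  { exists [], (ccomp 53 291 c). split; reflexivity. }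
  destruct (ccomp_ok (compile c) (128 * n) n N c s 53 291 M1)
    as (k2 & M2 & L2 & S2 & R2 & _); auto.
  { exists prologue, []. rewrite app_nil_r. split; reflexivity. }
  exists (k1 + k2)%nat, M2, s. split; [|split; [lia|split; auto]].
  - exists (291 + length (ccomp 53 291 c))%nat. split.
    + eapply steps_app; eauto.
    + right. apply nth_error_None. unfold compile. rewrite length_app. simpl. lia.
  - apply R2.
Qed.

(** With no disks the first test fails and the machine halts at once; the radii, in cells 2 and 5,
    are then still 0. *)
Lemma compile_empty c eps :
  0 < eps -> exists M, runs_to (compile c) (input_mem [] eps) 2 M /\
    forall v, (2 <= v)%nat -> M v = 0.
Proof.
  intros He. set (M := upd (input_mem [] eps) 0 (input_mem [] eps 0%nat + input_mem [] eps 1%nat)).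
  exists M. split.
  - exists 2%nat. split.
    + apply (steps_app _ 1 1) with (c2 := (1%nat, M)).
      * apply steps_one. now constructor.
      * apply steps_one. eapply SJltF; [reflexivity|]. unfold M. upds. simpl. lra.
    + left. reflexivity.
  - intros v Hv. unfold M. upds. destruct v as [|[|v]]; try lia.
    cbn [input_mem]. now rewrite nth_error_nil.
Qed.

(** * Reasoning about structured programs *)

Fixpoint wsc (c : cmd) : list nat :=
  match c with
  | Skip | Put _ _ _ => []
  | Set_ v _ => [v]
  | Seq c1 c2 | If _ _ c1 c2 => wsc c1 ++ wsc c2
  | For v _ _ _ c => v :: wsc c
  end.

Fixpoint war (c : cmd) : list nat :=
  match c with
  | Skip | Set_ _ _ => []
  | Put a _ _ => [a]
  | Seq c1 c2 | If _ _ c1 c2 => war c1 ++ war c2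
  | For _ _ _ _ c => war c
  end.

(** Boolean, so that frame conditions on concrete registers are closed by [reflexivity]. *)
Definition mem_nat (v : nat) (l : list nat) : bool := existsb (Nat.eqb v) l.

Definition frame (lv la : list nat) (s s' : state) : Prop :=
  (forall v, mem_nat v lv = false -> sc s' v = sc s v) /\
  (forall a i, mem_nat a la = false -> ar s' a i = ar s a i).

Lemma frame_trans lv la s1 s2 s3 : frame lv la s1 s2 -> frame lv la s2 s3 -> frame lv la s1 s3.
Proof. intros [A B] [C D]. split; intros; rewrite ?C, ?D; auto. Qed.

Lemma mem_nat_app v l1 l2 : mem_nat v (l1 ++ l2) = false <->
  mem_nat v l1 = false /\ mem_nat v l2 = false.
Proof. unfold mem_nat. rewrite existsb_app. apply Bool.orb_false_iff. Qed.

Lemma frame_app lv lv' la la' s1 s2 s3 :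
  frame lv la s1 s2 -> frame lv' la' s2 s3 -> frame (lv ++ lv') (la ++ la') s1 s3.
Proof.
  intros [A B] [C D]. split; intros v; intros; rewrite mem_nat_app in *.
  - rewrite C, A; tauto.
  - rewrite D, B; tauto.
Qed.

Lemma frame_refl lv la s : frame lv la s s.
Proof. split; auto. Qed.

Lemma frame_set_sc v lv la s x : frame (v :: lv) la s (set_sc s v x).
Proof.
  split; auto. intros w Hw. simpl in *. unfold set_sc; simpl.
  destruct (Nat.eqb w v); simpl in *; congruence.
Qed.

Lemma frame_cons v lv la s s' : frame lv la s s' -> frame (v :: lv) la s s'.
Proof.
  intros [A B]. split; auto. intros w Hw. apply A. unfold mem_nat in *. simpl in Hw.
  apply Bool.orb_false_iff in Hw. tauto.
Qed.

Section Logic.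
Variables n N : nat.

Lemma run_frame c : forall s, frame (wsc c) (war c) s (run_cmd n N c s).
Proof.
  induction c; intros s; cbn [run_cmd wsc war].
  - apply frame_refl.
  - apply frame_set_sc.
  - split; auto. intros b i H. unfold set_ar; simpl in *.
    destruct (Nat.eqb b a); simpl in *; congruence.
  - eapply frame_app; eauto.
  - destruct (Rlt_dec _ _).
    + apply (frame_app _ _ _ _ _ _ _ (IHc1 s)). apply frame_refl.
    + apply (frame_app _ _ _ _ s s _ (frame_refl _ _ _) (IHc2 s)).
  - generalize (bn * n + bN * N + bc)%nat. intros k. induction k as [|k IH]; simpl.
    + apply frame_refl.
    + eapply frame_trans; [exact IH|]. eapply frame_trans; [apply frame_set_sc|].
      apply frame_cons. apply IHc.
Qed.

(** The step also receives the frame relative to the state before the loop, so invariants need not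
    mention what the body leaves alone. *)
Lemma for_rule v bn bN bc c k (I : nat -> state -> Prop) s :
  (bn * n + bN * N + bc)%nat = k ->
  I O s ->
  (forall i s', (i < k)%nat -> I i s' ->
     frame (v :: wsc c) (war c) s s' -> I (S i) (run_cmd n N c (set_sc s' v (INR i)))) ->
  I k (run_cmd n N (For v bn bN bc c) s).
Proof.
  intros Hk H0 HS. cbn [run_cmd]. rewrite Hk.
  set (f := fun i s => run_cmd n N c (set_sc s v (INR i))).
  enough (A : forall j, (j <= k)%nat ->
    I j (loop j f s) /\ frame (v :: wsc c) (war c) s (loop j f s)) by (apply A; lia).
  induction j as [|j IH]; intros Hj; simpl.
  - split; auto. apply frame_refl.
  - destruct IH as [IH1 IH2]; [lia|]. split.
    + apply HS; auto.
    + eapply frame_trans; [exact IH2|]. eapply frame_trans; [apply frame_set_sc|].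
      apply frame_cons. apply run_frame.
Qed.

Lemma run_Seq c1 c2 s : run_cmd n N (Seq c1 c2) s = run_cmd n N c2 (run_cmd n N c1 s).
Proof. reflexivity. Qed.

Lemma run_Set v e s : run_cmd n N (Set_ v e) s = set_sc s v (eval_expr n N s e).
Proof. reflexivity. Qed.

Lemma run_If e1 e2 c1 c2 s : run_cmd n N (If e1 e2 c1 c2) s =
  if Rlt_dec (eval_expr n N s e1) (eval_expr n N s e2) then run_cmd n N c1 s else run_cmd n N c2 s.
Proof. reflexivity. Qed.
End Logic.

(** * The program *)

Declare Scope prog_scope.
Delimit Scope prog_scope with prog.
Bind Scope prog_scope with expr.
Bind Scope prog_scope with cmd.
Notation "$ v" := (Var v) (at level 1, v at level 0, format "$ v") : prog_scope.
Notation "# z" := (Cst z%Z) (at level 1, z at level 0, format "# z") : prog_scope.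
Notation "a + b" := (Bin OAdd a b) : prog_scope.
Notation "a - b" := (Bin OSub a b) : prog_scope.
Notation "a * b" := (Bin OMul a b) : prog_scope.
Notation "a / b" := (Div a b) : prog_scope.
Notation "v <- e" := (Set_ v e) (at level 90, no associativity) : prog_scope.
Notation "c1 ;; c2" := (Seq c1 c2) (at level 95, right associativity) : prog_scope.
Open Scope prog_scope.

(** The idle assignment makes both branches updates of [v], so that the effect is literally one
    [set_sc] with a maximum, without extensionality of states. *)
Definition UpMax (v : nat) (e : expr) : cmd := If ($v) e (v <- e) (v <- $v).
Definition UpMin (v : nat) (e : expr) : cmd := If e ($v) (v <- e) (v <- $v).
Definition PutMax (a : nat) (ix e : expr) : cmd :=
  If (Get a ix) e (Put a ix e) (Put a ix (Get a ix)).

(* Injective, so that arrays can be used as tables.  Array 0 holds the input,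
   1 the squared enlarged radii per grid cell, 2 and 3 the results of the two
   transforms, 4 and 5 the tops and the bottoms of the columns. *)
Definition epair (e1 e2 : expr) : expr := (e1 + e2) * (e1 + e2) + e1.

Notation o1x := 0%nat. Notation o1y := 1%nat. Notation o1r := 2%nat.
Notation o2x := 3%nat. Notation o2y := 4%nat. Notation o2r := 5%nat.
Notation p1x := 6%nat. Notation p1y := 7%nat. Notation p2x := 8%nat. Notation p2y := 9%nat.
Notation far := 10%nat. Notation sep := 11%nat. Notation rmax := 12%nat.
Notation qx := 13%nat. Notation qy := 14%nat. Notation off := 15%nat. Notation scl := 16%nat.
Notation vi := 17%nat. Notation vj := 18%nat. Notation vk := 19%nat.
Notation d1 := 20%nat. Notation d2 := 21%nat. Notation vx := 22%nat. Notation vy := 23%nat.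
Notation vt := 24%nat. Notation acc := 25%nat. Notation cur := 26%nat. Notation dir := 27%nat.
Notation vs := 28%nat. Notation vp := 29%nat. Notation vq := 30%nat.
Notation bestL := 31%nat. Notation bxL := 32%nat. Notation byL := 33%nat.
Notation bestR := 34%nat. Notation bxR := 35%nat. Notation byR := 36%nat.
Notation lo := 37%nat. Notation hi := 38%nat. Notation yy := 39%nat.
Notation va := 40%nat. Notation vb := 41%nat. Notation vh := 42%nat. Notation it := 43%nat.
Notation big := 44%nat.
Notation NN := ParGrid.

Definition dkx := Get 0 (#3 * $vi + #1).
Definition dky := Get 0 (#3 * $vi + #2).
Definition dkr := Get 0 (#3 * $vi + #3).

Definition distances : cmd :=
  d1 <- (dkx - $p1x) * (dkx - $p1x) + (dky - $p1y) * (dky - $p1y);;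
  d2 <- (dkx - $p2x) * (dkx - $p2x) + (dky - $p2y) * (dky - $p2y).

Definition farthest : cmd :=
  p1x <- Get 0 #1;; p1y <- Get 0 #2;; p2x <- $p1x;; p2y <- $p1y;; far <- #0;;
  For vi 1 0 0 (
    distances;;
    If ($far) ($d1) (far <- $d1;; p2x <- dkx;; p2y <- dky) Skip).

Definition spread : cmd :=
  sep <- #0;; rmax <- #0;;
  For vi 1 0 0 (
    distances;; UpMin d1 ($d2);; UpMax sep ($d1);; UpMax rmax dkr).

(** [far] is a squared distance, hence 25 for the threshold 5 R0. In the far case the origin of the
    second cluster goes to abscissa 11 N = 6 N + 5 N; in the near case both clusters share one
    map. *)
Definition reference : cmd :=
  big <- Sqr ($sep) + $rmax;;
  If (#25 * ($big * $big)) ($far)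
    (qx <- $p2x;; qy <- $p2y;; off <- #11 * NN)
    (qx <- $p1x;; qy <- $p1y;; off <- #6 * NN);;
  scl <- NN / $big.

(** The 2 added to the scaled radius absorbs the rounding of the center and of the covered point to
    grid points. *)
Definition bucket : cmd :=
  For vi 1 0 0 (
    distances;;
    If ($d2) ($d1)
      (vx <- (dkx - $qx) * $scl + $off;; vy <- (dky - $qy) * $scl + #6 * NN)
      (vx <- (dkx - $p1x) * $scl + #6 * NN;; vy <- (dky - $p1y) * $scl + #6 * NN);;
    vt <- dkr * $scl + #2;;
    PutMax 1 (epair (Flr ($vx)) (Flr ($vy))) ($vt * $vt)).

Definition transform_acc (src : nat) : cmd :=
  For vk 0 13 0 (UpMax acc (Get src (epair ($vj) ($vk)) - ($vi - $vk) * ($vi - $vk))).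

Definition transform_row (src dst : nat) : cmd :=
  For vj 0 13 0 (
    acc <- #0;; transform_acc src;; Put dst (epair ($vi) ($vj)) ($acc)).

(** Each pass reads at [(vj, vk)] and writes at [(vi, vj)], that is, transposes; applying the same
    code twice treats both coordinates and restores their order. *)
Definition transform (src dst : nat) : cmd := For vi 0 13 0 (transform_row src dst).

Definition columns_clear : cmd := For vi 0 52 1 (Put 4 ($vi) #0;; Put 5 ($vi) #0).

(* The offset [39 N] makes the stored values positive: 0 marks an empty column. *)
Definition columns_row : cmd :=
  For vj 0 13 0 (
    If #0 (Get 3 (epair ($vi) ($vj)))
      (vx <- $vp * $vi + $vq * $vj + #26 * NN;;
       vy <- $vp * $vj - $vq * $vi;;
       PutMax 4 ($vx) (#39 * NN + $vy);;
       PutMax 5 ($vx) (#39 * NN - $vy))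
      Skip).

Definition columns : cmd := columns_clear;; For vi 0 13 0 columns_row.

(** [vh] is the larger vertical distance from the candidate ordinate to the top and the bottom of
    the column. If it exceeds the radius, the interval is made empty; otherwise it is intersected
    with the half chord [vt] on both sides of the column. *)
Definition scan_column (ix : expr) : cmd :=
  va <- Get 4 ix;; vb <- Get 5 ix;;
  If #0 ($va)
    (vh <- $va - #39 * NN - $yy;; UpMax vh ($vb - #39 * NN + $yy);;
     If ($cur) ($vh)
       (hi <- $lo - #1)
       (vt <- Sqr ($cur * $cur - $vh * $vh);;
        UpMax lo ($vi - $vt);; UpMin hi ($vi + $vt)))
    Skip.

Definition scan_cell (ix : expr) (best bx by_ : nat) : cmd :=
  scan_column ix;;
  If ($hi) ($lo) Skip
    (If ($best) ($vi + #1) (best <- $vi + #1;; bx <- $lo;; by_ <- $yy) Skip).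

(** The initial interval only has to contain all relevant abscissas, which lie between -4 N and 56
    N, also after mirroring. *)
Definition scan_row (ix : expr) (best bx by_ : nat) : cmd :=
  yy <- $vj - #39 * NN;; lo <- #(-100) * NN;; hi <- #200 * NN;;
  For vi 0 52 1 (scan_cell ix best bx by_).

Definition scan (ix : expr) (best bx by_ : nat) : cmd :=
  best <- #0;; For vj 0 78 1 (scan_row ix best bx by_).

Definition direction : cmd :=
  vs <- $dir / NN - #1;; vt <- #1 + $vs * $vs;;
  vp <- (#1 - $vs * $vs) / $vt;; vq <- #2 * $vs / $vt.

(* The second scan runs on the mirrored columns, so that it finds a suffix. *)
Definition trial : cmd :=
  direction;; columns;; scan ($vi) bestL bxL byL;; scan (#52 * NN - $vi) bestR bxR byR.

Definition accept : cmd :=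
  vx <- $bxL - #26 * NN;;
  o1x <- $vp * $vx - $vq * $byL;; o1y <- $vq * $vx + $vp * $byL;;
  vx <- #26 * NN - $bxR;;
  o2x <- $vp * $vx - $vq * $byR;; o2y <- $vq * $vx + $vp * $byR;;
  o1r <- $cur + #3;; cur <- $cur - #1.

Definition settle : cmd :=
  If ($bestL + $bestR) (#52 * NN + #1) (dir <- $dir + #1)
    (If ($cur) #0 (dir <- $dir + #1) accept).

Definition search : cmd :=
  o1x <- #6 * NN;; o1y <- #6 * NN;;
  o2x <- ($p2x - $qx) * $scl + $off;; o2y <- ($p2y - $qy) * $scl + #6 * NN;;
  o1r <- NN;; cur <- NN - #4;; dir <- #0;;
  For it 0 3 0 (trial;; settle).

(** The abscissa 17 N / 2 is halfway between the origins 6 N and 11 N of the two clusters and tells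
    which map to invert. *)
Definition map_back (ox oy : nat) : cmd :=
  If (#17 * NN) (#2 * $ox)
    (ox <- ($ox - $off) * $vt + $qx;; oy <- ($oy - #6 * NN) * $vt + $qy)
    (ox <- ($ox - #6 * NN) * $vt + $p1x;; oy <- ($oy - #6 * NN) * $vt + $p1y).

Definition finish : cmd :=
  vt <- $big / NN;; map_back o1x o1y;; map_back o2x o2y;;
  o1r <- $o1r * $vt;; o2r <- $o1r.

Definition two_center : cmd :=
  farthest;; spread;; reference;; bucket;; transform 1 2;; transform 2 3;; search;; finish.

(** Computation turns the cost into an explicit polynomial, linear in [n] and cubic in [N]; the
    three inequalities let [lia] absorb its lower powers of [N]. *)
Lemma two_center_cost n N : (1 <= N)%nat ->
  (ccost n N two_center <= 1000 * 1000 * 10 * (n + N * N * N))%nat.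
Proof.
  intros HN. cbv -[Nat.add Nat.mul Nat.le].
  assert (1 * 1 <= N * N)%nat by (apply Nat.mul_le_mono; lia).
  assert (N * 1 <= N * N)%nat by (apply Nat.mul_le_mono; lia).
  assert (N * N * 1 <= N * N * N)%nat by (apply Nat.mul_le_mono; lia).
  lia.
Qed.

Close Scope prog_scope.

(** * Specifications of the loops *)

Definition prn (i j : nat) : nat := ((i + j) * (i + j) + i)%nat.

(** The value lies between (i + j)^2 and (i + j + 1)^2, which determines i + j and then i. *)
Lemma prn_inj i j k l : prn i j = prn k l -> i = k /\ j = l.
Proof.
  unfold prn. intros H. assert (i + j = k + l)%nat by nia.
  rewrite H0 in H. lia.
Qed.

Lemma Rlt_Rmax_r x y z : z < Rmax x y <-> z < x \/ z < y.
Proof. unfold Rmax. destruct (Rle_dec x y); split; lra. Qed.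

Lemma rfloor_ridx x : 0 <= x -> rfloor x = INR (ridx x).
Proof.
  intros H. unfold rfloor, ridx. rewrite INR_IZR_INZ, Zabs2Nat.id_abs, Z.abs_eq; auto.
  destruct (base_Int_part x) as [_ B].
  assert (-1 < IZR (Int_part x)) by lra. apply lt_IZR in H0. lia.
Qed.

Lemma ridx_bounds x : 0 <= x -> INR (ridx x) <= x < INR (ridx x) + 1.
Proof.
  intros H. rewrite <- rfloor_ridx by auto. unfold rfloor.
  destruct (base_Int_part x). lra.
Qed.

Lemma lt_S_INR (i j : nat) : (i < S j)%nat -> (i < j)%nat \/ i = j.
Proof. lia. Qed.

Section Specs.
Variables n N : nat.
Notation NR := (INR N).
Notation run := (run_cmd n N).
Notation eval := (eval_expr n N).

Lemma run_UpMax v e s : run (UpMax v e) s = set_sc s v (Rmax (sc s v) (eval s e)).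
Proof.
  unfold UpMax. cbn [run_cmd eval_expr]. unfold Rmax.
  destruct (Rlt_dec _ _), (Rle_dec _ _); auto; [lra|]. f_equal. lra.
Qed.

Lemma run_UpMin v e s : run (UpMin v e) s = set_sc s v (Rmin (sc s v) (eval s e)).
Proof.
  unfold UpMin. cbn [run_cmd eval_expr]. unfold Rmin.
  destruct (Rlt_dec _ _), (Rle_dec _ _); auto; [lra|]. f_equal. lra.
Qed.

Lemma run_PutMax a ix e s : run (PutMax a ix e) s =
  set_ar s a (ridx (eval s ix)) (Rmax (ar s a (ridx (eval s ix))) (eval s e)).
Proof.
  unfold PutMax. cbn [run_cmd eval_expr]. unfold Rmax.
  destruct (Rlt_dec _ _), (Rle_dec _ _); auto; [lra|]. f_equal. lra.
Qed.

Lemma eval_epair s e1 e2 i j : eval s e1 = INR i -> eval s e2 = INR j ->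
  eval s (epair e1 e2) = INR (prn i j).
Proof.
  intros H1 H2. unfold epair, prn. cbn [eval_expr aop_eval]. rewrite H1, H2.
  now rewrite plus_INR, mult_INR, plus_INR.
Qed.

(** A maximum is described by the thresholds strictly below it, so that each update just adds a
    disjunct. Thresholds are nonnegative because the accumulator starts at 0. *)
Lemma transform_spec src dst s : src <> dst -> forall i j z,
  (i < 13 * N)%nat -> (j < 13 * N)%nat -> 0 <= z ->
  (z < ar (run (transform src dst) s) dst (prn i j) <->
   exists k, (k < 13 * N)%nat /\ z < ar s src (prn j k) - (INR i - INR k) * (INR i - INR k)).
Proof.
  intros Hne.
  pose (good := fun s' i j => forall z, 0 <= z ->
    (z < ar s' dst (prn i j) <-> exists k, (k < 13 * N)%nat /\
      z < ar s src (prn j k) - (INR i - INR k) * (INR i - INR k))).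
  enough (A : forall i j, (i < 13 * N)%nat -> (j < 13 * N)%nat ->
    good (run (transform src dst) s) i j) by (intros; now apply A).
  unfold transform.
  apply (for_rule n N vi 0 13 0 _ (13 * N)%nat
    (fun m s' => forall i j, (i < m)%nat -> (j < 13 * N)%nat -> good s' i j)).
  { lia. } { intros; lia. }
  intros m s1 Hm I1 F1.
  set (s1' := set_sc s1 vi (INR m)).
  enough (A : (forall i j, (i < m)%nat -> (j < 13 * N)%nat -> good
      (run (transform_row src dst) s1') i j) /\
     forall j, (j < 13 * N)%nat -> good (run (transform_row src dst) s1') m j).
  { intros i j Hi Hj. apply lt_S_INR in Hi as [Hi| ->]; apply A; auto. }
  apply (for_rule n N vj 0 13 0 _ (13 * N)%nat
    (fun m' s' => (forall i j, (i < m)%nat -> (j < 13 * N)%nat -> good s' i j) /\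
       forall j, (j < m')%nat -> good s' m j)).
  { lia. } { split; auto. intros; lia. }
  intros m' s2 Hm' [I2 I3] F2.
  cbn [run_cmd]. set (s2' := set_sc (set_sc s2 vj (INR m')) acc (eval _ (#0)%prog)).
  assert (Hsrc : forall i, ar s2 src i = ar s src i).
  { intros i. destruct F1 as [_ F1], F2 as [_ F2].
    rewrite F2, <- F1; auto; simpl; now apply Nat.eqb_neq in Hne as ->. }
  assert (Hvi : sc s2 vi = INR m).
  { destruct F2 as [F2 _]. rewrite F2 by reflexivity. reflexivity. }
  set (s3 := run (transform_acc src) s2').
  assert (H3 : frame [vk; acc; acc] [] s2' s3).
  { apply (run_frame n N (transform_acc src)). }
  assert (Hacc : forall z, 0 <= z -> (z < sc s3 acc <-> exists k, (k < 13 * N)%nat /\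
      z < ar s src (prn m' k) - (INR m - INR k) * (INR m - INR k))).
  { apply (for_rule n N vk 0 13 0 _ (13 * N)%nat (fun k s' => forall z, 0 <= z ->
       (z < sc s' acc <-> exists k', (k' < k)%nat /\
      z < ar s src (prn m' k') - (INR m - INR k') * (INR m - INR k')))).
    - lia.
    - intros z Hz. simpl. split; [lra|]. intros (k & Hk & _). lia.
    - intros k s4 Hk I4 F4 z Hz. rewrite run_UpMax. cbn [eval_expr aop_eval].
      rewrite (eval_epair _ _ _ m' k).
      2:{ destruct F4 as [F4 _]. simpl. now rewrite F4. }
      2:{ reflexivity. }
      rewrite ridx_INR. simpl. rewrite Rlt_Rmax_r, I4 by auto.
      destruct F4 as [F4 F4']. rewrite (F4 vi), F4' by reflexivity. simpl.
      rewrite Hsrc, Hvi. split.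
      + intros [(k' & Hk' & Hz')|Hz']; [exists k'|exists k]; split; auto; lia.
      + intros (k' & Hk' & Hz'). apply lt_S_INR in Hk' as [Hk'| ->]; eauto. }
  destruct H3 as [H3 H3'].
  rewrite (eval_epair _ _ _ m m').
  2:{ simpl. rewrite H3 by reflexivity. exact Hvi. }
  2:{ simpl. rewrite H3 by reflexivity. reflexivity. }
  rewrite ridx_INR.
  assert (K : forall i j, (i, j) <> (m, m') ->
    ar (set_ar s3 dst (prn m m') (eval s3 ($acc)%prog)) dst (prn i j) = ar s2 dst (prn i j)).
  { intros i j Hij. simpl. rewrite Nat.eqb_refl.
    destruct (Nat.eqb_spec (prn i j) (prn m m')) as [E|].
    - apply prn_inj in E as [-> ->]. congruence.
    - simpl. now rewrite H3'. }
  split.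
  - intros i j Hi Hj z Hz. rewrite K by (injection; lia). now apply I2.
  - intros j Hj z Hz. apply lt_S_INR in Hj as [Hj| ->].
    + rewrite K by (injection; lia). now apply I3.
    + simpl. rewrite !Nat.eqb_refl. simpl. now apply Hacc.
Qed.

Notation colx p q i j := (p * INR i + q * INR j + 26 * NR).

Lemma columns_spec s : let s' := run columns s in
  forall c z, (c < 52 * N + 1)%nat -> 0 <= z ->
  (z < ar s' 4%nat c <-> exists i j, (i < 13 * N)%nat /\ (j < 13 * N)%nat /\
     0 < ar s 3%nat (prn i j) /\ ridx (colx (sc s vp) (sc s vq) i j) = c /\
     z < 39 * NR + (sc s vp * INR j - sc s vq * INR i)) /\
  (z < ar s' 5%nat c <-> exists i j, (i < 13 * N)%nat /\ (j < 13 * N)%nat /\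
     0 < ar s 3%nat (prn i j) /\ ridx (colx (sc s vp) (sc s vq) i j) = c /\
     z < 39 * NR - (sc s vp * INR j - sc s vq * INR i)).
Proof.
  set (p := sc s vp). set (q := sc s vq).
  pose (good := fun (vis : nat -> nat -> Prop) s' => forall c z,
    (c < 52 * N + 1)%nat -> 0 <= z ->
  (z < ar s' 4%nat c <-> exists i j, vis i j /\ (j < 13 * N)%nat /\
     0 < ar s 3%nat (prn i j) /\ ridx (colx p q i j) = c /\
     z < 39 * NR + (p * INR j - q * INR i)) /\
  (z < ar s' 5%nat c <-> exists i j, vis i j /\ (j < 13 * N)%nat /\
     0 < ar s 3%nat (prn i j) /\ ridx (colx p q i j) = c /\
     z < 39 * NR - (p * INR j - q * INR i))).
  unfold columns. cbn zeta.
  cbn [run_cmd]. set (s1 := run columns_clear s).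
  change (good (fun i _ => (i < 13 * N)%nat) (run (For vi 0 13 0 columns_row) s1)).
  assert (F1 : frame [vi] [4%nat; 5%nat] s s1) by apply (run_frame n N columns_clear).
  assert (Z : forall c, (c < 52 * N + 1)%nat -> ar s1 4%nat c = 0 /\ ar s1 5%nat c = 0).
  { apply (for_rule n N vi 0 52 1 _ (52 * N + 1)%nat (fun m s' => forall c, (c < m)%nat ->
      ar s' 4%nat c = 0 /\ ar s' 5%nat c = 0)).
    { lia. } { intros; lia. }
    intros m s2 Hm I2 _ c Hc. cbn [run_cmd eval_expr]. simpl. rewrite ridx_INR.
    destruct (Nat.eqb_spec c m); auto. apply I2. lia. }
  apply (for_rule n N vi 0 13 0 _ (13 * N)%nat (fun m s' => good (fun i _ => (i < m)%nat) s')).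
  { lia. }
  { intros c z Hc Hz. destruct (Z c) as [-> ->]; [lia|].
    split; (split; [lra|]); intros (i & j & Hi & _); lia. }
  intros m s2 Hm I2 F2. set (s2' := set_sc s2 vi (INR m)).
  enough (A : good (fun i j => (i < m)%nat \/ i = m /\ (j < 13 * N)%nat)
    (run columns_row s2')).
  { intros c z Hc Hz. destruct (A c z Hc Hz) as [A1 A2].
    split; [rewrite A1|rewrite A2]; split; intros (i & j & Hi & Hj & H);
      exists i, j; split; auto; lia. }
  apply (for_rule n N vj 0 13 0 _ (13 * N)%nat
    (fun m' s' => good (fun i j => (i < m)%nat \/ i = m /\ (j < m')%nat) s')).
  { lia. }
  { intros c z Hc Hz. destruct (I2 c z Hc Hz) as [A1 A2]. change (ar s2') with (ar s2).
    split; [rewrite A1|rewrite A2]; split; intros (i & j & Hi & Hj & H);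
      exists i, j; split; auto; lia. }
  intros m' s3 Hm' I3 F3.
  assert (G3 : forall i, ar s3 3%nat i = ar s 3%nat i).
  { intros i. destruct F1 as [_ F1], F2 as [_ F2], F3 as [_ F3].
    rewrite F3, <- F1, <- F2 by reflexivity. reflexivity. }
  assert (Gp : sc s3 vp = p /\ sc s3 vq = q /\ sc s3 vi = INR m).
  { destruct F1 as [F1 _], F2 as [F2 _], F3 as [F3 _].
    rewrite !F3 by reflexivity. simpl. rewrite !F2, !F1 by reflexivity. auto. }
  destruct Gp as (Gp & Gq & Gi).
  set (s3' := set_sc s3 vj (INR m')).
  cbn [run_cmd]. cbn [eval_expr].
  rewrite (eval_epair s3' _ _ m m'), ridx_INR by (auto; reflexivity).
  change (ar s3' 3%nat (prn m m')) with (ar s3 3%nat (prn m m')). rewrite (G3 (prn m m')).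
  destruct (Rlt_dec 0 (ar s 3%nat (prn m m'))) as [Hlt|Hlt].
  - rewrite !run_PutMax. unfold s3'. simpl. rewrite Gp, Gq, Gi.
    intros c z Hc Hz. destruct (I3 c z Hc Hz) as [A1 A2]. simpl.
    destruct (Nat.eqb_spec c (ridx (colx p q m m'))) as [E|E].
    + rewrite <- E, !Rlt_Rmax_r, A1, A2. split; split.
      * intros [(i & j & Hi & H)|H]; [exists i, j|exists m, m']; intuition lia.
      * intros (i & j & Hi & Hj & H). destruct (Nat.eq_dec i m) as [->|]; [destruct (Nat.eq_dec j m') as [->|]|].
        -- right; tauto.
        -- left. exists m, j. intuition lia.
        -- left. exists i, j. intuition lia.
      * intros [(i & j & Hi & H)|H]; [exists i, j|exists m, m']; intuition lia.
      * intros (i & j & Hi & Hj & H). destruct (Nat.eq_dec i m) as [->|]; [destruct (Nat.eq_dec j m') as [->|]|].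
        -- right; tauto.
        -- left. exists m, j. intuition lia.
        -- left. exists i, j. intuition lia.
    + rewrite A1, A2. split; split; intros (i & j & Hi & Hj & H); exists i, j.
      * intuition lia.
      * destruct (Nat.eq_dec i m) as [->|]; [destruct (Nat.eq_dec j m') as [->|]|];
          intuition (lia || congruence).
      * intuition lia.
      * destruct (Nat.eq_dec i m) as [->|]; [destruct (Nat.eq_dec j m') as [->|]|];
          intuition (lia || congruence).
  - intros c z Hc Hz. destruct (I3 c z Hc Hz) as [A1 A2]. unfold s3'; simpl.
    rewrite A1, A2. split; split; intros (i & j & Hi & Hj & H); exists i, j.
    + intuition lia.
    + destruct (Nat.eq_dec i m) as [->|]; [destruct (Nat.eq_dec j m') as [->|]|];
          intuition lia.
    + intuition lia.
    + destruct (Nat.eq_dec i m) as [->|]; [destruct (Nat.eq_dec j m') as [->|]|];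
          intuition lia.
Qed.
End Specs.

(* [fits N r a b c x y]: the disk of radius [r] around [(x, y)] contains the
   points of abscissa [c] and of ordinates [a - 39 N] and [39 N - b], which are the
   top and the bottom of column [c]; [a <= 0] marks an empty column. *)
Definition fits (N : nat) (r a b : R) (c : nat) (x y : R) : Prop :=
  0 < a ->
  let h := Rmax (a - 39 * INR N - y) (b - 39 * INR N + y) in
  let w := sqrt (sqrt ((r * r - h * h) * (r * r - h * h))) in
  h <= r /\ INR c - w <= x <= INR c + w.

(** * Correctness of the column scan *)

Section Specs.
Variables n N : nat.
Notation NR := (INR N).
Notation run := (run_cmd n N).
Notation eval := (eval_expr n N).

(** The column read, [c'], may differ from the abscissa [c] used in the test; the mirrored scan
    needs this. *)
Lemma scan_column_spec ix c c' s :
  sc s vi = INR c -> (forall s', sc s' vi = INR c -> eval s' ix = INR c') ->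
  let s' := run (scan_column ix) s in
  forall x, sc s' lo <= x <= sc s' hi <->
    sc s lo <= x <= sc s hi /\
    fits N (sc s cur) (ar s 4%nat c') (ar s 5%nat c') c x (sc s yy).
Proof.
  intros Hc Hix s' x. unfold s', scan_column. cbn [run_cmd].
  cbn [eval_expr]. rewrite !Hix by (cbn; auto). rewrite !ridx_INR.
  cbn [run_cmd eval_expr aop_eval sc ar set_sc set_ar Nat.eqb].
  unfold fits. set (a := ar s 4%nat c'). set (b := ar s 5%nat c').
  destruct (Rlt_dec 0 a) as [Ha|Ha]; [|tauto].
  rewrite !run_UpMax. cbn [run_cmd eval_expr aop_eval sc ar set_sc set_ar Nat.eqb].
  set (h := Rmax (a - 39 * NR - sc s yy) (b - 39 * NR + sc s yy)).
  destruct (Rlt_dec (sc s cur) h) as [Hh|Hh].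
  - cbn -[INR]. split; [lra|]. intros [_ H]. specialize (H Ha). lra.
  - rewrite run_UpMin. cbn -[INR]. rewrite Hc.
    set (w := sqrt _). unfold Rmax, Rmin.
    destruct (Rle_dec _ _), (Rle_dec _ _); split; intros; try split; try intros _; try lra;
     destruct H as [H1 H2]; specialize (H2 Ha); lra.
Qed.

Ltac split4 := split; [|split; [|split]].

(** Restricting to the two register triples in use makes the registers concrete, so that frame
    conditions compute. *)
Definition scan_scalars (best bx by_ : nat) : Prop :=
  (best, bx, by_) = (bestL, bxL, byL) \/ (best, bx, by_) = (bestR, bxR, byR).

Lemma scan_spec ix ixf best bx by_ s :
  scan_scalars best bx by_ ->
  (forall c s', (c < 52 * N + 1)%nat -> sc s' vi = INR c -> eval s' ix = INR (ixf c)) ->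
  let s' := run (scan ix best bx by_) s in
  let K c x y := fits N (sc s cur) (ar s 4%nat (ixf c)) (ar s 5%nat (ixf c)) c x y in
  exists b, (b <= 52 * N + 1)%nat /\ sc s' best = INR b /\
    (forall c, (c < b)%nat -> K c (sc s' bx) (sc s' by_)) /\
    (forall t x j, (t <= 52 * N + 1)%nat -> (j < 78 * N + 1)%nat ->
       -100 * NR <= x <= 200 * NR ->
       (forall c, (c < t)%nat -> K c x (INR j - 39 * NR)) -> (t <= b)%nat).
Proof.
  intros Hs Hix s' K.
  pose (good := fun (vis : nat -> nat -> Prop) s' => exists b, (b <= 52 * N + 1)%nat /\
    sc s' best = INR b /\
    (forall c, (c < b)%nat -> K c (sc s' bx) (sc s' by_)) /\
    (forall t x j, vis j t ->
       -100 * NR <= x <= 200 * NR ->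
       (forall c, (c < t)%nat -> K c x (INR j - 39 * NR)) -> (t <= b)%nat)).
  assert (G : good (fun j t => (j < 78 * N + 1)%nat /\ (t <= 52 * N + 1)%nat) s').
  2:{ destruct G as (b & B1 & B2 & B3 & B4). exists b. split4; auto.
      intros; eapply B4; eauto. }
  unfold s', scan. rewrite run_Seq, run_Set.
  set (s1 := set_sc s best (eval s (#0)%prog)).
  apply (for_rule n N vj 0 78 1 _ (78 * N + 1)%nat
    (fun m s' => good (fun j t => (j < m)%nat /\ (t <= 52 * N + 1)%nat) s')).
  { lia. }
  { exists 0%nat. split4; try (intros; lia).
    destruct Hs as [Hs|Hs]; injection Hs as -> -> ->; reflexivity. }
  intros m s2 Hm I2 F2. unfold scan_row. rewrite !run_Seq, !run_Set.
  set (s3 := set_sc (set_sc (set_sc _ yy _) lo _) hi _).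
  assert (E3 : sc s3 yy = INR m - 39 * NR /\ sc s3 lo = -100 * NR /\ sc s3 hi = 200 * NR /\
     sc s3 cur = sc s cur /\ (forall i, ar s3 4%nat i = ar s 4%nat i) /\
     (forall i, ar s3 5%nat i = ar s 5%nat i) /\
     sc s3 best = sc s2 best /\ sc s3 bx = sc s2 bx /\ sc s3 by_ = sc s2 by_).
  { destruct F2 as [F2 F2'].
    destruct Hs as [Hs|Hs]; injection Hs as -> -> ->;
    (split; [reflexivity|split; [reflexivity|split; [reflexivity|split; [|
      split; [|split; [|split; [|split]]]]]]]); try reflexivity;
    try (intros i; now apply (F2' 4%nat)); try (intros i; now apply (F2' 5%nat)); now apply (F2 cur). }
  clearbody s3. destruct E3 as (Ey & El & Eh & Ec & E4 & E5 & Eb & Ebx & Eby).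
  enough (A : good (fun j t => (j < m)%nat /\ (t <= 52 * N + 1)%nat \/
      j = m /\ (t <= 52 * N + 1)%nat)
    (run (For vi 0 52 1 (scan_cell ix best bx by_)) s3)).
  { destruct A as (b & B1 & B2 & B3 & B4). exists b. split4; auto.
    intros t x j [J1 J2]. apply B4. lia. }
  (* The interval is exactly the set of abscissas admissible for the first [k] columns, and the
     record accounts for earlier rows and for prefixes of length at most [k] of this row. *)
  apply (for_rule n N vi 0 52 1 _ (52 * N + 1)%nat (fun k s' =>
    (forall x, sc s' lo <= x <= sc s' hi <-> -100 * NR <= x <= 200 * NR /\
      forall c, (c < k)%nat -> K c x (INR m - 39 * NR)) /\
    good (fun j t => (j < m)%nat /\ (t <= 52 * N + 1)%nat \/ j = m /\ (t <= k)%nat) s')).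
  { lia. }
  { rewrite El, Eh. split; [intros x; split; [|tauto]; split; auto; intros; lia|].
    destruct I2 as (b & B1 & B2 & B3 & B4). exists b. rewrite Eb, Ebx, Eby.
    split4; auto. intros t x j [J|[-> J]]; [now apply B4|lia]. }
  intros k s4 Hk [L4 I4] F4. set (s5 := set_sc s4 vi (INR k)).
  assert (Hs4 : sc s4 yy = INR m - 39 * NR /\ sc s4 cur = sc s cur /\
     (forall i, ar s4 4%nat i = ar s 4%nat i) /\ (forall i, ar s4 5%nat i = ar s 5%nat i)).
  { destruct F4 as [F4 F4']. rewrite <- Ey, <- Ec. repeat split.
    1,2: apply F4; destruct Hs as [Hs|Hs]; injection Hs as -> -> ->; reflexivity.
    - intros i. rewrite <- E4. now apply F4'.
    - intros i. rewrite <- E5. now apply F4'. }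
  destruct Hs4 as (G1 & G2 & G3 & G4).
  unfold scan_cell. rewrite run_Seq.
  pose proof (scan_column_spec ix k (ixf k) s5 eq_refl (fun s' => Hix k s' Hk)) as SC.
  cbn zeta in SC. set (s6 := run (scan_column ix) s5) in *.
  assert (F6 : frame (wsc (scan_column ix)) [] s5 s6) by apply (run_frame n N (scan_column ix)).
  assert (Hs6 : sc s6 yy = INR m - 39 * NR /\ sc s6 vi = INR k /\
    sc s6 best = sc s4 best /\ sc s6 bx = sc s4 bx /\ sc s6 by_ = sc s4 by_).
  { destruct F6 as [F6 _]. rewrite <- G1.
    destruct Hs as [Hs|Hs]; injection Hs as -> -> ->; rewrite !F6 by reflexivity; tauto. }
  clearbody s6. destruct Hs6 as (H1 & H2 & H3 & H4 & H5).
  assert (L6 : forall x, sc s6 lo <= x <= sc s6 hi <-> -100 * NR <= x <= 200 * NR /\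
      forall c, (c < S k)%nat -> K c x (INR m - 39 * NR)).
  { intros x. rewrite SC. change (ar s5) with (ar s4). change (sc s5 lo) with (sc s4 lo).
    change (sc s5 hi) with (sc s4 hi). change (sc s5 cur) with (sc s4 cur).
    change (sc s5 yy) with (sc s4 yy). rewrite L4, G1, G2, G3, G4. split.
    - intros [[A B] C]. split; auto. intros c Hc. apply lt_S_INR in Hc as [Hc| ->]; auto.
    - intros [A B]. split; [split; auto|]. apply B. lia. }
  destruct I4 as (b & B1 & B2 & B3 & B4).
  assert (B5 : forall t x j, (j < m)%nat /\ (t <= 52 * N + 1)%nat \/ j = m /\ (t <= S k)%nat ->
       -100 * NR <= x <= 200 * NR ->
       (forall c, (c < t)%nat -> K c x (INR j - 39 * NR)) -> (t <= b)%nat \/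
     j = m /\ t = S k /\ sc s6 lo <= x <= sc s6 hi).
  { intros t x j [J|[-> J]] Hx Ht.
    - left. eapply B4; eauto.
    - destruct (Nat.eq_dec t (S k)) as [->|].
      + right. split; [auto|split; [auto|]]; apply L6; auto.
      + left. apply (B4 t x m); auto. lia. }
  cbn [run_cmd eval_expr aop_eval]. rewrite H3, H2, B2.
  destruct (Rlt_dec (sc s6 hi) (sc s6 lo)) as [C1|C1].
  - split; auto. exists b. rewrite H3, H4, H5. split4; auto.
    intros t x j J Hx Ht. destruct (B5 t x j J Hx Ht) as [|(_ & _ & ?)]; auto. lra.
  - destruct (Rlt_dec (INR b) (INR k + 1)) as [C2|C2].
    + rewrite <- S_INR in *. apply INR_lt in C2.
      (* A nonempty interval contains its left end, which therefore serves as the stored center. *)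
      assert (Hlo : forall c, (c < S k)%nat -> K c (sc s6 lo) (sc s6 yy)).
      { rewrite H1. apply (L6 (sc s6 lo)). lra. }
      split.
      { destruct Hs as [Hs|Hs]; injection Hs as -> -> ->; cbn -[INR]; auto. }
      exists (S k). split; [lia|]. split; [|split].
      * destruct Hs as [Hs|Hs]; injection Hs as -> -> ->; cbn -[INR]; rewrite S_INR; auto.
      * destruct Hs as [Hs|Hs]; injection Hs as -> -> ->; cbn -[INR]; exact Hlo.
      * intros t x j J Hx Ht. destruct (B5 t x j J Hx Ht) as [|(_ & -> & _)]; lia.
    + split; auto. exists b. rewrite H3, H4, H5. split4; auto.
      rewrite <- S_INR in C2. apply Rnot_lt_le, INR_le in C2.
      intros t x j J Hx Ht. destruct (B5 t x j J Hx Ht) as [|(_ & -> & _)]; lia.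
Qed.
End Specs.

(** * Plane geometry *)

Definition nrm (x y : R) : R := sqrt (x * x + y * y).

Lemma nrm_pos x y : 0 <= nrm x y.
Proof. apply sqrt_pos. Qed.

Lemma nrm_sq x y : nrm x y * nrm x y = x * x + y * y.
Proof. unfold nrm. apply sqrt_sqrt. nra. Qed.

Lemma nrm_le x y r : 0 <= r -> nrm x y <= r <-> x * x + y * y <= r * r.
Proof.
  intros Hr. pose proof (nrm_pos x y). rewrite <- nrm_sq. split; intros; nra.
Qed.

Lemma nrm_triangle a b c d : nrm (a + c) (b + d) <= nrm a b + nrm c d.
Proof.
  pose proof (nrm_pos a b) as H1. pose proof (nrm_pos c d) as H2.
  apply nrm_le. { lra. }
  pose proof (nrm_sq a b) as E1. pose proof (nrm_sq c d) as E2.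
  enough (a * c + b * d <= nrm a b * nrm c d) by nra.
  destruct (Rle_dec (a * c + b * d) 0). { nra. }
  apply Rsqr_incr_0_var; [|now apply Rmult_le_pos]. unfold Rsqr.
  replace (nrm a b * nrm c d * (nrm a b * nrm c d)) with
    ((nrm a b * nrm a b) * (nrm c d * nrm c d)) by ring.
  rewrite E1, E2. pose proof (Rle_0_sqr (a * d - b * c)) as H. unfold Rsqr in H. lra.
Qed.

Lemma nrm_ext x y x' y' : x * x + y * y = x' * x' + y' * y' -> nrm x y = nrm x' y'.
Proof. unfold nrm. now intros ->. Qed.

Lemma nrm_step x y x' y' k r :
  nrm x y <= r -> nrm (x' - x) (y' - y) <= k -> nrm x' y' <= r + k.
Proof.
  intros H1 H2. pose proof (nrm_triangle x y (x' - x) (y' - y)) as H.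
  replace (x + (x' - x)) with x' in H by ring. replace (y + (y' - y)) with y' in H by ring.
  lra.
Qed.

Lemma abs_le_nrm x y r : nrm x y <= r -> - r <= x <= r /\ - r <= y <= r.
Proof.
  intros H. pose proof (nrm_pos x y). assert (0 <= r) by lra.
  apply nrm_le in H; [|lra]. repeat split; nra.
Qed.

Lemma nrm_scale k x y : 0 <= k -> nrm (k * x) (k * y) = k * nrm x y.
Proof.
  intros Hk. unfold nrm. replace (k * x * (k * x) + k * y * (k * y)) with
    ((k * k) * (x * x + y * y)) by ring.
  rewrite sqrt_mult by nra. now rewrite sqrt_square.
Qed.

Lemma nrm_rot p q x y : p * p + q * q = 1 ->
  nrm (p * x + q * y) (p * y - q * x) = nrm x y.
Proof.
  intros H. apply nrm_ext.
  replace (_ + _) with ((p * p + q * q) * (x * x + y * y)) by ring. rewrite H. ring.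
Qed.

Lemma in_disk_nrm D x y : 0 <= dr D -> in_disk D x y <-> nrm (x - dx D) (y - dy D) <= dr D.
Proof. intros H. unfold in_disk. rewrite nrm_le by auto. now rewrite <- !Rsqr_pow2. Qed.

(** Shrink the vector by the factor r / (r + k). *)
Lemma nrm_split x y r k : 0 <= r -> 0 < k -> nrm x y <= r + k ->
  exists x' y', nrm x' y' <= r /\ nrm (x - x') (y - y') <= k.
Proof.
  intros Hr Hk H. exists (r / (r + k) * x), (r / (r + k) * y).
  assert (0 <= r / (r + k)) by (apply Rmult_le_pos; [lra|apply Rlt_le, Rinv_0_lt_compat; lra]).
  assert (0 <= k / (r + k)) by (apply Rmult_le_pos; [lra|apply Rlt_le, Rinv_0_lt_compat; lra]).
  split.
  - rewrite nrm_scale by auto.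
    apply Rle_trans with (r / (r + k) * (r + k)); [now apply Rmult_le_compat_l|].
    right. field. lra.
  - replace (x - r / (r + k) * x) with (k / (r + k) * x) by (field; lra).
    replace (y - r / (r + k) * y) with (k / (r + k) * y) by (field; lra).
    rewrite nrm_scale by auto.
    apply Rle_trans with (k / (r + k) * (r + k)); [now apply Rmult_le_compat_l|].
    right. field. lra.
Qed.

(** Half-angle parametrization: for d from 0 to 2 N the slope runs through [-1, 1] and the direction
    through the right half of the unit circle, with exact unit vectors and no trigonometry. *)
Definition slope (N d : nat) : R := INR d / INR N - 1.
Definition cosd (N d : nat) : R := (1 - slope N d * slope N d) / (1 + slope N d * slope N d).
Definition sind (N d : nat) : R := 2 * slope N d / (1 + slope N d * slope N d).

Lemma unit_dir N d : cosd N d * cosd N d + sind N d * sind N d = 1.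
Proof. unfold cosd, sind. field. nra. Qed.

Lemma abs_bound x k : - k <= x <= k -> Rabs x <= k.
Proof. intros. apply Rabs_le. lra. Qed.

Lemma dir_approx N vx vy : (1 <= N)%nat -> vx * vx + vy * vy = 1 -> 0 <= vx ->
  exists d, (d <= 2 * N)%nat /\
    Rabs (vx - cosd N d) <= 2 / INR N /\ Rabs (vy - sind N d) <= 2 / INR N.
Proof.
  intros HN Hv Hx. assert (HNR : 1 <= INR N) by (apply (le_INR 1); lia).
  (* The tangent of half the angle of v, to be rounded down to a multiple of 1 / N. *)
  set (s := vy / (1 + vx)).
  assert (Hs : s * (1 + vx) = vy) by (unfold s; field; lra).
  assert (Hs2 : s * s * (1 + vx) = 1 - vx).
  { apply Rmult_eq_reg_r with (1 + vx); [|lra].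
    replace (s * s * (1 + vx) * (1 + vx)) with ((s * (1 + vx)) * (s * (1 + vx))) by ring.
    rewrite Hs. nra. }
  assert (Hs1 : -1 <= s <= 1) by nra.
  assert (Hy0 : 0 <= (s + 1) * INR N) by nra.
  pose proof (ridx_bounds _ Hy0) as B. set (d := ridx ((s + 1) * INR N)) in *.
  exists d. set (t := slope N d).
  assert (Ht : t * INR N = INR d - INR N) by (unfold t, slope; field; lra).
  assert (Hst : 0 <= s - t <= 1 / INR N).
  { split; apply Rmult_le_reg_r with (INR N); try lra.
    replace (1 / INR N * INR N) with 1 by (field; lra). lra. }
  assert (Ec : vx = (1 - s * s) / (1 + s * s)).
  { apply Rmult_eq_reg_r with (1 + s * s); [|nra].
    replace ((1 - s * s) / (1 + s * s) * (1 + s * s)) with (1 - s * s) by (field; nra). nra. }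
  assert (Es : vy = 2 * s / (1 + s * s)).
  { apply Rmult_eq_reg_r with (1 + s * s); [|nra].
    replace (2 * s / (1 + s * s) * (1 + s * s)) with (2 * s) by (field; nra). nra. }
  (* Both coordinates are 2-Lipschitz in the slope: each difference is 2 (s - t) times a quotient of
     absolute value at most 1. *)
  assert (K : forall u, - ((1 + s * s) * (1 + t * t)) <= u <= (1 + s * s) * (1 + t * t) ->
    Rabs (2 * (s - t) * (u / ((1 + s * s) * (1 + t * t)))) <= 2 / INR N).
  { intros u Hu. set (w := (1 + s * s) * (1 + t * t)) in *.
    assert (Hw : 0 < w) by (unfold w; nra).
    assert (-1 <= u / w <= 1).
    { split; apply Rmult_le_reg_r with w; auto; replace (u / w * w) with u by (field; lra); lra. }
    apply abs_bound. replace (2 / INR N) with (2 * (1 / INR N)) by (field; lra).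
    split; nra. }
  split; [|split].
  - apply INR_le. rewrite mult_INR. simpl (INR 2). nra.
  - unfold cosd. fold t. rewrite Ec.
    replace (_ - _) with (2 * (s - t) * (- (s + t) / ((1 + s * s) * (1 + t * t))))
      by (field; split; nra).
    apply K. assert (0 <= s * s * (t * t)) by nra. split; nra.
  - unfold sind. fold t. rewrite Es.
    replace (_ - _) with (2 * (s - t) * ((1 - s * t) / ((1 + s * s) * (1 + t * t))))
      by (field; split; nra).
    apply K. assert (0 <= s * s * (t * t)) by nra. split; nra.
Qed.

(* Moving the point by [tau] against [v] brings it to the side of [c1]. *)
Lemma nearer_center x1 y1 x2 y2 L vx vy x y kappa tau :
  0 <= L -> 0 <= tau -> vx * vx + vy * vy = 1 -> x2 - x1 = L * vx -> y2 - y1 = L * vy ->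
  vx * (x - (x1 + x2) / 2) + vy * (y - (y1 + y2) / 2) <= tau ->
  nrm (x - x1) (y - y1) <= kappa \/ nrm (x - x2) (y - y2) <= kappa ->
  nrm (x - x1) (y - y1) <= kappa + 2 * tau.
Proof.
  intros HL Ht Hv Hx Hy Hs [H|H]; [lra|].
  set (x' := x - tau * vx). set (y' := y - tau * vy).
  assert (Hd : nrm (tau * vx) (tau * vy) = tau).
  { rewrite nrm_scale by auto. unfold nrm. rewrite Hv, sqrt_1. ring. }
  assert (H2 : nrm (x' - x2) (y' - y2) <= kappa + tau).
  { apply nrm_step with (1 := H). rewrite <- Hd. right. apply nrm_ext. unfold x', y'. ring. }
  assert (H1 : nrm (x' - x1) (y' - y1) <= kappa + tau).
  { pose proof (nrm_pos (x' - x2) (y' - y2)).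
    apply nrm_le; [lra|]. apply nrm_le in H2; [|lra].
    enough (E : (x' - x1) * (x' - x1) + (y' - y1) * (y' - y1) -
      ((x' - x2) * (x' - x2) + (y' - y2) * (y' - y2)) =
      2 * L * (vx * (x - (x1 + x2) / 2) + vy * (y - (y1 + y2) / 2) - tau)).
    { assert (0 <= L * (tau - (vx * (x - (x1 + x2) / 2) + vy * (y - (y1 + y2) / 2))))
        by (apply Rmult_le_pos; lra). nra. }
    replace x1 with (x2 - L * vx) by lra. replace y1 with (y2 - L * vy) by lra.
    unfold x', y'.
    transitivity (2 * L * (vx * (x - (x2 - L * vx + x2) / 2) + vy * (y - (y2 - L * vy + y2) / 2)
      - tau * (vx * vx + vy * vy))); [field|rewrite Hv; ring]. }
  replace (kappa + 2 * tau) with (kappa + tau + tau) by ring.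
  apply nrm_step with (1 := H1). rewrite <- Hd. right. apply nrm_ext. unfold x', y'. ring.
Qed.

(** * From disks to grid points and columns *)

Section Raster.
Variables (N n : nat) (E : nat -> disk).
Notation NR := (INR N).
Hypothesis N_ge : (4 <= N)%nat.
Hypothesis E_box : forall i, (i < n)%nat -> 0 < dr (E i) /\
  dr (E i) <= dx (E i) <= 12 * NR - dr (E i) /\ dr (E i) <= dy (E i) <= 12 * NR - dr (E i).

Lemma NR_ge : 4 <= NR.
Proof. apply (le_INR 4) in N_ge. simpl in N_ge. lra. Qed.

Definition fl (x : R) : R := INR (ridx x).

(** The set decided by the two transforms; the inequality is strict because the program tests for
    positive entries. *)
Definition occ (i j : nat) : Prop := exists d, (d < n)%nat /\
  (INR i - fl (dx (E d))) * (INR i - fl (dx (E d))) +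
  (INR j - fl (dy (E d))) * (INR j - fl (dy (E d))) < (dr (E d) + 2) * (dr (E d) + 2).

Definition covered (x1 y1 x2 y2 rho : R) : Prop :=
  forall d px py, (d < n)%nat -> in_disk (E d) px py ->
    nrm (px - x1) (py - y1) <= rho \/ nrm (px - x2) (py - y2) <= rho.

Definition covered_occ (x1 y1 x2 y2 rho : R) : Prop :=
  forall i j, (i < 13 * N)%nat -> (j < 13 * N)%nat -> occ i j ->
    nrm (INR i - x1) (INR j - y1) <= rho \/ nrm (INR i - x2) (INR j - y2) <= rho.

(** Rounding down both ends changes each coordinate of the difference by less than 1, so its norm by
    less than 3 / 2. *)
Lemma fl_diff a b c d : 0 <= a -> 0 <= b -> 0 <= c -> 0 <= d ->
  forall r, nrm (a - c) (b - d) <= r ->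
  (fl a - fl c) * (fl a - fl c) + (fl b - fl d) * (fl b - fl d) < (r + 2) * (r + 2).
Proof.
  intros Ha Hb Hc Hd r Hr. unfold fl.
  pose proof (ridx_bounds _ Ha). pose proof (ridx_bounds _ Hb).
  pose proof (ridx_bounds _ Hc). pose proof (ridx_bounds _ Hd).
  set (a' := INR (ridx a)) in *. set (b' := INR (ridx b)) in *.
  set (c' := INR (ridx c)) in *. set (d' := INR (ridx d)) in *.
  pose proof (nrm_pos (a - c) (b - d)).
  assert (K : nrm (a' - c') (b' - d') <= r + 3 / 2).
  { apply nrm_step with (1 := Hr). apply nrm_le. { lra. }
    assert (-1 < (a' - c' - (a - c)) < 1) by lra.
    assert (-1 < (b' - d' - (b - d)) < 1) by lra. nra. }
  apply nrm_le in K; [|lra]. nra.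
Qed.

Lemma occ_point d px py : (d < n)%nat -> in_disk (E d) px py ->
  0 <= px <= 12 * NR /\ 0 <= py <= 12 * NR /\ occ (ridx px) (ridx py).
Proof.
  intros Hd H. destruct (E_box d Hd) as (B1 & B2 & B3).
  apply in_disk_nrm in H; [|lra]. destruct (abs_le_nrm _ _ _ H) as [H1 H2].
  split; [lra|]. split; [lra|]. exists d. split; auto. apply fl_diff; auto; lra.
Qed.

Lemma ridx_lt x k : 0 <= x -> x < INR k -> (ridx x < k)%nat.
Proof. intros H1 H2. apply INR_lt. pose proof (ridx_bounds x H1). lra. Qed.

(** Every point of a disk is within 2 of the grid point obtained by rounding it down, which is
    occupied. *)
Lemma covered_of_occ x1 y1 x2 y2 r :
  covered_occ x1 y1 x2 y2 (r + 1) -> covered x1 y1 x2 y2 (r + 3).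
Proof.
  intros H d px py Hd Hp. destruct (occ_point d px py Hd Hp) as (Hx & Hy & Ho).
  pose proof NR_ge.
  assert (L : forall z, 0 <= z <= 12 * NR -> (ridx z < 13 * N)%nat).
  { intros z Hz. apply ridx_lt; [lra|]. rewrite mult_INR. simpl (INR 13). lra. }
  assert (K : nrm (px - INR (ridx px)) (py - INR (ridx py)) <= 2).
  { pose proof (ridx_bounds px) as B1. pose proof (ridx_bounds py) as B2.
    apply nrm_le; [lra|]. nra. }
  replace (r + 3) with (r + 1 + 2) by ring.
  destruct (H (ridx px) (ridx py)) as [A|A]; auto; [left|right];
    apply nrm_step with (1 := A);
    replace (px - _ - _) with (px - INR (ridx px)) by ring;
    replace (py - _ - _) with (py - INR (ridx py)) by ring; exact K.
Qed.

(** The enlargement and the rounding of the center cost 2 each, so an occupied grid point is within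
    4 of a point of the disk itself. *)
Lemma occ_of_covered x1 y1 x2 y2 rho :
  covered x1 y1 x2 y2 rho -> covered_occ x1 y1 x2 y2 (rho + 4).
Proof.
  intros H i j _ _ (d & Hd & Ho). destruct (E_box d Hd) as (B1 & B2 & B3).
  set (D := E d) in *.
  assert (K1 : nrm (INR i - fl (dx D)) (INR j - fl (dy D)) <= dr D + 2).
  { apply nrm_le; lra. }
  assert (K2 : nrm (INR i - dx D) (INR j - dy D) <= dr D + 2 + 2).
  { apply nrm_step with (1 := K1). unfold fl.
    pose proof (ridx_bounds (dx D)) as F1. pose proof (ridx_bounds (dy D)) as F2.
    apply nrm_le; [lra|]. nra. }
  replace (dr D + 2 + 2) with (dr D + 4) in K2 by ring.
  apply nrm_split in K2 as (x' & y' & K2 & K3); try lra.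
  destruct (H d (dx D + x') (dy D + y') Hd) as [A|A].
  - apply in_disk_nrm; [unfold D in B1; lra|]. fold D.
    now replace (dx D + x' - dx D) with x' by ring;
    replace (dy D + y' - dy D) with y' by ring.
  - left. apply nrm_step with (1 := A). eapply Rle_trans; [|exact K3].
    right. apply nrm_ext. ring.
  - right. apply nrm_step with (1 := A). eapply Rle_trans; [|exact K3].
    right. apply nrm_ext. ring.
Qed.

Lemma occ_exists : (1 <= n)%nat ->
  exists i j, (i < 13 * N)%nat /\ (j < 13 * N)%nat /\ occ i j.
Proof.
  intros Hn. destruct (E_box 0) as (B1 & B2 & B3); [lia|]. pose proof NR_ge.
  assert (L : forall z, 0 <= z <= 12 * NR -> (ridx z < 13 * N)%nat).
  { intros z Hz. apply ridx_lt; [lra|]. rewrite mult_INR. simpl (INR 13). lra. }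
  exists (ridx (dx (E 0))), (ridx (dy (E 0))).
  split; [apply L; lra|]. split; [apply L; lra|].
  apply (occ_point 0); [lia|]. apply in_disk_nrm; [lra|].
  unfold Rminus. rewrite !Rplus_opp_r. apply nrm_le; nra.
Qed.

Section Direction.
Variables p q : R.
Hypothesis unit_pq : p * p + q * q = 1.

(** Coordinates in the rotated frame; [p * i] and [q * j] are at least -13 N each, so the shift by
    26 N makes column numbers nonnegative. *)
Definition colu (i j : nat) : R := p * INR i + q * INR j + 26 * NR.
Definition ordi (i j : nat) : R := p * INR j - q * INR i.

Lemma pq_bounds : -1 <= p <= 1 /\ -1 <= q <= 1.
Proof. nra. Qed.

Lemma colu_bounds i j : (i < 13 * N)%nat -> (j < 13 * N)%nat ->
  0 <= colu i j <= 52 * NR /\ - (26 * NR) <= ordi i j <= 26 * NR /\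
  (ridx (colu i j) < 52 * N + 1)%nat.
Proof.
  intros Hi Hj. destruct pq_bounds as [Bp Bq]. unfold colu, ordi.
  assert (0 <= INR i <= 13 * NR) as Bi.
  { split; [apply pos_INR|]. replace (13 * NR) with (INR (13 * N)).
    - apply le_INR. lia.
    - rewrite mult_INR. simpl (INR 13). ring. }
  assert (0 <= INR j <= 13 * NR) as Bj.
  { split; [apply pos_INR|]. replace (13 * NR) with (INR (13 * N)).
    - apply le_INR. lia.
    - rewrite mult_INR. simpl (INR 13). ring. }
  assert (- (13 * NR) <= p * INR i <= 13 * NR) by nra.
  assert (- (13 * NR) <= q * INR i <= 13 * NR) by nra.
  assert (- (13 * NR) <= p * INR j <= 13 * NR) by nra.
  assert (- (13 * NR) <= q * INR j <= 13 * NR) by nra.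
  split; [lra|]. split; [lra|]. apply ridx_lt; [lra|].
  rewrite plus_INR, mult_INR. simpl (INR 1). replace (INR 52) with 52 by (simpl; lra). lra.
Qed.

Variables A B : nat -> R.
Hypothesis A_char : forall c z, (c < 52 * N + 1)%nat -> 0 <= z ->
  (z < A c <-> exists i j, (i < 13 * N)%nat /\ (j < 13 * N)%nat /\ occ i j /\
     ridx (colu i j) = c /\ z < 39 * NR + ordi i j).
Hypothesis B_char : forall c z, (c < 52 * N + 1)%nat -> 0 <= z ->
  (z < B c <-> exists i j, (i < 13 * N)%nat /\ (j < 13 * N)%nat /\ occ i j /\
     ridx (colu i j) = c /\ z < 39 * NR - ordi i j).

Lemma column_bounds i j : (i < 13 * N)%nat -> (j < 13 * N)%nat -> occ i j ->
  let c := ridx (colu i j) in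
  0 < A c /\ 39 * NR + ordi i j <= A c /\ 39 * NR - ordi i j <= B c.
Proof.
  intros Hi Hj Ho c. destruct (colu_bounds i j Hi Hj) as (_ & B2 & B3).
  pose proof NR_ge.
  assert (0 < A c) by (apply A_char; [auto|lra|]; exists i, j; repeat split; auto; lra).
  assert (0 < B c) by (apply B_char; [auto|lra|]; exists i, j; repeat split; auto; lra).
  split; auto. split; apply Rnot_lt_le; intros K.
  - apply (Rlt_irrefl (A c)). apply A_char; auto; [lra|]. exists i, j. repeat split; auto.
  - apply (Rlt_irrefl (B c)). apply B_char; auto; [lra|]. exists i, j. repeat split; auto.
Qed.

(** The point lies between the top and the bottom of its column, so its vertical distance to the
    center is at most [h]; rounding its abscissa to the column adds at most 1. *)
Lemma fits_sound r i j x y : (i < 13 * N)%nat -> (j < 13 * N)%nat -> occ i j ->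
  let c := ridx (colu i j) in fits N r (A c) (B c) c x y ->
  nrm (colu i j - x) (ordi i j - y) <= r + 1.
Proof.
  intros Hi Hj Ho c Hf. destruct (column_bounds i j Hi Hj Ho) as (K1 & K2 & K3).
  fold c in K1, K2, K3. specialize (Hf K1). cbn zeta in Hf.
  set (h := Rmax _ _) in *. destruct Hf as [Hh Hf].
  assert (h1 : ordi i j - y <= h) by (eapply Rle_trans; [|apply Rmax_l]; lra).
  assert (h2 : y - ordi i j <= h) by (eapply Rle_trans; [|apply Rmax_r]; lra).
  assert (Hv : 0 <= r * r - h * h) by nra.
  rewrite sqrt_square in Hf by auto. set (w := sqrt _) in *.
  assert (Hw : w * w = r * r - h * h) by (apply sqrt_sqrt; auto).
  assert (0 <= w) by apply sqrt_pos.
  assert (K : nrm (INR c - x) (ordi i j - y) <= r) by (apply nrm_le; nra).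
  apply nrm_step with (1 := K). destruct (colu_bounds i j Hi Hj) as (B1 & _ & _).
  pose proof (ridx_bounds (colu i j)) as R1. fold c in R1.
  apply nrm_le; [lra|]. nra.
Qed.

(** The points of the column stay within the vertical half chord [w] at abscissa [c]; hence
    [h <= w], and exchanging the legs of the right triangle bounds the horizontal offset by sqrt
    (r^2 - h^2). *)
Lemma fits_complete r c x y : (c < 52 * N + 1)%nat -> - (39 * NR) <= y <= 39 * NR ->
  (forall i j, (i < 13 * N)%nat -> (j < 13 * N)%nat -> occ i j -> ridx (colu i j) = c ->
     nrm (INR c - x) (ordi i j - y) <= r) ->
  fits N r (A c) (B c) c x y.
Proof.
  intros Hc Hy H HA. cbn zeta. set (h := Rmax _ _).
  destruct (proj1 (A_char c 0 Hc (Rle_refl 0)) HA) as (i & j & Hi & Hj & Ho & Hcol & _).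
  pose proof (H i j Hi Hj Ho Hcol) as H0. pose proof (nrm_pos (INR c - x) (ordi i j - y)).
  destruct (abs_le_nrm _ _ _ H0) as [Hcx _].
  assert (Hv : 0 <= r * r - (INR c - x) * (INR c - x)) by nra.
  set (w := sqrt (r * r - (INR c - x) * (INR c - x))).
  assert (Hw : w * w = r * r - (INR c - x) * (INR c - x)) by (apply sqrt_sqrt; auto).
  assert (Hw0 : 0 <= w) by apply sqrt_pos.
  assert (HY : forall i j, (i < 13 * N)%nat -> (j < 13 * N)%nat -> occ i j ->
    ridx (colu i j) = c -> - w <= ordi i j - y <= w).
  { intros i' j' Hi' Hj' Ho' Hcol'. pose proof (H i' j' Hi' Hj' Ho' Hcol') as G.
    apply nrm_le in G; [|lra]. split; nra. }
  assert (HAw : A c <= 39 * NR + y + w).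
  { apply Rnot_lt_le. intros K. apply A_char in K as (i' & j' & Hi' & Hj' & Ho' & Hcol' & K);
      auto; [|lra]. specialize (HY i' j' Hi' Hj' Ho' Hcol'). lra. }
  assert (HBw : B c <= 39 * NR - y + w).
  { apply Rnot_lt_le. intros K. apply B_char in K as (i' & j' & Hi' & Hj' & Ho' & Hcol' & K);
      auto; [|lra]. specialize (HY i' j' Hi' Hj' Ho' Hcol'). lra. }
  destruct (column_bounds i j Hi Hj Ho) as (K1 & K2 & K3). rewrite Hcol in *.
  assert (Hh1 : 0 <= h).
  { assert (A c - 39 * NR - y <= h) by apply Rmax_l.
    assert (B c - 39 * NR + y <= h) by apply Rmax_r. lra. }
  assert (Hh2 : h <= w) by (apply Rmax_lub; lra).
  assert (Hhw : h * h <= w * w) by (apply Rmult_le_compat; auto).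
  assert (Hv2 : 0 <= r * r - h * h).
  { pose proof (Rle_0_sqr (INR c - x)) as G. unfold Rsqr in G. lra. }
  rewrite sqrt_square by auto. set (w' := sqrt _).
  assert (Hw' : w' * w' = r * r - h * h) by (apply sqrt_sqrt; auto).
  assert (0 <= w') by apply sqrt_pos.
  assert (0 <= r) by lra.
  assert (w <= r) by (apply Rsqr_incr_0_var; auto; unfold Rsqr; pose proof (Rle_0_sqr (INR c - x)) as G; unfold Rsqr in G; lra).
  assert (Hcw : (INR c - x) * (INR c - x) <= w' * w') by lra.
  split; [lra|]. split; nra.
Qed.
End Direction.
End Raster.

Lemma fits_mirror N r a b c x y : (c <= 52 * N)%nat ->
  fits N r a b (52 * N - c) x y <-> fits N r a b c (52 * INR N - x) y.
Proof.
  intros Hc. unfold fits. rewrite minus_INR, mult_INR by auto.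
  replace (INR 52) with 52 by (simpl; lra).
  split; intros H Ha; specialize (H Ha); cbn zeta in *; lra.
Qed.

Lemma unit_vector x y : exists L vx vy, 0 <= L /\ vx * vx + vy * vy = 1 /\
  x = L * vx /\ y = L * vy.
Proof.
  destruct (Req_dec (nrm x y) 0) as [E0|E0].
  - exists 0, 1, 0. pose proof (nrm_sq x y) as H. rewrite E0 in H.
    repeat split; try lra; nra.
  - exists (nrm x y), (x / nrm x y), (y / nrm x y). split; [apply nrm_pos|].
    split; [|split; field; auto].
    replace (_ + _) with ((x * x + y * y) / (nrm x y * nrm x y)) by (field; auto).
    rewrite nrm_sq. field. rewrite <- nrm_sq. nra.
Qed.

(** * Splitting a cover along a discretized direction *)

Section Raster.
Variables (N n : nat) (E : nat -> disk).
Notation NR := (INR N).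
Hypothesis N_ge : (4 <= N)%nat.
Hypothesis E_box : forall i, (i < n)%nat -> 0 < dr (E i) /\
  dr (E i) <= dx (E i) <= 12 * NR - dr (E i) /\ dr (E i) <= dy (E i) <= 12 * NR - dr (E i).

Notation occ := (occ n E).
Notation col := (colu N).
Notation covered := (covered n E).
Notation covered_occ := (covered_occ N n E).

Definition col_char (p q : R) (A B : nat -> R) : Prop :=
  forall c z, (c < 52 * N + 1)%nat -> 0 <= z ->
  (z < A c <-> exists i j, (i < 13 * N)%nat /\ (j < 13 * N)%nat /\ occ i j /\
     ridx (col p q i j) = c /\ z < 39 * NR + ordi p q i j) /\
  (z < B c <-> exists i j, (i < 13 * N)%nat /\ (j < 13 * N)%nat /\ occ i j /\
     ridx (col p q i j) = c /\ z < 39 * NR - ordi p q i j).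

(** Grid points have coordinates in [0, 13 N], and a relevant center is within 2 N of one. *)
Definition in_box (x y : R) : Prop :=
  - (2 * NR) <= x <= 15 * NR /\ - (2 * NR) <= y <= 15 * NR.

Definition split_at (d t : nat) (x1 y1 x2 y2 r : R) : Prop :=
  forall i j, (i < 13 * N)%nat -> (j < 13 * N)%nat -> occ i j ->
    let c := ridx (col (cosd N d) (sind N d) i j) in
    ((c < t)%nat -> nrm (INR i - x1) (INR j - y1) <= r) /\
    ((t <= c)%nat -> nrm (INR i - x2) (INR j - y2) <= r).

Lemma grid_bounds i : (i < 13 * N)%nat -> 0 <= INR i <= 13 * NR.
Proof.
  intros Hi. split; [apply pos_INR|].
  replace (13 * NR) with (INR (13 * N)) by (rewrite mult_INR; simpl (INR 13); ring).
  apply le_INR. lia.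
Qed.

Lemma abs_le_bounds x k : Rabs x <= k -> - k <= x <= k.
Proof. intros H. unfold Rabs in H. destruct (Rcase_abs x); lra. Qed.

(* 122 = 2 (60 + 1): 60 accounts for the error on the direction, 1 for the
   width of a column. *)
Lemma oriented_split x1 y1 x2 y2 L vx vy kappa :
  0 <= L -> vx * vx + vy * vy = 1 -> 0 <= vx -> x2 - x1 = L * vx -> y2 - y1 = L * vy ->
  in_box x1 y1 -> in_box x2 y2 -> covered_occ x1 y1 x2 y2 kappa ->
  exists d t, (d <= 2 * N)%nat /\ (t <= 52 * N + 1)%nat /\
    split_at d t x1 y1 x2 y2 (kappa + 122).
Proof.
  intros HL Hv Hvx Hx Hy [B1 B1'] [B2 B2'] Hc. pose proof (NR_ge _ N_ge) as HN.
  destruct (dir_approx N vx vy) as (d & Hd & Hp & Hq); auto; try lia.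
  pose proof (unit_dir N d) as Hu.
  set (p := cosd N d) in *. set (q := sind N d) in *.
  set (mx := (x1 + x2) / 2). set (my := (y1 + y2) / 2).
  set (tm := p * mx + q * my + 26 * NR).
  (* [tm] is the column coordinate of the midpoint of the centers. It may be negative, where [ridx]
     would return an absolute value, or lie beyond the last column. *)
  exists d. set (t := if Rlt_dec tm 0 then 0%nat else Nat.min (ridx tm) (52 * N + 1)).
  exists t. split; [auto|]. split; [unfold t; destruct (Rlt_dec tm 0); lia|].
  intros i j Hi Hj Ho c. fold p q in c.
  destruct (colu_bounds N N_ge p q Hu i j Hi Hj) as (C1 & _ & C2). fold c in C2.
  pose proof (ridx_bounds (col p q i j) (proj1 C1)) as C3. fold c in C3.
  specialize (Hc i j Hi Hj Ho).
  assert (Herr : Rabs ((vx - p) * (INR i - mx) + (vy - q) * (INR j - my)) <= 60).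
  { eapply Rle_trans; [apply Rabs_triang|]. rewrite !Rabs_mult.
    pose proof (grid_bounds i Hi) as Gi. pose proof (grid_bounds j Hj) as Gj.
    assert (Rabs (INR i - mx) <= 15 * NR) by (apply abs_bound; unfold mx; lra).
    assert (Rabs (INR j - my) <= 15 * NR) by (apply abs_bound; unfold my; lra).
    replace 60 with (2 / NR * (15 * NR) + 2 / NR * (15 * NR)) by (field; lra).
    apply Rplus_le_compat; apply Rmult_le_compat; auto; apply Rabs_pos. }
  apply abs_le_bounds in Herr.
  assert (Ecol : p * (INR i - mx) + q * (INR j - my) = col p q i j - tm)
    by (unfold colu, tm; ring).
  split; intros Hct; replace 122 with (2 * 61) by ring.
  - apply (nearer_center x1 y1 x2 y2 L vx vy); auto; [lra|]. fold mx my.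
    enough (col p q i j - tm <= 0) by lra.
    unfold t in Hct. destruct (Rlt_dec tm 0) as [|H0]; [lia|].
    apply Nat.min_glb_lt_iff in Hct as [Hct _].
    pose proof (ridx_bounds tm) as C4. apply (le_INR (S c)) in Hct.
    rewrite S_INR in Hct. lra.
  - apply (nearer_center x2 y2 x1 y1 L (- vx) (- vy)); auto; try lra; try (now apply or_comm).
    replace ((x2 + x1) / 2) with mx by (unfold mx; field).
    replace ((y2 + y1) / 2) with my by (unfold my; field).
    enough (tm - col p q i j <= 1) by lra.
    unfold t in Hct. destruct (Rlt_dec tm 0) as [|H0]; [lra|].
    apply Rnot_lt_le in H0. pose proof (ridx_bounds tm H0) as C4.
    assert (Hct' : (ridx tm <= c)%nat) by lia. apply le_INR in Hct'. lra.
Qed.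

Lemma near_in_box i j x y r : (i < 13 * N)%nat -> (j < 13 * N)%nat -> r <= 2 * NR ->
  nrm (INR i - x) (INR j - y) <= r -> in_box x y.
Proof.
  intros Hi Hj Hr H. apply abs_le_nrm in H as [H1 H2].
  pose proof (grid_bounds i Hi). pose proof (grid_bounds j Hj). split; lra.
Qed.

(** The available directions cover only the right half circle; exchanging the centers reverses the
    direction between them. *)
Lemma touching_split x1 y1 x2 y2 kappa :
  in_box x1 y1 -> in_box x2 y2 -> covered_occ x1 y1 x2 y2 kappa ->
  exists d t a1 b1 a2 b2, (d <= 2 * N)%nat /\ (t <= 52 * N + 1)%nat /\
    in_box a1 b1 /\ in_box a2 b2 /\ split_at d t a1 b1 a2 b2 (kappa + 122).
Proof.
  intros B1 B2 Hc. destruct (unit_vector (x2 - x1) (y2 - y1)) as (L & vx & vy & HL & Hv & Hx & Hy).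
  destruct (Rle_dec 0 vx) as [H|H].
  - destruct (oriented_split x1 y1 x2 y2 L vx vy kappa) as (d & t & Hd & Ht & HS); auto.
    exists d, t, x1, y1, x2, y2. auto.
  - destruct (oriented_split x2 y2 x1 y1 L (- vx) (- vy) kappa) as (d & t & Hd & Ht & HS);
      auto; try lra.
    { intros i j Hi Hj Ho. apply or_comm. auto. }
    exists d, t, x2, y2, x1, y1. auto.
Qed.

Lemma covered_split x1 y1 x2 y2 rho : (1 <= n)%nat -> covered x1 y1 x2 y2 rho -> rho <= NR ->
  exists d t a1 b1 a2 b2, (d <= 2 * N)%nat /\ (t <= 52 * N + 1)%nat /\
    in_box a1 b1 /\ in_box a2 b2 /\ split_at d t a1 b1 a2 b2 (rho + 126).
Proof.
  intros n_pos Hc Hr. pose proof (NR_ge _ N_ge) as HN.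
  apply (occ_of_covered N n E E_box) in Hc. replace (rho + 126) with (rho + 4 + 122) by ring.
  set (kappa := rho + 4) in *. assert (Hk : kappa <= 2 * NR) by (unfold kappa; lra).
  (* A disk that meets no occupied point can lie anywhere, outside the box; it is then replaced by a
     second copy of the other disk. *)
  assert (one : forall x y, (forall i j, (i < 13 * N)%nat -> (j < 13 * N)%nat -> occ i j ->
     nrm (INR i - x) (INR j - y) <= kappa) ->
    exists d t a1 b1 a2 b2, (d <= 2 * N)%nat /\ (t <= 52 * N + 1)%nat /\
    in_box a1 b1 /\ in_box a2 b2 /\ split_at d t a1 b1 a2 b2 (kappa + 122)).
  { intros x y H. destruct (occ_exists N n E N_ge E_box n_pos) as (i & j & Hi & Hj & Ho).
    assert (in_box x y) by (apply (near_in_box i j x y kappa); auto).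
    apply (touching_split x y x y); auto. intros i' j' Hi' Hj' Ho'. left. auto. }
  destruct (classic (exists i j, (i < 13 * N)%nat /\ (j < 13 * N)%nat /\ occ i j /\
     nrm (INR i - x1) (INR j - y1) <= kappa)) as [(i & j & Hi & Hj & Ho & H1)|H1].
  2:{ apply (one x2 y2). intros i j Hi Hj Ho. destruct (Hc i j Hi Hj Ho); auto.
      exfalso. apply H1. eauto 7. }
  destruct (classic (exists i j, (i < 13 * N)%nat /\ (j < 13 * N)%nat /\ occ i j /\
     nrm (INR i - x2) (INR j - y2) <= kappa)) as [(i' & j' & Hi' & Hj' & Ho' & H2)|H2].
  2:{ apply (one x1 y1). intros i' j' Hi' Hj' Ho'. destruct (Hc i' j' Hi' Hj' Ho'); auto.
      exfalso. apply H2. eauto 7. }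
  apply (touching_split x1 y1 x2 y2); auto.
  - apply (near_in_box i j x1 y1 kappa); auto.
  - apply (near_in_box i' j' x2 y2 kappa); auto.
Qed.

Section Direction.
Variables (p q : R) (A B : nat -> R).
Hypothesis unit_pq : p * p + q * q = 1.
Hypothesis AB_char : col_char p q A B.

Lemma A_char : forall c z, (c < 52 * N + 1)%nat -> 0 <= z ->
  (z < A c <-> exists i j, (i < 13 * N)%nat /\ (j < 13 * N)%nat /\ occ i j /\
     ridx (col p q i j) = c /\ z < 39 * NR + ordi p q i j).
Proof. intros c z Hc Hz. now apply AB_char. Qed.

Lemma B_char : forall c z, (c < 52 * N + 1)%nat -> 0 <= z ->
  (z < B c <-> exists i j, (i < 13 * N)%nat /\ (j < 13 * N)%nat /\ occ i j /\
     ridx (col p q i j) = c /\ z < 39 * NR - ordi p q i j).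
Proof. intros c z Hc Hz. now apply AB_char. Qed.

Lemma rotate_back i j X Y : nrm (p * i + q * j - X) (p * j - q * i - Y) =
  nrm (i - (p * X - q * Y)) (j - (q * X + p * Y)).
Proof.
  rewrite <- (nrm_rot p q (i - (p * X - q * Y))) by auto. f_equal.
  - transitivity (p * i + q * j - (p * p + q * q) * X); [rewrite unit_pq|]; ring.
  - transitivity (p * j - q * i - (p * p + q * q) * Y); [rewrite unit_pq|]; ring.
Qed.

Lemma success_covered r bL bR xL yL xR yR : (52 * N + 1 <= bL + bR)%nat ->
  (forall c, (c < bL)%nat -> fits N r (A c) (B c) c xL yL) ->
  (forall c, (c < bR)%nat -> fits N r (A (52 * N - c)) (B (52 * N - c)) c xR yR) ->
  covered (p * (xL - 26 * NR) - q * yL) (q * (xL - 26 * NR) + p * yL)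
          (p * (26 * NR - xR) - q * yR) (q * (26 * NR - xR) + p * yR) (r + 3).
Proof.
  intros Hb HL HR. apply (covered_of_occ N n E N_ge E_box). intros i j Hi Hj Ho.
  destruct (colu_bounds N N_ge p q unit_pq i j Hi Hj) as (_ & _ & Hc).
  set (c := ridx (col p q i j)) in *.
  rewrite <- !rotate_back.
  destruct (Nat.lt_ge_cases c bL) as [K|K]; [left|right].
  - pose proof (fits_sound N n E N_ge p q unit_pq A B A_char B_char r i j xL yL Hi Hj Ho (HL c K))
      as F. unfold colu, ordi in F.
    replace (_ - _) with (p * INR i + q * INR j + 26 * NR - xL) by ring. exact F.
  (* As [bL + bR] reaches the number of columns, the mirror image of a column not below [bL] is
     below [bR]. *)
  - specialize (HR (52 * N - c)%nat). replace (52 * N - (52 * N - c))%nat with c in HR by lia.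
    rewrite fits_mirror in HR by lia.
    pose proof (fits_sound N n E N_ge p q unit_pq A B A_char B_char r i j _ yR Hi Hj Ho
      (HR ltac:(lia))) as F. unfold colu, ordi in F.
    replace (p * INR i + q * INR j - (26 * NR - xR)) with
      (p * INR i + q * INR j + 26 * NR - (52 * NR - xR)) by ring. exact F.
Qed.

(** The center is rotated and its ordinate rounded down to a candidate of the scan; this and the
    rounding of abscissas to columns cost less than 2. [P] selects a prefix or a suffix of the
    columns. *)
Lemma fits_near r x y (P : nat -> Prop) : in_box x y ->
  (forall i j, (i < 13 * N)%nat -> (j < 13 * N)%nat -> occ i j -> P (ridx (col p q i j)) ->
     nrm (INR i - x) (INR j - y) <= r) ->
  exists x' k, - (4 * NR) <= x' <= 56 * NR /\ (k < 78 * N + 1)%nat /\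
    forall c, (c < 52 * N + 1)%nat -> P c -> fits N (r + 2) (A c) (B c) c x' (INR k - 39 * NR).
Proof.
  intros [Bx By] H. pose proof (NR_ge _ N_ge) as HN.
  destruct (pq_bounds p q unit_pq) as [Bp Bq].
  assert (K1 : - (15 * NR) <= p * x <= 15 * NR) by nra.
  assert (K2 : - (15 * NR) <= q * y <= 15 * NR) by nra.
  assert (K3 : - (15 * NR) <= p * y <= 15 * NR) by nra.
  assert (K4 : - (15 * NR) <= q * x <= 15 * NR) by nra.
  set (y' := p * y - q * x).
  assert (Hy : 0 <= y' + 39 * NR) by (unfold y'; lra).
  exists (p * x + q * y + 26 * NR), (ridx (y' + 39 * NR)).
  pose proof (ridx_bounds _ Hy) as Rb. set (k := ridx (y' + 39 * NR)) in *.
  split; [lra|]. split.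
  { apply INR_lt. rewrite plus_INR, mult_INR. replace (INR 78) with 78 by (simpl; lra).
    simpl (INR 1). unfold y' in *. lra. }
  intros c Hc HP. apply (fits_complete N n E N_ge p q unit_pq A B A_char B_char); auto.
  { unfold y' in *. lra. }
  intros i j Hi Hj Ho Hcol.
  assert (G : nrm (INR i - x) (INR j - y) <= r) by (apply H; auto; now rewrite Hcol).
  rewrite <- (nrm_rot p q) in G by auto.
  apply nrm_step with (1 := G).
  destruct (colu_bounds N N_ge p q unit_pq i j Hi Hj) as (C1 & _ & _).
  pose proof (ridx_bounds (col p q i j) (proj1 C1)) as C2. rewrite Hcol in C2.
  unfold ordi. unfold colu in C2. unfold y' in Rb.
  apply nrm_le; [lra|].
  set (u := INR c - _ - _). set (v := p * INR j - q * INR i - _ - _).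
  assert (-1 <= u <= 1) by (unfold u; lra). assert (-1 <= v <= 1) by (unfold v; lra).
  assert (u * u <= 1) by nra. assert (v * v <= 1) by nra. lra.
Qed.

End Direction.
End Raster.

(** * Search over directions and radii *)

Section Search.
Variables (N n : nat) (E : nat -> disk).
Notation NR := (INR N).
Notation run := (run_cmd n N).
Notation eval := (eval_expr n N).
Hypothesis N_ge : (4 <= N)%nat.
Hypothesis E_box : forall i, (i < n)%nat -> 0 < dr (E i) /\
  dr (E i) <= dx (E i) <= 12 * NR - dr (E i) /\ dr (E i) <= dy (E i) <= 12 * NR - dr (E i).
Hypothesis n_pos : (1 <= n)%nat.

Lemma direction_spec d s : sc s dir = INR d ->
  sc (run direction s) vp = cosd N d /\ sc (run direction s) vq = sind N d.
Proof.
  intros Hd. unfold direction. rewrite !run_Seq, !run_Set.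
  cbn [eval_expr aop_eval sc set_sc Nat.eqb]. rewrite Hd.
  pose proof (NR_ge N N_ge). rewrite (safe_div_eq (INR d)) by lra. fold (slope N d).
  assert (1 + slope N d * slope N d <> 0) by nra.
  now rewrite !safe_div_eq by auto.
Qed.

Definition raster_ok (s : state) : Prop := forall i j, (i < 13 * N)%nat -> (j < 13 * N)%nat ->
  (0 < ar s 3%nat (prn i j) <-> occ n E i j).

Lemma columns_char s : raster_ok s ->
  col_char N n E (sc s vp) (sc s vq) (ar (run columns s) 4%nat) (ar (run columns s) 5%nat).
Proof.
  intros Hok c z Hc Hz. destruct (columns_spec n N s c z Hc Hz) as [H1 H2].
  split; [rewrite H1|rewrite H2]; split; intros (i & j & Hi & Hj & Ho & H);
    exists i, j; (split; [auto|split; [auto|split; [now apply Hok|exact H]]]).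
Qed.

Lemma trial_spec d s : sc s dir = INR d -> raster_ok s ->
  let s' := run trial s in
  exists bL bR A B, sc s' bestL = INR bL /\ sc s' bestR = INR bR /\
    sc s' vp = cosd N d /\ sc s' vq = sind N d /\
    col_char N n E (cosd N d) (sind N d) A B /\
    (forall c, (c < bL)%nat -> fits N (sc s cur) (A c) (B c) c (sc s' bxL) (sc s' byL)) /\
    (forall c, (c < bR)%nat -> fits N (sc s cur) (A (52 * N - c)%nat) (B (52 * N - c)%nat) c
       (sc s' bxR) (sc s' byR)) /\
    (forall t x j, (t <= 52 * N + 1)%nat -> (j < 78 * N + 1)%nat -> -100 * NR <= x <= 200 * NR ->
       (forall c, (c < t)%nat -> fits N (sc s cur) (A c) (B c) c x (INR j - 39 * NR)) ->
       (t <= bL)%nat) /\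
    (forall t x j, (t <= 52 * N + 1)%nat -> (j < 78 * N + 1)%nat -> -100 * NR <= x <= 200 * NR ->
       (forall c, (c < t)%nat -> fits N (sc s cur) (A (52 * N - c)%nat) (B (52 * N - c)%nat) c x
         (INR j - 39 * NR)) -> (t <= bR)%nat).
Proof.
  intros Hd Hok. unfold trial. rewrite !run_Seq. cbn zeta.
  destruct (direction_spec d s Hd) as [Hp Hq].
  pose proof (run_frame n N direction s) as [Fs1 Fa1]. set (s1 := run direction s) in *.
  pose proof (columns_char s1) as HC. rewrite Hp, Hq in HC.
  pose proof (run_frame n N columns s1) as [Fs2 Fa2]. set (s2 := run columns s1) in *.
  destruct (scan_spec n N ($vi)%prog (fun c => c) bestL bxL byL s2) as (bL & _ & L1 & L2 & L3).
  { now left. } { intros c s' _ Hs'. exact Hs'. }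
  pose proof (run_frame n N (scan ($vi)%prog bestL bxL byL) s2) as [Fs3 Fa3].
  set (s3 := run (scan ($vi)%prog bestL bxL byL) s2) in *.
  destruct (scan_spec n N (#52 * NN - $vi)%prog (fun c => (52 * N - c)%nat) bestR bxR byR s3)
    as (bR & _ & R1 & R2 & R3).
  { now right. }
  { intros c s' Hc Hs'. cbn [eval_expr aop_eval]. rewrite Hs', minus_INR, mult_INR by lia.
    replace (INR 52) with 52 by (simpl; lra). reflexivity. }
  pose proof (run_frame n N (scan (#52 * NN - $vi)%prog bestR bxR byR) s3) as [Fs4 Fa4].
  set (s4 := run (scan (#52 * NN - $vi)%prog bestR bxR byR) s3) in *.
  clearbody s1 s2 s3 s4.
  assert (C2 : sc s2 cur = sc s cur) by (now rewrite Fs2, Fs1).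
  assert (C3 : sc s3 cur = sc s cur) by (now rewrite Fs3).
  exists bL, bR, (ar s2 4%nat), (ar s2 5%nat).
  split; [now rewrite Fs4|]. split; [auto|].
  split; [now rewrite Fs4, Fs3, Fs2|]. split; [now rewrite Fs4, Fs3, Fs2|].
  split.
  { apply HC. intros i j Hi Hj. rewrite Fa1 by reflexivity. now apply Hok. }
  rewrite C2 in *. rewrite C3 in *.
  split; [|split; [|split]].
  - intros c Hc. rewrite (Fs4 bxL), (Fs4 byL) by reflexivity. now apply L2.
  - intros c Hc. rewrite <- !Fa3 by reflexivity. now apply R2.
  - intros t x j Ht Hj Hx H. now apply (L3 t x j).
  - intros t x j Ht Hj Hx H. apply (R3 t x j); auto.
    intros c Hc. rewrite !Fa3 by reflexivity. now apply H.
Qed.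

Notation state_covered s := (covered n E (sc s o1x) (sc s o1y) (sc s o2x) (sc s o2y)).

Lemma accept_spec s : let s' := run accept s in
  sc s' o1x = sc s vp * (sc s bxL - 26 * NR) - sc s vq * sc s byL /\
  sc s' o1y = sc s vq * (sc s bxL - 26 * NR) + sc s vp * sc s byL /\
  sc s' o2x = sc s vp * (26 * NR - sc s bxR) - sc s vq * sc s byR /\
  sc s' o2y = sc s vq * (26 * NR - sc s bxR) + sc s vp * sc s byR /\
  sc s' o1r = sc s cur + 3 /\ sc s' cur = sc s cur - 1 /\ sc s' dir = sc s dir /\
  ar s' = ar s.
Proof. repeat split. Qed.

(* No cover of radius at most [r - 128] splits along direction [d]. *)
Definition refuted (d : nat) (r : R) : Prop :=
  forall t a1 b1 a2 b2 rho, 0 <= rho -> (t <= 52 * N + 1)%nat ->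
    in_box N a1 b1 -> in_box N a2 b2 -> split_at N n E d t a1 b1 a2 b2 (rho + 126) ->
    r < rho + 128.

(** Of the [m] trials, [d] failed and [m - d] succeeded. The 4 is the 3 lost when an accepted radius
    becomes a true cover, plus the decrement that follows. *)
Definition search_inv (m : nat) (s : state) : Prop :=
  raster_ok s /\ exists d, (d <= m)%nat /\ sc s dir = INR d /\
    sc s cur = NR - 4 - INR (m - d) /\ sc s o1r = sc s cur + 4 /\ 0 <= sc s o1r /\
    state_covered s (sc s o1r) /\ forall d', (d' < d)%nat -> refuted d' (sc s cur).

Lemma search_step m s : search_inv m s -> search_inv (S m) (run settle (run trial s)).
Proof.
  intros (Hok & d & Hdm & Hd & Hcur & Hr & Hr0 & Hcov & Href).
  destruct (trial_spec d s Hd Hok)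
    as (bL & bR & A & B & EL & ER & Ep & Eq & HAB & SL & SR & CL & CR).
  pose proof (run_frame n N trial s) as [Fs Fa].
  pose proof (unit_dir N d) as Hu. pose proof (NR_ge N N_ge) as HN.
  set (s1 := run trial s) in *. clearbody s1.
  assert (Hok1 : raster_ok s1).
  { intros i j Hi Hj. rewrite Fa by reflexivity. now apply Hok. }
  assert (Hcur1 : sc s1 cur = sc s cur) by now rewrite Fs.
  assert (fail : refuted d (sc s cur) -> search_inv (S m) (set_sc s1 dir (sc s1 dir + 1))).
  { intros HF. split; auto. exists (S d). cbn -[INR].
    rewrite !Fs by reflexivity. rewrite Hd, S_INR, Hcur.
    split; [lia|]. split; [auto|]. split; [do 2 f_equal; lia|].
    rewrite <- Hcur. split; [auto|split; [auto|split; [auto|]]].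
    intros d' Hd'. apply lt_S_INR in Hd' as [Hd'| ->]; auto. }
  unfold settle. rewrite !run_If, run_Set. cbn [eval_expr aop_eval]. rewrite EL, ER, Hcur1.
  destruct (Rlt_dec (INR bL + INR bR) (52 * NR + 1)) as [Hb|Hb];
    [|destruct (Rlt_dec (sc s cur) 0) as [Hneg|Hneg]].
  (* Otherwise a split with [rho + 126 <= cur - 2] would give a prefix of [t] columns and a suffix
     of the remaining ones, contradicting the maximality of [bL] and [bR]. *)
  - apply fail. intros t a1 b1 a2 b2 rho Hrho Ht B1 B2 HS.
    apply Rnot_le_lt. intros Hle.
    destruct (fits_near N n E N_ge _ _ A B Hu HAB (sc s cur - 2) a1 b1 (fun c => (c < t)%nat))
      as (x & j & Hx & Hj & HF); auto.
    { intros i j Hi Hj Ho Hc. apply Rle_trans with (rho + 126); [|lra]. now apply HS. }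
    destruct (fits_near N n E N_ge _ _ A B Hu HAB (sc s cur - 2) a2 b2 (fun c => (t <= c)%nat))
      as (x' & j' & Hx' & Hj' & HF'); auto.
    { intros i k Hi Hk Ho Hc. apply Rle_trans with (rho + 126); [|lra]. now apply HS. }
    replace (sc s cur - 2 + 2) with (sc s cur) in * by ring.
    assert (KL : (t <= bL)%nat).
    { apply (CL t x j); auto; [lra|]. intros c Hc. apply HF; auto. lia. }
    assert (KR : (52 * N + 1 - t <= bR)%nat).
    { apply (CR _ (52 * NR - x') j'); auto; [lia|lra|]. intros c Hc.
      apply fits_mirror; [lia|]. apply HF'; lia. }
    assert (K : (52 * N + 1 <= bL + bR)%nat) by lia. apply le_INR in K.
    rewrite !plus_INR, mult_INR in K. simpl (INR 1) in K.
    replace (INR 52) with 52 in K by (simpl; lra). lra.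
  - apply fail. intros t a1 b1 a2 b2 rho Hrho _ _ _ _. lra.
  - assert (K : (52 * N + 1 <= bL + bR)%nat).
    { apply INR_le. rewrite !plus_INR, mult_INR. simpl (INR 1).
      replace (INR 52) with 52 by (simpl; lra). lra. }
    pose proof (success_covered N n E N_ge E_box _ _ A B Hu HAB _ _ _ _ _ _ _ K SL SR) as HC.
    destruct (accept_spec s1) as (G1 & G2 & G3 & G4 & G5 & G6 & G7 & G8).
    split. { unfold raster_ok. rewrite G8. exact Hok1. } exists d.
    rewrite G1, G2, G3, G4, G5, G6, G7, Ep, Eq, Hcur1.
    rewrite (Fs dir) by reflexivity. rewrite Hcur in *.
    replace (S m - d)%nat with (S (m - d)) by lia. rewrite S_INR.
    split; [lia|]. split; [auto|]. split; [ring|]. split; [ring|]. split; [lra|].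
    split; [exact HC|].
    (* Earlier refutations survive because the radius has only decreased. *)
    intros d' Hd' t a1 b1 a2 b2 rho H1 H2 H3 H4 H5.
    pose proof (Href d' Hd' t a1 b1 a2 b2 rho H1 H2 H3 H4 H5). lra.
Qed.

Lemma search_spec s : raster_ok s ->
  covered n E (6 * NR) (6 * NR) ((sc s p2x - sc s qx) * sc s scl + sc s off)
    ((sc s p2y - sc s qy) * sc s scl + 6 * NR) NR ->
  let s' := run search s in
  0 <= sc s' o1r <= NR /\ state_covered s' (sc s' o1r) /\
  forall x1 y1 x2 y2 rho, 0 <= rho -> covered n E x1 y1 x2 y2 rho -> sc s' o1r <= rho + 132.
Proof.
  intros Hok Hinit s'. pose proof (NR_ge N N_ge) as HN.
  assert (HI : search_inv (3 * N) s').
  { unfold s', search. rewrite !run_Seq, !run_Set.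
    apply (for_rule n N it 0 3 0 _ (3 * N)%nat search_inv).
    - lia.
    - split; [exact Hok|]. exists 0%nat. cbn -[INR].
      split; [lia|]. split; [reflexivity|]. split; [simpl (INR 0); lra|].
      split; [lra|]. split; [lra|]. split; [exact Hinit|]. intros; lia.
    - intros m s1 Hm HI _. rewrite run_Seq.
      apply (search_step m (set_sc s1 it (INR m))). exact HI. }
  destruct HI as (_ & d & Hdm & Hd & Hcur & Hr & Hr0 & Hcov & Href).
  split; [|split; auto].
  - split; auto. pose proof (pos_INR (3 * N - d)). lra.
  - intros x1 y1 x2 y2 rho Hrho Hc. destruct (Rle_dec rho NR) as [HrN|HrN].
    2:{ pose proof (pos_INR (3 * N - d)). lra. }
    destruct (covered_split N n E N_ge E_box x1 y1 x2 y2 rho n_pos Hc HrN)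
      as (d' & t & a1 & b1 & a2 & b2 & Hd' & Ht & B1 & B2 & HS).
    (* Either the good direction was refuted, or at most 2 N of the 3 N trials failed; then at least
       N succeeded and [o1r] is at most 0. *)
    destruct (Nat.lt_ge_cases d' d) as [L|L].
    + pose proof (Href d' L t a1 b1 a2 b2 rho Hrho Ht B1 B2 HS). lra.
    + assert (K : (N <= 3 * N - d)%nat) by lia. apply le_INR in K. lra.
Qed.
End Search.

(** * Normalization *)

Definition dist2 (x y a b : R) : R := (x - a) * (x - a) + (y - b) * (y - b).

(** Two of the three points share a disk. This gives both lower bounds on the optimum that make R0
    at most four times as large. *)
Lemma pigeonhole rho a1 b1 a2 b2 (x y : nat -> R) m :
  (forall i, (i < 3)%nat -> nrm (x i - a1) (y i - b1) <= rho \/ nrm (x i - a2) (y i - b2) <= rho) ->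
  (forall i j, (i < j)%nat -> (j < 3)%nat -> m <= nrm (x i - x j) (y i - y j)) ->
  m <= 2 * rho.
Proof.
  intros H Hm.
  assert (K : forall a b i j, (i < j)%nat -> (j < 3)%nat -> nrm (x i - a) (y i - b) <= rho ->
    nrm (x j - a) (y j - b) <= rho -> m <= 2 * rho).
  { intros a b i j Hij Hj H1 H2. eapply Rle_trans; [now apply (Hm i j)|].
    replace (2 * rho) with (rho + rho) by ring. apply nrm_step with (1 := H1).
    eapply Rle_trans; [|exact H2]. right. apply nrm_ext. ring. }
  destruct (H 0%nat) as [H0|H0], (H 1%nat) as [H1|H1], (H 2%nat) as [H2|H2]; try lia.
  - exact (K a1 b1 0%nat 1%nat ltac:(lia) ltac:(lia) H0 H1).
  - exact (K a1 b1 0%nat 1%nat ltac:(lia) ltac:(lia) H0 H1).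
  - exact (K a1 b1 0%nat 2%nat ltac:(lia) ltac:(lia) H0 H2).
  - exact (K a2 b2 1%nat 2%nat ltac:(lia) ltac:(lia) H1 H2).
  - exact (K a1 b1 1%nat 2%nat ltac:(lia) ltac:(lia) H1 H2).
  - exact (K a2 b2 0%nat 2%nat ltac:(lia) ltac:(lia) H0 H2).
  - exact (K a2 b2 0%nat 1%nat ltac:(lia) ltac:(lia) H0 H1).
  - exact (K a2 b2 0%nat 1%nat ltac:(lia) ltac:(lia) H0 H1).
Qed.

(** * Moving the two clusters into a common square *)

Section Normalize.
Variables (N n : nat) (D : nat -> disk) (P1x P1y P2x P2y R0 Qx Qy Off : R).
Notation NR := (INR N).
Notation S0 := (NR / R0).
Hypothesis N_ge : (4 <= N)%nat.
Hypothesis R0_pos : 0 < R0.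
Hypothesis D_pos : forall i, (i < n)%nat -> 0 < dr (D i).

Definition cl (x y : R) : bool :=
  if Rlt_dec (dist2 x y P2x P2y) (dist2 x y P1x P1y) then true else false.
Definition px (b : bool) := if b then P2x else P1x.
Definition py (b : bool) := if b then P2y else P1y.
Definition tx (b : bool) (x : R) : R :=
  if b then (x - Qx) * S0 + Off else (x - P1x) * S0 + 6 * NR.
Definition ty (b : bool) (y : R) : R :=
  if b then (y - Qy) * S0 + 6 * NR else (y - P1y) * S0 + 6 * NR.
Definition norm_disk (C : disk) : disk :=
  let b := cl (dx C) (dy C) in Disk (tx b (dx C)) (ty b (dy C)) (dr C * S0).
Definition far_case : Prop :=
  25 * (R0 * R0) < dist2 P2x P2y P1x P1y /\ Qx = P2x /\ Qy = P2y /\ Off = 11 * NR.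
Definition near_case : Prop :=
  dist2 P2x P2y P1x P1y <= 25 * (R0 * R0) /\ Qx = P1x /\ Qy = P1y /\ Off = 6 * NR.

Hypothesis cases : far_case \/ near_case.
Hypothesis cluster_bound : forall i, (i < n)%nat ->
  let b := cl (dx (D i)) (dy (D i)) in
  nrm (dx (D i) - px b) (dy (D i) - py b) + dr (D i) <= R0.

Lemma NR_pos : 4 <= NR.
Proof. exact (NR_ge N N_ge). Qed.

Lemma S0_pos : 0 < S0.
Proof. pose proof NR_pos. apply Rdiv_lt_0_compat; lra. Qed.

Lemma S0_R0 : S0 * R0 = NR.
Proof. field. lra. Qed.

Lemma t_diff b x y a c : nrm (tx b x - tx b a) (ty b y - ty b c) = S0 * nrm (x - a) (y - c).
Proof.
  rewrite <- nrm_scale by (apply Rlt_le, S0_pos). f_equal; destruct b; simpl; ring.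
Qed.

Lemma near_t b b' x y : near_case -> tx b x = tx b' x /\ ty b y = ty b' y.
Proof.
  intros (_ & H1 & H2 & H3). unfold tx, ty. destruct b, b'; rewrite ?H1, ?H2, ?H3; auto.
Qed.

Lemma norm_box i : (i < n)%nat -> let C := norm_disk (D i) in
  0 < dr C /\ dr C <= dx C <= 12 * NR - dr C /\ dr C <= dy C <= 12 * NR - dr C.
Proof.
  intros Hi C. pose proof (cluster_bound i Hi) as H. pose proof (D_pos i Hi) as Hp.
  pose proof S0_pos as HS. pose proof S0_R0 as HE. pose proof NR_pos.
  set (b := cl (dx (D i)) (dy (D i))) in *. unfold C, norm_disk. fold b. simpl.
  set (x := dx (D i)) in *. set (y := dy (D i)) in *. set (r := dr (D i)) in *.
  assert (H' : nrm (x - px b) (y - py b) <= R0 - r) by lra.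
  apply abs_le_nrm in H' as [Hx Hy].
  assert (Hr : 0 < r * S0) by nra.
  (* Used with k = 1 in the far case, where disks stay within N of their cluster origin, and with k
     = 6 in the near case, where the second cluster is within 5 R0 + R0 of the first center. *)
  assert (K : forall z k, - (k * R0 - r) <= z <= k * R0 - r ->
    - (k * NR - r * S0) <= z * S0 <= k * NR - r * S0).
  { intros z k [Hz1 Hz2].
    apply (Rmult_le_compat_r S0) in Hz1, Hz2; try lra.
    assert (k * (S0 * R0) = k * NR) by now rewrite HE. lra. }
  split; auto. destruct cases as [(_ & HQ1 & HQ2 & HO)|(Hd & HQ1 & HQ2 & HO)].
  - unfold tx, ty. rewrite HQ1, HQ2, HO. clear HQ1 HQ2 HO.
    destruct b; cbn [px py] in *;
    [pose proof (K (x - P2x) 1) as Kx; pose proof (K (y - P2y) 1) as Ky|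
     pose proof (K (x - P1x) 1) as Kx; pose proof (K (y - P1y) 1) as Ky]; lra.
  - assert (G : nrm (x - P1x) (y - P1y) <= R0 - r + 5 * R0).
    { destruct b; cbn [px py] in *.
      - assert (H' : nrm (x - P2x) (y - P2y) <= R0 - r) by lra.
        apply nrm_step with (1 := H'). apply nrm_le; [lra|]. unfold dist2 in Hd. nra.
      - lra. }
    apply abs_le_nrm in G as [Gx Gy].
    destruct (near_t b false x y) as [-> ->]. { repeat split; auto. }
    simpl. pose proof (K (x - P1x) 6) as Kx. pose proof (K (y - P1y) 6) as Ky. lra.
Qed.

Notation E := (fun i => norm_disk (D i)).

Lemma norm_cluster i X Y : (i < n)%nat -> in_disk (norm_disk (D i)) X Y ->
  let b := cl (dx (D i)) (dy (D i)) in nrm (X - tx b (px b)) (Y - ty b (py b)) <= NR.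
Proof.
  intros Hi H b. pose proof (cluster_bound i Hi) as Hc. pose proof (D_pos i Hi).
  pose proof S0_pos as HS. pose proof S0_R0 as HE.
  apply in_disk_nrm in H; [|simpl; nra]. unfold norm_disk in H. fold b in H, Hc. simpl in H.
  replace NR with (dr (D i) * S0 + S0 * (R0 - dr (D i))) by (rewrite <- HE at 3; ring).
  apply nrm_step with (1 := H).
  replace (_ - _ - _) with (tx b (dx (D i)) - tx b (px b)) by ring.
  replace (_ - _ - _) with (ty b (dy (D i)) - ty b (py b)) by ring.
  rewrite t_diff. apply Rmult_le_compat_l; lra.
Qed.

Lemma t_P1 : tx false P1x = 6 * NR /\ ty false P1y = 6 * NR.
Proof. unfold tx, ty. split; ring. Qed.

Lemma initial_cover : covered n E (6 * NR) (6 * NR) ((P2x - Qx) * S0 + Off) ((P2y - Qy) * S0 + 6 * NR) NR.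
Proof.
  intros i X Y Hi H. pose proof (norm_cluster i X Y Hi H) as K. cbn zeta in K.
  destruct (cl _ _); [right; exact K|left]. cbn [px py] in K.
  destruct t_P1 as [E1 E2]. now rewrite E1, E2 in K.
Qed.

Definition side (X : R) : bool := if Rlt_dec (17 * NR) (2 * X) then true else false.
Definition backx (X : R) : R :=
  if side X then (X - Off) * (R0 / NR) + Qx else (X - 6 * NR) * (R0 / NR) + P1x.
Definition backy (X Y : R) : R :=
  if side X then (Y - 6 * NR) * (R0 / NR) + Qy else (Y - 6 * NR) * (R0 / NR) + P1y.

Lemma t_back X Y : tx (side X) (backx X) = X /\ ty (side X) (backy X Y) = Y.
Proof.
  pose proof NR_pos. unfold tx, ty, backx, backy. destruct (side X); split; field; lra.
Qed.

(** In the far case a center that covers a point of a cluster is within 2 N of its origin, so its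
    abscissa is at most 8 N or at least 9 N, and [side] recognizes the cluster. *)
Lemma cover_back X1 Y1 X2 Y2 r : 0 <= r <= NR -> covered n E X1 Y1 X2 Y2 r ->
  forall i x y, (i < n)%nat -> in_disk (D i) x y ->
    nrm (x - backx X1) (y - backy X1 Y1) <= r * (R0 / NR) \/
    nrm (x - backx X2) (y - backy X2 Y2) <= r * (R0 / NR).
Proof.
  intros Hr HC i x y Hi H. pose proof (D_pos i Hi). pose proof S0_pos as HS.
  pose proof S0_R0 as HE. pose proof NR_pos as HN.
  set (b := cl (dx (D i)) (dy (D i))).
  assert (HP : in_disk (norm_disk (D i)) (tx b x) (ty b y)).
  { apply in_disk_nrm in H; [|lra]. apply in_disk_nrm; [simpl; nra|].
    unfold norm_disk. fold b. simpl. rewrite t_diff. nra. }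
  pose proof (norm_cluster i _ _ Hi HP) as HK. fold b in HK. cbn zeta in HK.
  enough (K : forall X Y, nrm (tx b x - X) (ty b y - Y) <= r ->
    nrm (x - backx X) (y - backy X Y) <= r * (R0 / NR)).
  { destruct (HC i _ _ Hi HP); auto. }
  intros X Y HX.
  assert (Et : tx b x = tx (side X) x /\ ty b y = ty (side X) y).
  { destruct cases as [(Hf & HQ1 & HQ2 & HO)|Hn]; [|now apply near_t].
    enough (b = side X) as -> by auto.
    apply abs_le_nrm in HK as [HK _]. apply abs_le_nrm in HX as [HX _].
    unfold side. destruct b; cbn [px py] in HK.
    - assert (tx true P2x = 11 * NR) by (unfold tx; rewrite HQ1, HO; ring).
      destruct (Rlt_dec _ _); auto. lra.
    - destruct t_P1 as [T1 _]. destruct (Rlt_dec _ _); auto. lra. }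
  destruct Et as [Ex Ey]. destruct (t_back X Y) as [Bx By].
  rewrite Ex, Ey in HX. rewrite <- Bx in HX at 2. rewrite <- By in HX at 1.
  rewrite t_diff in HX. apply Rmult_le_reg_l with S0; auto.
  replace (S0 * (r * (R0 / NR))) with r by (field; lra). exact HX.
Qed.

(** In the far case a disk of radius at most R0 serves a single cluster: its center is within 2 R0
    of that cluster's center and more than 3 R0 from the other, so mapping it by its nearer cluster
    preserves the covered points. *)
Lemma cover_forth a1 b1 a2 b2 rho : 0 <= rho <= R0 ->
  (forall i x y, (i < n)%nat -> in_disk (D i) x y ->
     nrm (x - a1) (y - b1) <= rho \/ nrm (x - a2) (y - b2) <= rho) ->
  covered n E (tx (cl a1 b1) a1) (ty (cl a1 b1) b1) (tx (cl a2 b2) a2) (ty (cl a2 b2) b2)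
    (rho * S0).
Proof.
  intros Hr HC i X Y Hi H. pose proof (D_pos i Hi). pose proof S0_pos as HS.
  pose proof S0_R0 as HE. pose proof NR_pos as HN.
  pose proof (cluster_bound i Hi) as Hcl. set (b := cl (dx (D i)) (dy (D i))) in *.
  assert (Hxy : exists x y, tx b x = X /\ ty b y = Y).
  { unfold tx, ty. destruct b;
    [exists ((X - Off) / S0 + Qx), ((Y - 6 * NR) / S0 + Qy)|
     exists ((X - 6 * NR) / S0 + P1x), ((Y - 6 * NR) / S0 + P1y)]; split; field; lra. }
  destruct Hxy as (x & y & <- & <-).
  assert (HP : nrm (x - dx (D i)) (y - dy (D i)) <= dr (D i)).
  { apply in_disk_nrm in H; [|simpl; nra]. unfold norm_disk in H. fold b in H. simpl in H.
    rewrite t_diff in H. nra. }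
  assert (HPc : nrm (x - px b) (y - py b) <= R0).
  { pose proof (nrm_triangle (x - dx (D i)) (y - dy (D i)) (dx (D i) - px b) (dy (D i) - py b)) as T.
    cbn zeta in Hcl. fold b in Hcl.
    replace (x - dx (D i) + (dx (D i) - px b)) with (x - px b) in T by ring.
    replace (y - dy (D i) + (dy (D i) - py b)) with (y - py b) in T by ring. lra. }
  enough (K : forall a c, nrm (x - a) (y - c) <= rho ->
    nrm (tx b x - tx (cl a c) a) (ty b y - ty (cl a c) c) <= rho * S0).
  { destruct (HC i x y Hi); auto. apply in_disk_nrm; auto. lra. }
  intros a c Hac.
  assert (Et : tx b x = tx (cl a c) x /\ ty b y = ty (cl a c) y).
  { destruct cases as [(Hf & _)|Hn]; [|now apply near_t].
    enough (b = cl a c) as -> by auto.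
    assert (Ha : nrm (a - px b) (c - py b) <= R0 + R0).
    { replace (R0 + R0) with (R0 + R0) by ring. apply nrm_step with (1 := HPc).
      replace (_ - _ - _) with (- (x - a)) by ring.
      replace (_ - _ - _) with (- (y - c)) by ring.
      eapply Rle_trans; [|apply (proj2 Hr)]. eapply Rle_trans; [|exact Hac].
      right. apply nrm_ext. ring. }
    assert (Hb : 5 * R0 < nrm (P2x - P1x) (P2y - P1y)).
    { apply Rnot_le_lt. intros K. apply nrm_le in K; [|lra]. unfold dist2 in Hf. nra. }
    assert (Hother : 3 * R0 < nrm (a - px (negb b)) (c - py (negb b))).
    { apply Rnot_le_lt. intros K.
      pose proof (nrm_triangle (a - px b) (c - py b) (- (a - px (negb b))) (- (c - py (negb b)))) as T.
      rewrite (nrm_ext (- (a - px (negb b))) _ (a - px (negb b)) (c - py (negb b))) in T by ring.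
      enough (nrm (P2x - P1x) (P2y - P1y) <=
        nrm (a - px b + - (a - px (negb b))) (c - py b + - (c - py (negb b)))) by lra.
      right. apply nrm_ext. destruct b; cbn [px py negb]; ring. }
    pose proof (nrm_sq (a - px b) (c - py b)) as Q1.
    pose proof (nrm_sq (a - px (negb b)) (c - py (negb b))) as Q2.
    pose proof (nrm_pos (a - px b) (c - py b)).
    assert (L : dist2 a c (px b) (py b) < dist2 a c (px (negb b)) (py (negb b))).
    { unfold dist2. rewrite <- Q1, <- Q2. nra. }
    unfold cl. destruct b; cbn [px py negb] in L; destruct (Rlt_dec _ _); auto; lra. }
  destruct Et as [-> ->]. rewrite t_diff. nra.
Qed.

End Normalize.

(** * Correctness of clustering, rasterization and output *)

Section Setup.
Variables (N n : nat) (D : nat -> disk).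
Notation NR := (INR N).
Notation run := (run_cmd n N).
Notation eval := (eval_expr n N).
Hypothesis N_ge : (4 <= N)%nat.
Hypothesis n_pos : (1 <= n)%nat.
Hypothesis D_pos : forall i, (i < n)%nat -> 0 < dr (D i).

(** Relocation turns input cell a into entry a - 1 of array 0, so the data of disk [i] start at
    [3 * i + 1]. *)
Definition loaded (s : state) : Prop := forall i, (i < n)%nat ->
  ar s 0%nat (3 * i + 1)%nat = dx (D i) /\ ar s 0%nat (3 * i + 2)%nat = dy (D i) /\
  ar s 0%nat (3 * i + 3)%nat = dr (D i).

Lemma loaded_frame lv la s s' : frame lv la s s' -> mem_nat 0 la = false -> loaded s -> loaded s'.
Proof. intros [_ F] H0 H i Hi. rewrite !F by auto. auto. Qed.

Lemma eval_disk s i : loaded s -> (i < n)%nat -> sc s vi = INR i ->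
  eval s dkx = dx (D i) /\ eval s dky = dy (D i) /\ eval s dkr = dr (D i).
Proof.
  intros HL Hi Hv. destruct (HL i Hi) as (<- & <- & <-).
  unfold dkx, dky, dkr. cbn [eval_expr aop_eval]. rewrite Hv.
  assert (K : forall k, 3 * INR i + INR k = INR (3 * i + k)).
  { intros k. rewrite plus_INR, mult_INR. simpl (INR 3). lra. }
  repeat split; f_equal; rewrite <- (ridx_INR (3 * i + _)), <- K; f_equal; simpl; lra.
Qed.

Lemma distances_spec s i : loaded s -> (i < n)%nat -> sc s vi = INR i ->
  run distances s = set_sc (set_sc s d1 (dist2 (dx (D i)) (dy (D i)) (sc s p1x) (sc s p1y)))
    d2 (dist2 (dx (D i)) (dy (D i)) (sc s p2x) (sc s p2y)).
Proof.
  intros HL Hi Hv. unfold distances. rewrite run_Seq, !run_Set.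
  destruct (eval_disk s i HL Hi Hv) as (E1 & E2 & _).
  cbn [eval_expr aop_eval]. rewrite E1, E2.
  set (s1 := set_sc s d1 _).
  destruct (eval_disk s1 i) as (E3 & E4 & _); auto.
  rewrite E3, E4. reflexivity.
Qed.

Lemma farthest_spec s : loaded s -> let s' := run farthest s in
  sc s' p1x = dx (D 0) /\ sc s' p1y = dy (D 0) /\
  exists j, (j < n)%nat /\ sc s' p2x = dx (D j) /\ sc s' p2y = dy (D j) /\
    sc s' far = dist2 (dx (D j)) (dy (D j)) (dx (D 0)) (dy (D 0)) /\
    forall i, (i < n)%nat -> dist2 (dx (D i)) (dy (D i)) (dx (D 0)) (dy (D 0)) <= sc s' far.
Proof.
  intros HL. destruct (HL 0%nat n_pos) as (X0 & Y0 & _). simpl in X0, Y0.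
  assert (R1 : ridx 1 = 1%nat) by (exact (ridx_INR 1)).
  assert (R2 : ridx 2 = 2%nat) by (exact (ridx_INR 2)).
  unfold farthest. rewrite !run_Seq, !run_Set.
  set (s1 := set_sc _ far _).
  assert (K1 : sc s1 p1x = dx (D 0) /\ sc s1 p1y = dy (D 0) /\ sc s1 p2x = dx (D 0) /\
    sc s1 p2y = dy (D 0) /\ sc s1 far = 0 /\ loaded s1).
  { unfold s1. cbn [eval_expr sc set_sc ar Nat.eqb]. rewrite R1, R2. repeat split; auto; apply HL; auto. }
  clearbody s1. destruct K1 as (A1 & A2 & A3 & A4 & A5 & L1).
  enough (K : forall k, k = n -> let s' := run (For vi 1 0 0 (distances;;
    If ($far) ($d1) (far <- $d1;; p2x <- dkx;; p2y <- dky) Skip)%prog) s1 in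
    sc s' p1x = dx (D 0) /\ sc s' p1y = dy (D 0) /\
    exists j, (j < n)%nat /\ sc s' p2x = dx (D j) /\ sc s' p2y = dy (D j) /\
    sc s' far = dist2 (dx (D j)) (dy (D j)) (dx (D 0)) (dy (D 0)) /\
    forall i, (i < k)%nat -> dist2 (dx (D i)) (dy (D i)) (dx (D 0)) (dy (D 0)) <= sc s' far)
    by (now apply (K n)).
  intros k Hk.
  apply (for_rule n N vi 1 0 0 _ k (fun k s' =>
    sc s' p1x = dx (D 0) /\ sc s' p1y = dy (D 0) /\
    exists j, (j < n)%nat /\ sc s' p2x = dx (D j) /\ sc s' p2y = dy (D j) /\
    sc s' far = dist2 (dx (D j)) (dy (D j)) (dx (D 0)) (dy (D 0)) /\
    forall i, (i < k)%nat -> dist2 (dx (D i)) (dy (D i)) (dx (D 0)) (dy (D 0)) <= sc s' far)).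
  - lia.
  - split; [auto|split; [auto|]]. exists 0%nat. rewrite A3, A4, A5.
    repeat split; auto; try lia. unfold dist2. ring.
  - intros m s2 Hm (B1 & B2 & j & Hj & B3 & B4 & B5 & B6) F2.
    assert (L2 : loaded s2) by (eapply loaded_frame; eauto).
    set (s3 := set_sc s2 vi (INR m)).
    rewrite run_Seq, (distances_spec s3 m) by (auto; lia).
    rewrite run_If. set (s4 := set_sc (set_sc s3 d1 _) d2 _).
    destruct (eval_disk s4 m) as (E1 & E2 & _); auto; try lia.
    assert (V1 : eval s4 ($d1)%prog = dist2 (dx (D m)) (dy (D m)) (dx (D 0)) (dy (D 0))).
    { unfold s4, s3. cbn [eval_expr sc set_sc Nat.eqb]. now rewrite B1, B2. }
    rewrite V1. change (eval s4 ($far)%prog) with (sc s2 far).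
    destruct (Rlt_dec _ _) as [Hlt|Hlt].
    + rewrite !run_Seq, !run_Set. set (s5 := set_sc _ p2y _).
      assert (V2 : sc s5 far = dist2 (dx (D m)) (dy (D m)) (dx (D 0)) (dy (D 0))) by exact V1.
      assert (V3 : sc s5 p2x = dx (D m)) by exact E1.
      assert (V4 : sc s5 p2y = dy (D m)) by exact E2.
      split; [exact B1|]. split; [exact B2|]. exists m. rewrite V2, V3, V4.
      repeat split; auto; [lia|]. intros i Hi. apply lt_S_INR in Hi as [Hi| ->]; [|lra].
      specialize (B6 i Hi). lra.
    + split; [exact B1|]. split; [exact B2|]. exists j. cbn [run_cmd].
      split; [auto|]. split; [exact B3|]. split; [exact B4|]. split; [exact B5|].
      intros i Hi. change (sc s4 far) with (sc s2 far).
      apply lt_S_INR in Hi as [Hi| ->]; [auto|lra].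
Qed.

Definition dmin (s : state) (i : nat) : R :=
  Rmin (dist2 (dx (D i)) (dy (D i)) (sc s p1x) (sc s p1y))
       (dist2 (dx (D i)) (dy (D i)) (sc s p2x) (sc s p2y)).

Lemma spread_spec s : loaded s ->
  let s' := run spread s in
  (0 <= sc s' sep /\ (sc s' sep = 0 \/ exists i, (i < n)%nat /\ sc s' sep = dmin s i) /\
     forall i, (i < n)%nat -> dmin s i <= sc s' sep) /\
  ((exists i, (i < n)%nat /\ sc s' rmax = dr (D i)) /\
     forall i, (i < n)%nat -> dr (D i) <= sc s' rmax).
Proof.
  intros HL. unfold spread. rewrite !run_Seq, !run_Set.
  set (s1 := set_sc (set_sc s sep _) rmax _).
  enough (K : forall k, k = n -> let s' := run (For vi 1 0 0 (
    distances;; UpMin d1 ($d2);; UpMax sep ($d1);; UpMax rmax dkr)%prog) s1 in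
    (0 <= sc s' sep /\ (sc s' sep = 0 \/ exists i, (i < n)%nat /\ sc s' sep = dmin s i) /\
     forall i, (i < k)%nat -> dmin s i <= sc s' sep) /\
    ((sc s' rmax = 0 \/ exists i, (i < n)%nat /\ sc s' rmax = dr (D i)) /\
     forall i, (i < k)%nat -> dr (D i) <= sc s' rmax)).
  { destruct (K n eq_refl) as (K1 & [K2|K2] & K3); [exfalso|auto].
    specialize (K3 0%nat n_pos). specialize (D_pos 0%nat n_pos). lra. }
  intros k Hk.
  apply (for_rule n N vi 1 0 0 _ k (fun k s' =>
    (0 <= sc s' sep /\ (sc s' sep = 0 \/ exists i, (i < n)%nat /\ sc s' sep = dmin s i) /\
     forall i, (i < k)%nat -> dmin s i <= sc s' sep) /\
    ((sc s' rmax = 0 \/ exists i, (i < n)%nat /\ sc s' rmax = dr (D i)) /\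
     forall i, (i < k)%nat -> dr (D i) <= sc s' rmax))).
  - lia.
  - cbn. split; split; try lra; auto; try (split; [auto|]); intros; lia.
  - intros m s2 Hm ((B1 & B2 & B3) & B4 & B5) F2.
    assert (L2 : loaded s2) by (eapply loaded_frame; [exact F2|reflexivity|exact HL]).
    set (s3 := set_sc s2 vi (INR m)).
    rewrite !run_Seq, (distances_spec s3 m), run_UpMin, !run_UpMax by (auto; lia).
    match goal with |- context [eval ?x dkr] => set (s5 := x) in * end.
    destruct (eval_disk s5 m) as (_ & _ & E3); auto; try lia. rewrite E3.
    assert (V : sc s5 sep = Rmax (sc s2 sep) (dmin s m) /\ sc s5 rmax = sc s2 rmax).
    { split; [|reflexivity]. destruct F2 as [F2 _].
      unfold s5, s3, dmin. cbn [eval_expr sc set_sc Nat.eqb].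
      rewrite (F2 p1x), (F2 p1y), (F2 p2x), (F2 p2y) by reflexivity. reflexivity. }
    destruct V as [V1 V2]. clearbody s5. cbn [sc set_sc Nat.eqb]. rewrite V1, V2.
    split; split.
    + eapply Rle_trans; [exact B1|apply Rmax_l].
    + split.
      * unfold Rmax. destruct (Rle_dec _ _); [right; exists m; split; auto; lia|auto].
      * intros i Hi. apply lt_S_INR in Hi as [Hi| ->]; [|apply Rmax_r].
        eapply Rle_trans; [now apply B3|apply Rmax_l].
    + unfold Rmax. destruct (Rle_dec _ _); [right; exists m; split; auto; lia|auto].
    + intros i Hi. apply lt_S_INR in Hi as [Hi| ->]; [|apply Rmax_r].
      eapply Rle_trans; [now apply B5|apply Rmax_l].
Qed.

Lemma reference_spec s : 0 <= sc s sep -> 0 < sc s rmax ->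
  let s' := run reference s in
  sc s' big = sqrt (sc s sep) + sc s rmax /\ sc s' scl = NR / sc s' big /\
  (25 * (sc s' big * sc s' big) < sc s far /\
     sc s' qx = sc s p2x /\ sc s' qy = sc s p2y /\ sc s' off = 11 * NR \/
   sc s far <= 25 * (sc s' big * sc s' big) /\
     sc s' qx = sc s p1x /\ sc s' qy = sc s p1y /\ sc s' off = 6 * NR).
Proof.
  intros H1 H2. unfold reference. rewrite !run_Seq, !run_Set, run_If.
  set (s1 := set_sc s big _).
  assert (V : sc s1 big = sqrt (sc s sep) + sc s rmax).
  { unfold s1. cbn [eval_expr aop_eval sc set_sc Nat.eqb]. now rewrite sqrt_square. }
  assert (Hb : sc s1 big <> 0).
  { rewrite V. pose proof (sqrt_pos (sc s sep)). lra. }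
  rewrite <- V. cbn [eval_expr aop_eval].
  change (sc s1 far) with (sc s far).
  destruct (Rlt_dec _ _) as [Hlt|Hlt]; cbn [run_cmd eval_expr aop_eval sc set_sc Nat.eqb];
    rewrite safe_div_eq by auto; (split; [auto|split; [auto|]]); [left|right];
    repeat split; auto; lra.
Qed.

Notation norm s := (norm_disk N (sc s p1x) (sc s p1y) (sc s p2x) (sc s p2y) (sc s big)
  (sc s qx) (sc s qy) (sc s off)).

Lemma bucket_spec s : loaded s -> sc s scl = NR / sc s big ->
  (forall a, ar s 1%nat a = 0) ->
  (forall i, (i < n)%nat -> 0 <= dx (norm s (D i)) /\ 0 <= dy (norm s (D i))) ->
  forall a b z, 0 <= z ->
  (z < ar (run bucket s) 1%nat (prn a b) <-> exists i, (i < n)%nat /\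
     ridx (dx (norm s (D i))) = a /\ ridx (dy (norm s (D i))) = b /\
     z < (dr (norm s (D i)) + 2) * (dr (norm s (D i)) + 2)).
Proof.
  intros HL Hscl H0 Hpos.
  set (E := fun i => norm s (D i)) in *.
  enough (K : forall k, k = n -> forall a b z, 0 <= z ->
    (z < ar (run bucket s) 1%nat (prn a b) <-> exists i, (i < k)%nat /\
     ridx (dx (E i)) = a /\ ridx (dy (E i)) = b /\ z < (dr (E i) + 2) * (dr (E i) + 2)))
    by (now apply K).
  intros k Hk. unfold bucket.
  apply (for_rule n N vi 1 0 0 _ k (fun k s' => forall a b z, 0 <= z ->
    (z < ar s' 1%nat (prn a b) <-> exists i, (i < k)%nat /\
     ridx (dx (E i)) = a /\ ridx (dy (E i)) = b /\ z < (dr (E i) + 2) * (dr (E i) + 2)))).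
  { lia. }
  { intros a b z Hz. rewrite H0. split; [lra|]. intros (i & Hi & _). lia. }
  intros m s2 Hm I2 F2.
  assert (L2 : loaded s2) by (eapply loaded_frame; [exact F2|reflexivity|exact HL]).
  set (s3 := set_sc s2 vi (INR m)).
  rewrite !run_Seq, (distances_spec s3 m) by (auto; lia).
  rewrite run_If, run_Set, run_PutMax.
  set (s4 := set_sc (set_sc s3 d1 _) d2 _).
  destruct (eval_disk s4 m) as (E1 & E2 & _); auto; try lia.
  change (eval s4 ($d2)%prog) with (dist2 (dx (D m)) (dy (D m)) (sc s2 p2x) (sc s2 p2y)).
  change (eval s4 ($d1)%prog) with (dist2 (dx (D m)) (dy (D m)) (sc s2 p1x) (sc s2 p1y)).
  destruct F2 as [F2 _].
  rewrite (F2 p1x), (F2 p1y), (F2 p2x), (F2 p2y) by reflexivity.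
  match goal with |- context [set_sc ?x vt _] => set (s6 := x) in * end.
  assert (V : sc s6 vx = dx (E m) /\ sc s6 vy = dy (E m) /\ sc s6 vi = INR m /\ ar s6 = ar s2 /\
    sc s6 scl = NR / sc s big).
  { unfold s6, E, norm_disk, cl.
    destruct (Rlt_dec _ _).
    - rewrite !run_Seq, !run_Set.
      set (s5 := set_sc s4 vx _). destruct (eval_disk s5 m) as (_ & E4 & _); auto; try lia.
      cbn [eval_expr aop_eval sc set_sc Nat.eqb dx dy]. rewrite E4.
      unfold s5. cbn [eval_expr aop_eval sc set_sc Nat.eqb dx dy]. rewrite E1.
      unfold s4, s3. cbn [eval_expr aop_eval sc set_sc Nat.eqb dx dy].
      rewrite !F2 by reflexivity. rewrite Hscl. repeat split; reflexivity.
    - rewrite !run_Seq, !run_Set.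
      set (s5 := set_sc s4 vx _). destruct (eval_disk s5 m) as (_ & E4 & _); auto; try lia.
      cbn [eval_expr aop_eval sc set_sc Nat.eqb dx dy]. rewrite E4.
      unfold s5. cbn [eval_expr aop_eval sc set_sc Nat.eqb dx dy]. rewrite E1.
      unfold s4, s3. cbn [eval_expr aop_eval sc set_sc Nat.eqb dx dy].
      rewrite !F2 by reflexivity. rewrite Hscl. repeat split; reflexivity. }
  destruct V as (V1 & V2 & V3 & V4 & V5). clearbody s6.
  destruct (eval_disk s6 m) as (_ & _ & E6); auto; try lia.
  { intros i Hi. rewrite V4. now apply L2. }
  set (s7 := set_sc s6 vt _).
  assert (T7 : sc s7 vt = dr (E m) + 2).
  { unfold s7. cbn [eval_expr aop_eval sc set_sc Nat.eqb]. now rewrite E6, V5. }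
  destruct (Hpos m) as [P1 P2]; [lia|]. fold (E m) in P1, P2.
  rewrite (eval_epair n N s7 _ _ (ridx (dx (E m))) (ridx (dy (E m)))), ridx_INR.
  2:{ cbn [eval_expr]. change (sc s7 vx) with (sc s6 vx). rewrite V1. now apply rfloor_ridx. }
  2:{ cbn [eval_expr]. change (sc s7 vy) with (sc s6 vy). rewrite V2. now apply rfloor_ridx. }
  cbn [eval_expr aop_eval]. rewrite T7. change (ar s7) with (ar s6). rewrite V4.
  intros a b z Hz. cbn [ar set_ar Nat.eqb andb]. change (ar s7) with (ar s6). rewrite V4.
  destruct (Nat.eqb_spec (prn a b) (prn (ridx (dx (E m))) (ridx (dy (E m))))) as [Eq|Ne].
  - apply prn_inj in Eq as [-> ->]. rewrite Rlt_Rmax_r, I2 by auto. split.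
    + intros [(i & Hi & H)|H]; [exists i|exists m]; auto.
    + intros (i & Hi & H). apply lt_S_INR in Hi as [Hi| ->]; [left; exists i|right]; tauto.
  - rewrite I2 by auto. split.
    + intros (i & Hi & H). exists i. auto.
    + intros (i & Hi & H). exists i. split; auto. apply lt_S_INR in Hi as [Hi| ->]; auto.
      destruct H as (<- & <- & _). congruence.
Qed.

(** The inner transform is only queried at the threshold (i - k)^2, which is nonnegative, so its
    truncation at 0 loses nothing. *)
Lemma raster_spec s (E : nat -> disk) :
  (forall i, (i < n)%nat -> 0 < dr (E i) /\
    dr (E i) <= dx (E i) <= 12 * NR - dr (E i) /\ dr (E i) <= dy (E i) <= 12 * NR - dr (E i)) ->
  (forall a b z, 0 <= z -> (z < ar s 1%nat (prn a b) <-> exists i, (i < n)%nat /\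
     ridx (dx (E i)) = a /\ ridx (dy (E i)) = b /\ z < (dr (E i) + 2) * (dr (E i) + 2))) ->
  raster_ok N n E (run (transform 2 3) (run (transform 1 2) s)).
Proof.
  intros Hbox H1 i j Hi Hj. rewrite transform_spec by (auto; lra).
  assert (Sq : forall x : R, 0 <= x * x) by (intros; nra).
  assert (L : forall z, 0 <= z <= 12 * NR -> (ridx z < 13 * N)%nat).
  { intros z Hz. pose proof (NR_ge N N_ge). apply ridx_lt; [lra|].
    rewrite mult_INR. simpl (INR 13). lra. }
  split.
  - intros (k & Hk & H2).
    assert (H3 : (INR i - INR k) * (INR i - INR k) < ar (run (transform 1 2) s) 2%nat (prn j k)) by lra.
    rewrite transform_spec in H3 by auto. destruct H3 as (l & Hl & H3).
    assert (H4 : (INR i - INR k) * (INR i - INR k) + (INR j - INR l) * (INR j - INR l) <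
      ar s 1%nat (prn k l)) by lra.
    apply H1 in H4.
    2:{ pose proof (Sq (INR i - INR k)). pose proof (Sq (INR j - INR l)). lra. }
    destruct H4 as (d & Hd & <- & <- & H4). exists d. auto.
  - intros (d & Hd & H). destruct (Hbox d Hd) as (B1 & B2 & B3).
    exists (ridx (dx (E d))). split; [apply L; lra|].
    apply Rlt_0_minus. rewrite transform_spec by (auto; apply L; lra).
    exists (ridx (dy (E d))). split; [apply L; lra|].
    apply Rplus_lt_reg_r with ((INR j - INR (ridx (dy (E d)))) * (INR j - INR (ridx (dy (E d))))).
    match goal with |- _ < ?x => replace x with (ar s 1%nat (prn (ridx (dx (E d))) (ridx (dy (E d))))) by ring end.
    apply H1.
    { pose proof (Sq (INR i - INR (ridx (dx (E d))))).
      pose proof (Sq (INR j - INR (ridx (dy (E d))))). lra. }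
    exists d. auto.
Qed.

Lemma map_back_spec ox oy s : (ox, oy) = (o1x, o1y) \/ (ox, oy) = (o2x, o2y) ->
  sc s vt = sc s big / NR ->
  let s' := run (map_back ox oy) s in
  sc s' ox = backx N (sc s p1x) (sc s big) (sc s qx) (sc s off) (sc s ox) /\
  sc s' oy = backy N (sc s p1y) (sc s big) (sc s qy) (sc s ox) (sc s oy).
Proof.
  intros H Ht. unfold map_back. cbn zeta. rewrite run_If, !run_Seq, !run_Set.
  unfold backx, backy, side. cbn [eval_expr aop_eval].
  destruct H as [H|H]; injection H as -> ->;
    (destruct (Rlt_dec _ _); cbn [eval_expr aop_eval sc set_sc Nat.eqb]; rewrite Ht; auto).
Qed.

Lemma finish_spec s : let s' := run finish s in
  sc s' o1x = backx N (sc s p1x) (sc s big) (sc s qx) (sc s off) (sc s o1x) /\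
  sc s' o1y = backy N (sc s p1y) (sc s big) (sc s qy) (sc s o1x) (sc s o1y) /\
  sc s' o2x = backx N (sc s p1x) (sc s big) (sc s qx) (sc s off) (sc s o2x) /\
  sc s' o2y = backy N (sc s p1y) (sc s big) (sc s qy) (sc s o2x) (sc s o2y) /\
  sc s' o1r = sc s o1r * (sc s big / NR) /\ sc s' o2r = sc s' o1r.
Proof.
  pose proof (NR_ge N N_ge). cbn zeta. unfold finish. rewrite !run_Seq, !run_Set.
  cbn [eval_expr aop_eval]. rewrite safe_div_eq by lra.
  set (s1 := set_sc s vt (sc s big / NR)).
  destruct (map_back_spec o1x o1y s1) as [A1 A2]; auto.
  pose proof (run_frame n N (map_back o1x o1y) s1) as [F _].
  set (s2 := run (map_back o1x o1y) s1) in *.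
  destruct (map_back_spec o2x o2y s2) as [B1 B2]; auto.
  { rewrite !F by reflexivity. reflexivity. }
  pose proof (run_frame n N (map_back o2x o2y) s2) as [G _].
  set (s3 := run (map_back o2x o2y) s2) in *. clearbody s2 s3.
  cbn [sc set_sc Nat.eqb].
  rewrite (G o1x), (G o1y), (G o1r), (G vt), A1, A2, (F o1r), (F vt), B1, B2 by reflexivity.
  rewrite !F by reflexivity. repeat split.
Qed.
End Setup.

Lemma input_mem_disk Ds eps i d : (i < length Ds)%nat ->
  input_mem Ds eps (3 * i + 2)%nat = dx (nth i Ds d) /\
  input_mem Ds eps (3 * i + 3)%nat = dy (nth i Ds d) /\
  input_mem Ds eps (3 * i + 4)%nat = dr (nth i Ds d).
Proof.
  intros Hi. apply (nth_error_nth' Ds d) in Hi.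
  assert (K : forall k, (k < 3)%nat -> input_mem Ds eps (3 * i + k + 2)%nat =
    match k with O => dx (nth i Ds d) | S O => dy (nth i Ds d) | _ => dr (nth i Ds d) end).
  { intros k Hk. replace (3 * i + k + 2)%nat with (S (S (3 * i + k))) by lia.
    cbn [input_mem].
    replace ((3 * i + k) / 3)%nat with i by (apply (Nat.div_unique _ 3 i k); lia).
    replace ((3 * i + k) mod 3)%nat with k by (apply (Nat.mod_unique _ 3 i k); lia).
    now rewrite Hi. }
  split; [|split].
  - rewrite <- (K 0%nat) by lia. f_equal. lia.
  - rewrite <- (K 1%nat) by lia. f_equal. lia.
  - rewrite <- (K 2%nat) by lia. f_equal. lia.
Qed.

(** * Approximation guarantee of the whole program *)

Section Algorithm.
Variables (N n : nat) (D : nat -> disk) (s0 : state).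
Notation NR := (INR N).
Notation run := (run_cmd n N).
Hypothesis N_ge : (4 <= N)%nat.
Hypothesis n_pos : (1 <= n)%nat.
Hypothesis D_pos : forall i, (i < n)%nat -> 0 < dr (D i).
Hypothesis s0_loaded : loaded n D s0.
Hypothesis s0_zero : forall i, ar s0 1%nat i = 0.

Definition feasible (rho : R) : Prop := exists x1 y1 x2 y2, forall i x y,
  (i < n)%nat -> in_disk (D i) x y ->
  nrm (x - x1) (y - y1) <= rho \/ nrm (x - x2) (y - y2) <= rho.

(** Apply the pigeonhole to the center and the two ends of a horizontal diameter. *)
Lemma feasible_radius rho i : feasible rho -> (i < n)%nat -> dr (D i) <= 2 * rho.
Proof.
  intros (x1 & y1 & x2 & y2 & H) Hi. specialize (D_pos i Hi).
  set (r := dr (D i)) in *. set (x := dx (D i)) in *. set (y := dy (D i)) in *.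
  set (f := fun k => match k with O => - r | S O => 0 | _ => r end).
  apply (pigeonhole rho x1 y1 x2 y2 (fun k => x + f k) (fun _ => y)).
  - intros k Hk. apply (H i); auto. apply in_disk_nrm; fold r; [lra|]. fold x y.
    replace (x + f k - x) with (f k) by ring. replace (y - y) with 0 by ring.
    apply nrm_le; [lra|]. unfold f. destruct k as [|[|k]]; nra.
  - intros j k Hj Hk. replace (x + f j - (x + f k)) with (f j - f k) by ring.
    replace (y - y) with 0 by ring. rewrite <- (sqrt_square r) by lra.
    apply sqrt_le_1_alt. unfold f.
    destruct j as [|[|j]], k as [|[|k]]; try lia; nra.
Qed.

Lemma center_in_disk i : (i < n)%nat -> in_disk (D i) (dx (D i)) (dy (D i)).
Proof. intros Hi. specialize (D_pos i Hi). unfold in_disk. nra. Qed.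

Lemma feasible_centers rho i j k m : feasible rho -> (i < n)%nat -> (j < n)%nat -> (k < n)%nat ->
  m <= nrm (dx (D i) - dx (D j)) (dy (D i) - dy (D j)) ->
  m <= nrm (dx (D i) - dx (D k)) (dy (D i) - dy (D k)) ->
  m <= nrm (dx (D j) - dx (D k)) (dy (D j) - dy (D k)) -> m <= 2 * rho.
Proof.
  intros (x1 & y1 & x2 & y2 & H) Hi Hj Hk H1 H2 H3.
  set (f := fun a => match a with O => i | S O => j | _ => k end).
  apply (pigeonhole rho x1 y1 x2 y2 (fun a => dx (D (f a))) (fun a => dy (D (f a)))).
  - intros a Ha. apply (H (f a)); [|apply center_in_disk];
      unfold f; destruct a as [|[|a]]; auto.
  - intros a b Ha Hb. unfold f. destruct a as [|[|a]], b as [|[|b]]; try lia; auto.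
Qed.

Lemma two_center_correct : let s := run two_center s0 in
  0 <= sc s o1r /\ sc s o2r = sc s o1r /\
  (forall i x y, (i < n)%nat -> in_disk (D i) x y ->
     nrm (x - sc s o1x) (y - sc s o1y) <= sc s o1r \/
     nrm (x - sc s o2x) (y - sc s o2y) <= sc s o1r) /\
  forall rho, 0 <= rho -> feasible rho -> sc s o1r <= rho * (1 + 528 / NR).
Proof.
  cbn zeta. unfold two_center. rewrite !run_Seq.
  destruct (farthest_spec N n D N_ge n_pos s0 s0_loaded) as (A1 & A2 & j & Hj & A3 & A4 & A5 & A6).
  pose proof (run_frame n N farthest s0) as F1. set (s1 := run farthest s0) in *.
  assert (L1 : loaded n D s1) by (eapply loaded_frame; [exact F1|reflexivity|auto]).
  destruct (spread_spec N n D N_ge n_pos D_pos s1 L1) as ((B1 & B2 & B3) & (i0 & Hi0 & B4) & B5).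
  pose proof (run_frame n N spread s1) as F2. set (s2 := run spread s1) in *.
  assert (L2 : loaded n D s2) by (eapply loaded_frame; [exact F2|reflexivity|auto]).
  assert (B6 : 0 < sc s2 rmax) by (rewrite B4; auto).
  destruct (reference_spec N n s2 B1 B6) as (C1 & C2 & C3).
  pose proof (run_frame n N reference s2) as F3. set (s3 := run reference s2) in *.
  assert (L3 : loaded n D s3) by (eapply loaded_frame; [exact F3|reflexivity|auto]).
  assert (Z3 : forall a, ar s3 1%nat a = 0).
  { intros a. destruct F1 as [_ F1], F2 as [_ F2], F3 as [_ F3].
    now rewrite F3, F2, F1 by reflexivity. }
  assert (P3 : sc s3 p1x = dx (D 0) /\ sc s3 p1y = dy (D 0) /\ sc s3 p2x = dx (D j) /\
    sc s3 p2y = dy (D j)).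
  { destruct F2 as [F2 _], F3 as [F3 _]. rewrite !F3, !F2 by reflexivity. auto. }
  assert (P2 : sc s2 p1x = dx (D 0) /\ sc s2 p1y = dy (D 0) /\ sc s2 p2x = dx (D j) /\
    sc s2 p2y = dy (D j) /\ sc s2 far = sc s1 far).
  { destruct F2 as [F2 _]. rewrite !F2 by reflexivity. auto. }
  destruct P3 as (P1x & P1y & P2x & P2y). destruct P2 as (Q1x & Q1y & Q2x & Q2y & Qf).
  rewrite Q1x, Q1y, Q2x, Q2y, Qf, A5 in C3.
  set (R0 := sc s3 big) in *. pose proof (NR_ge N N_ge) as HN.
  assert (R0_pos : 0 < R0) by (pose proof (sqrt_pos (sc s2 sep)); lra).
  set (norm := norm_disk N (dx (D 0)) (dy (D 0)) (dx (D j)) (dy (D j)) R0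
    (sc s3 qx) (sc s3 qy) (sc s3 off)).
  assert (cases : far_case N (dx (D 0)) (dy (D 0)) (dx (D j)) (dy (D j)) R0
      (sc s3 qx) (sc s3 qy) (sc s3 off) \/
    near_case N (dx (D 0)) (dy (D 0)) (dx (D j)) (dy (D j)) R0
      (sc s3 qx) (sc s3 qy) (sc s3 off)) by (exact C3).
  assert (Hdmin : forall i, dmin D s1 i = Rmin (dist2 (dx (D i)) (dy (D i)) (dx (D 0)) (dy (D 0)))
    (dist2 (dx (D i)) (dy (D i)) (dx (D j)) (dy (D j)))).
  { intros i. unfold dmin. now rewrite A1, A2, A3, A4. }
  assert (cluster : forall i, (i < n)%nat ->
    let b := cl (dx (D 0)) (dy (D 0)) (dx (D j)) (dy (D j)) (dx (D i)) (dy (D i)) in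
    nrm (dx (D i) - px (dx (D 0)) (dx (D j)) b) (dy (D i) - py (dy (D 0)) (dy (D j)) b)
      + dr (D i) <= R0).
  { intros i Hi b. rewrite C1. apply Rplus_le_compat; [|now apply B5].
    apply sqrt_le_1_alt. eapply Rle_trans; [|now apply (B3 i)]. rewrite Hdmin.
    unfold b, cl, px, py, Rmin, dist2.
    destruct (Rlt_dec _ _), (Rle_dec _ _); lra. }
  assert (box : forall i, (i < n)%nat -> 0 < dr (norm (D i)) /\
    dr (norm (D i)) <= dx (norm (D i)) <= 12 * NR - dr (norm (D i)) /\
    dr (norm (D i)) <= dy (norm (D i)) <= 12 * NR - dr (norm (D i))).
  { intros i Hi. exact (norm_box N n D _ _ _ _ _ _ _ _ N_ge R0_pos D_pos cases cluster i Hi). }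
  pose proof (bucket_spec N n D N_ge n_pos s3 L3 C2 Z3) as G.
  fold R0 in G. rewrite P1x, P1y, P2x, P2y in G. fold norm in G.
  assert (G' : forall a b z, 0 <= z -> z < ar (run bucket s3) 1%nat (prn a b) <->
    exists i, (i < n)%nat /\ ridx (dx (norm (D i))) = a /\ ridx (dy (norm (D i))) = b /\
    z < (dr (norm (D i)) + 2) * (dr (norm (D i)) + 2)).
  { apply G. intros i Hi. destruct (box i Hi) as (K1 & K2 & K3). split; lra. }
  pose proof (raster_spec N n N_ge (run bucket s3) (fun i => norm (D i)) box G') as Hok.
  pose proof (run_frame n N bucket s3) as F4. set (s4 := run bucket s3) in *.
  pose proof (run_frame n N (transform 1 2) s4) as F5. set (s5 := run (transform 1 2) s4) in *.
  pose proof (run_frame n N (transform 2 3) s5) as F6. set (s6 := run (transform 2 3) s5) in *.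
  assert (K6 : forall v, mem_nat v (wsc bucket ++ wsc (transform 1 2)) = false ->
    sc s6 v = sc s3 v).
  { intros v Hv. apply mem_nat_app in Hv as [V1 V2].
    destruct F4 as [F4 _], F5 as [F5 _], F6 as [F6 _]. now rewrite F6, F5, F4. }
  destruct (search_spec N n (fun i => norm (D i)) N_ge box n_pos s6 Hok) as (S1 & S2 & S3).
  { rewrite !K6 by reflexivity. rewrite P2x, P2y, C2.
    exact (initial_cover N n D _ _ _ _ _ _ _ _ N_ge R0_pos D_pos cluster). }
  pose proof (run_frame n N search s6) as F7. set (s7 := run search s6) in *.
  assert (K7 : forall v, mem_nat v ((wsc bucket ++ wsc (transform 1 2)) ++ wsc search) = false ->
    sc s7 v = sc s3 v).
  { intros v Hv. apply mem_nat_app in Hv as [V1 V2]. destruct F7 as [F7 _].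
    rewrite F7 by auto. now apply K6. }
  destruct (finish_spec N n N_ge s7) as (E1 & E2 & E3 & E4 & E5 & E6).
  set (s8 := run finish s7) in *. clearbody s4 s5 s6 s7 s8.
  rewrite (K7 p1x), (K7 p1y), (K7 big), (K7 qx), (K7 qy), (K7 off) in * by reflexivity.
  rewrite P1x, P1y in *. fold R0 in E1, E2, E3, E4, E5.
  set (r := sc s7 o1r) in *.
  assert (Hscale : 0 < R0 / NR) by (apply Rdiv_lt_0_compat; lra).
  rewrite E6, E5. split; [nra|]. split; [auto|]. split.
  { rewrite E1, E2, E3, E4.
    exact (cover_back N n D _ _ _ _ _ _ _ _ N_ge R0_pos D_pos cases cluster _ _ _ _ _ S1 S2). }
  intros rho Hrho HF.
  (* R0 is the clustering radius plus the largest disk radius, each at most [2 * rho]. For the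
     former, [p1], [p2] and the center farthest from both are pairwise at least that far apart, by
     the choice of [p2]. *)
  assert (HR0 : R0 <= 4 * rho).
  { rewrite C1, B4. pose proof (feasible_radius rho i0 HF Hi0).
    enough (sqrt (sc s2 sep) <= 2 * rho) by lra.
    destruct B2 as [B2|(i & Hi & B2)]; [rewrite B2, sqrt_0; lra|].
    rewrite Hdmin in B2.
    apply (feasible_centers rho i 0 j); auto; apply sqrt_le_1_alt.
    - rewrite B2. apply Rmin_l.
    - rewrite B2. apply Rmin_r.
    - rewrite B2. eapply Rle_trans; [apply Rmin_l|].
      specialize (A6 i Hi). rewrite A5 in A6. unfold dist2 in *. lra. }
  assert (Hrs : r <= NR / R0 * rho + 132).
  (* [cover_forth] needs rho at most R0; beyond that, the initial radius N is already good
     enough. *)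
  { destruct (Rle_dec rho R0) as [Hle|Hgt].
    - destruct HF as (a1 & b1 & a2 & b2 & HF).
      pose proof (cover_forth N n D _ _ _ _ _ _ _ _ N_ge R0_pos D_pos cases cluster
        a1 b1 a2 b2 rho (conj Hrho Hle) HF) as HC.
      rewrite Rmult_comm. apply (S3 _ _ _ _ (rho * (NR / R0))) in HC; auto.
      apply Rmult_le_pos; auto. apply Rlt_le. apply Rdiv_lt_0_compat; lra.
    - assert (K : NR <= NR / R0 * rho); [|lra].
      apply Rle_trans with (NR / R0 * R0); [right; field; lra|].
      apply Rmult_le_compat_l; [|lra]. apply Rlt_le. apply Rdiv_lt_0_compat; lra. }
  apply Rle_trans with ((NR / R0 * rho + 132) * (R0 / NR)).
  { apply Rmult_le_compat_r; lra. }
  replace ((NR / R0 * rho + 132) * (R0 / NR)) with (rho + 132 / NR * R0) by (field; lra).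
  replace (rho * (1 + 528 / NR)) with (rho + 132 / NR * (4 * rho)) by (field; lra).
  apply Rplus_le_compat_l, Rmult_le_compat_l; auto. apply Rlt_le, Rdiv_lt_0_compat; lra.
Qed.
End Algorithm.

Lemma grid_lower eps : 0 < eps -> 1000 / eps <= INR (grid eps).
Proof.
  intros He. assert (H : 0 < 1000 / eps) by (apply Rdiv_lt_0_compat; lra).
  pose proof (ridx_bounds (1000 / eps)) as B. unfold grid.
  rewrite plus_INR. replace (INR 4) with 4 by (simpl; lra). lra.
Qed.

Lemma grid_cube eps : 0 < eps -> INR (grid eps) ^ 3 <= 4 * 1000 ^ 3 * (/ eps ^ 3 + 1).
Proof.
  intros He. assert (H : 0 < 1000 / eps) by (apply Rdiv_lt_0_compat; lra).
  pose proof (ridx_bounds (1000 / eps)) as B.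
  assert (HG : INR (grid eps) <= 1000 * (/ eps + 1)).
  { unfold grid. rewrite plus_INR. replace (INR 4) with 4 by (simpl; lra).
    unfold Rdiv in *. lra. }
  assert (Hx : 0 < / eps) by now apply Rinv_0_lt_compat.
  rewrite <- pow_inv. set (x := / eps) in *.
  apply Rle_trans with ((1000 * (x + 1)) ^ 3).
  - apply pow_incr. split; [apply pos_INR|auto].
  - rewrite Rpow_mult_distr.
    assert ((x + 1) ^ 3 <= 4 * (x ^ 3 + 1)); [|lra].
    assert (0 <= (x + 1) * ((x - 1) * (x - 1)))
      by (apply Rmult_le_pos; [lra|apply Rle_0_sqr]).
    enough (4 * (x ^ 3 + 1) - (x + 1) ^ 3 = 3 * ((x + 1) * ((x - 1) * (x - 1)))) by lra.
    ring.
Qed.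

Theorem theorem4 :
  exists (P : program) (c : R), 0 < c /\
    forall (Ds : list disk) (eps : R),
      (forall D, In D Ds -> 0 < dr D) ->
      no_containment Ds ->
      0 < eps ->
      exists (k : nat) (M : mem),
        runs_to P (input_mem Ds eps) k M /\
        INR k <= c * (INR (length Ds) + / eps ^ 3 + 1) /\
        dr (out_disk1 M) = dr (out_disk2 M) /\
        0 <= dr (out_disk1 M) /\
        covers2 Ds (out_disk1 M) (out_disk2 M) /\
        forall rstar, is_opt_two_cover_radius Ds rstar ->
          dr (out_disk1 M) <= (1 + eps) * rstar.
Proof.
  (* The cost is about 10^7 (n + N^3), and N^3 is at most 4 * 10^9 times 1 / eps^3 + 1. *)
  exists (compile two_center), (10 ^ 17). split; [lra|].
  intros Ds eps Hpos _ He.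
  assert (Hx : 0 < / eps ^ 3) by (apply Rinv_0_lt_compat; now apply pow_lt).
  destruct Ds as [|D0 Ds'] eqn:EDs.
  { destruct (compile_empty two_center eps He) as (M & HM & HZ).
    exists 2%nat, M. split; [auto|]. unfold out_disk1, out_disk2. cbn [dr length].
    rewrite !HZ by lia. simpl (INR 2). simpl (INR 0).
    split; [lra|]. split; [auto|]. split; [lra|]. split.
    - intros x y (D & [] & _).
    - intros rstar [[H _] _]. apply Rmult_le_pos; lra. }
  rewrite <- EDs in *. set (n := length Ds). set (N := grid eps).
  set (D := fun i => nth i Ds D0).
  assert (Hn : (1 <= n)%nat) by (unfold n; rewrite EDs; simpl; lia).
  assert (HN4 : (4 <= N)%nat) by (unfold N, grid; lia).
  destruct (compile_nonempty two_center Ds eps) as (k & M & s & HR & Hk & HM & Har); auto.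
  { rewrite EDs. discriminate. }
  fold n N in Hk, HM.
  assert (Dpos : forall i, (i < n)%nat -> 0 < dr (D i)).
  { intros i Hi. apply Hpos. now apply nth_In. }
  destruct (two_center_correct N n D s HN4 Hn Dpos) as (T1 & T2 & T3 & T4).
  { intros i Hi. destruct (input_mem_disk Ds eps i D0 Hi) as (E1 & E2 & E3).
    rewrite !Har by lia. unfold D. rewrite <- E1, <- E2, <- E3.
    split; [|split]; f_equal; lia. }
  { intros i. now rewrite Har by lia. }
  exists k, M. split; [auto|]. unfold out_disk1, out_disk2. cbn [dr].
  rewrite !HM by lia. split; [|split; [|split; [|split]]]; auto.
  - pose proof (two_center_cost n N ltac:(lia)) as HC.
    assert (K : (k <= 400 + 18 * n + 1000 * 1000 * 10 * (n + N * N * N))%nat) by lia.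
    apply le_INR in K. rewrite !plus_INR, !mult_INR, plus_INR, !mult_INR in K.
    pose proof (grid_cube eps He) as G. fold N in G.
    replace (INR 400) with 400 in K by (rewrite INR_IZR_INZ; reflexivity).
    replace (INR 18) with 18 in K by (rewrite INR_IZR_INZ; reflexivity).
    replace (INR 1000) with 1000 in K by (rewrite INR_IZR_INZ; reflexivity).
    replace (INR 10) with 10 in K by (rewrite INR_IZR_INZ; reflexivity).
    pose proof (pos_INR n). fold n. lra.
  - intros x y (C & HC & Hxy). apply (In_nth Ds C D0) in HC as (i & Hi & <-).
    destruct (T3 i x y Hi Hxy); [left|right]; apply in_disk_nrm; auto.
  - intros rstar [[H0 (x1 & y1 & x2 & y2 & Hcov)] _].
    eapply Rle_trans; [apply (T4 rstar); auto|].
    + exists x1, y1, x2, y2. intros i x y Hi Hxy.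
      destruct (Hcov x y) as [K|K].
      { exists (D i). split; [now apply nth_In|auto]. }
      * left. now apply (in_disk_nrm (Disk x1 y1 rstar)) in K.
      * right. now apply (in_disk_nrm (Disk x2 y2 rstar)) in K.
    + rewrite Rmult_comm. apply Rmult_le_compat_r; auto. apply Rplus_le_compat_l.
      pose proof (grid_lower eps He) as G. fold N in G. pose proof (NR_ge N HN4) as HN.
      apply Rmult_le_reg_r with (INR N); [lra|].
      replace (528 / INR N * INR N) with 528 by (field; lra).
      apply Rle_trans with (eps * (1000 / eps)).
      * replace (eps * (1000 / eps)) with 1000 by (field; lra). lra.
      * apply Rmult_le_compat_l; lra.
Qed.
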